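(* Let $b>0$, $1<p<\infty$, let $\Omega\subset\mathbb{R}^n$ be a domain, and let $f\in L^q_{\mathrm{loc}}(\Omega)$ with $n<q\le\infty$. Let $u$ be a convex weak solution to $$-b\,\operatorname{div}\left(\frac{\nabla u}{|\nabla u|}\right)-\operatorname{div}\left(|\nabla u|^{p-2}\nabla u\right)=f\quad\text{in }\Omega .$$ Then $u\in C^1(\Omega)$.
   Context: A domain is a nonempty connected open set. $\langle\cdot\mid\cdot\rangle$ is the standard inner product on $\mathbb{R}^n$. If $\Omega$ is not convex, ''convex'' for a function on $\Omega$ is understood as convex on every convex subset of $\Omega$. For $z\in\mathbb{R}^n$, $\partial|\cdot|(z)$ is the subdifferential of the Euclidean norm at $z$: it equals $\{z/|z|\}$ if $z\ne0$ and the closed unit ball if $z=0$. The vector $|z|^{p-2}z$ is understood as $0$ for $z=0$. Weak solution: $u\in W^{1,p}_{\mathrm{loc}}(\Omega)$ is a weak solution of the equation if for every bounded Lipschitz domain $\omega\Subset\Omega$ there exists $Z\in L^\infty(\omega,\mathbb{R}^n)$ such that $Z(x)\in\partial|\cdot|(\nabla u(x))$ for a.e. $x\in\omega$ and $$b\int_\omega\langle Z\mid\nabla\phi\rangle\,dx+\int_\omega\langle|\nabla u|^{p-2}\nabla u\mid\nabla\phi\rangle\,dx=\int_\omega f\phi\,dx\quad\text{for all }\phi\in W^{1,p}_0(\omega).$$ *)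

(* Defs.v *)
From HB Require Import structures.
From mathcomp Require Import all_boot all_order all_algebra.
From mathcomp Require Import all_classical all_reals all_analysis.

Set Implicit Arguments.
Unset Strict Implicit.
Unset Printing Implicit Defensive.

Import Order.TTheory GRing.Theory Num.Theory.
Import numFieldNormedType.Exports.

Local Open Scope classical_set_scope.
Local Open Scope ring_scope.

Definition rV_display : measure_display. Proof. exact. Qed.

(* The product sigma-algebra on R^n, generated by the coordinates, i.e. the
   Borel sigma-algebra. *)
Section rV_measurable.
Context {R : realType} (n : nat).

Definition rV_coord (i : 'I_n) (v : 'rV[R]_n) : measurableTypeR R := v ord0 i.

Let rV_set0 : g_sigma_preimage rV_coord set0.
Proof. exact: sigma_algebra0. Qed.

Let rV_setC A : g_sigma_preimage rV_coord A -> g_sigma_preimage rV_coord (~` A).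
Proof. exact: sigma_algebraC. Qed.

Let rV_bigcup (F : (set 'rV[R]_n)^nat) :
  (forall i, g_sigma_preimage rV_coord (F i)) ->
  g_sigma_preimage rV_coord (\bigcup_i (F i)).
Proof. exact: sigma_algebra_bigcup. Qed.

HB.instance Definition _ := @isMeasurable.Build rV_display 'rV[R]_n
  (g_sigma_preimage rV_coord) rV_set0 rV_setC rV_bigcup.

End rV_measurable.
Arguments rV_coord {R n}.

Section rV_lebesgue.
Context {R : realType}.
Local Notation RT := (measurableTypeR R).

Lemma measurable_rV_coord n (i : 'I_n) : measurable_fun [set: 'rV[R]_n] (rV_coord i).
Proof.
move=> _ Y mY; rewrite setTI; apply: sub_sigma_algebra => /=.
rewrite -bigcup_seq/=; exists i => /=; first by rewrite mem_index_enum.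
by exists Y => //; rewrite setTI.
Qed.

Lemma measurable_fun_rVP d (T : measurableType d) n (f : T -> 'rV[R]_n) :
  (forall i, measurable_fun [set: T] (rV_coord i \o f)) ->
  measurable_fun [set: T] f.
Proof.
move=> mf _ A mA; rewrite setTI.
have : preimage_set_system [set: T] f (g_sigma_preimage rV_coord) (f @^-1` A).
  by exists A => //; rewrite setTI.
rewrite -g_sigma_preimage_comp; apply: smallest_sub.
  exact: sigma_algebra_measurable.
rewrite -bigcup_seq => B [i _] [C mC <-]; exact: mf.
Qed.

Definition cons_rV n (x : RT * 'rV[R]_n) : 'rV[R]_n.+1 :=
  \row_i (if unlift ord0 i is Some j then x.2 ord0 j else x.1).

Definition uncons_rV n (v : 'rV[R]_n.+1) : RT * 'rV[R]_n :=
  (v ord0 ord0, \row_j v ord0 (lift ord0 j)).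

Lemma cons_rVK n : cancel (@cons_rV n) (@uncons_rV n).
Proof.
move=> [t v]; rewrite /uncons_rV mxE unlift_none /=; congr pair.
by apply/rowP => j; rewrite !mxE liftK.
Qed.

Lemma measurable_cons_rV n : measurable_fun [set: RT * 'rV[R]_n] (@cons_rV n).
Proof.
apply: measurable_fun_rVP => i.
have [j ->|->] := unliftP ord0 i.
  rewrite (_ : _ \o _ = rV_coord j \o snd); last first.
    by apply/funext => x; rewrite /rV_coord /= mxE liftK.
  exact: measurableT_comp (measurable_rV_coord j) _.
rewrite (_ : _ \o _ = fst) //.
by apply/funext => x; rewrite /rV_coord /= mxE unlift_none.
Qed.

Lemma measurable_uncons_rV n : measurable_fun [set: 'rV[R]_n.+1] (@uncons_rV n).
Proof.
apply/measurable_fun_pairP; split.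
  exact: (measurable_rV_coord ord0).
apply: measurable_fun_rVP => i.
rewrite (_ : _ \o _ = rV_coord (lift ord0 i)); first exact: measurable_rV_coord.
by apply/funext => x; rewrite /rV_coord /= mxE.
Qed.

Definition cons_measure n (mu : set 'rV[R]_n -> \bar R) :
    set 'rV[R]_n.+1 -> \bar R :=
  pushforward (@lebesgue_measure R \x mu)%E (@cons_rV n).

Section cons_measure.
Variables (n : nat) (mu : {sigma_finite_measure set 'rV[R]_n -> \bar R}).
Local Open Scope ereal_scope.

Let cons_measure0 : cons_measure mu set0 = 0.
Proof. by rewrite /cons_measure /pushforward preimage_set0 measure0. Qed.

Let cons_measure_ge0 A : 0 <= cons_measure mu A.
Proof. by rewrite /cons_measure /pushforward; exact: measure_ge0. Qed.

Let cons_measure_sigma_additive : semi_sigma_additive (cons_measure mu).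
Proof.
apply: measure_semi_sigma_additive; exact: measurable_cons_rV.
Qed.

HB.instance Definition _ := isMeasure.Build _ _ _ (cons_measure mu)
  cons_measure0 cons_measure_ge0 cons_measure_sigma_additive.

Let cons_measure_sigma_finite : sigma_finite setT (cons_measure mu).
Proof.
have /sigma_finiteP[F [TF ndF Foo]] := sigma_finiteT (@lebesgue_measure R).
have /sigma_finiteP[G [TG ndG Goo]] := sigma_finiteT mu.
exists (fun k => @uncons_rV n @^-1` (F k `*` G k)).
  rewrite -preimage_bigcup; apply/esym/seteqP; split => // v _ /=.
  have [i _ Fi] : (\bigcup_i F i) (v ord0 ord0) by rewrite -TF.
  have [j _ Gj] : (\bigcup_i G i) (uncons_rV v).2 by rewrite -TG.
  exists (maxn i j) => //; split => /=.
    by move: Fi; apply/subsetPset/ndF/leq_maxl.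
  by move: Gj; apply/subsetPset/ndG/leq_maxr.
move=> k; have [mF Fk] := Foo k; have [mG Gk] := Goo k; split.
  rewrite -[X in measurable X]setTI; apply: measurable_uncons_rV => //.
  exact: measurableX.
rewrite /cons_measure /pushforward -comp_preimage.
rewrite (_ : _ \o _ = id) ?preimage_id; last first.
  by apply/funext => x; exact: cons_rVK.
by rewrite product_measure1E// lte_mul_pinfty// ge0_fin_numE.
Qed.

HB.instance Definition _ := Measure_isSigmaFinite.Build _ _ _ (cons_measure mu)
  cons_measure_sigma_finite.

End cons_measure.

(* n-dimensional Lebesgue measure, as an iterated product. *)
Fixpoint lebesgue_rV n : set 'rV[R]_n -> \bar R :=
  match n with
  | 0 => dirac (0 : 'rV[R]_0)
  | m.+1 => cons_measure (@lebesgue_rV m)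
  end.
Arguments lebesgue_rV n : clear implicits.

Lemma lebesgue_rV_sigma_finite_measure n :
  exists mu : {sigma_finite_measure set 'rV[R]_n -> \bar R},
    lebesgue_rV n = mu.
Proof.
elim: n => [|n [mu /= ->]]; first by exists (dirac (0 : 'rV[R]_0)).
by exists (cons_measure mu).
Qed.

Section lebesgue_rV_instances.
Variable n : nat.
Local Open Scope ereal_scope.

Let lebesgue_rV0 : lebesgue_rV n set0 = 0.
Proof. by have [mu ->] := lebesgue_rV_sigma_finite_measure n. Qed.

Let lebesgue_rV_ge0 A : 0 <= lebesgue_rV n A.
Proof. by have [mu ->] := lebesgue_rV_sigma_finite_measure n. Qed.

Let lebesgue_rV_sigma_additive : semi_sigma_additive (lebesgue_rV n).
Proof.
have [mu ->] := lebesgue_rV_sigma_finite_measure n.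
exact: measure_semi_sigma_additive.
Qed.

HB.instance Definition _ := isMeasure.Build _ _ _ (lebesgue_rV n)
  lebesgue_rV0 lebesgue_rV_ge0 lebesgue_rV_sigma_additive.

Let lebesgue_rV_sigma_finite : sigma_finite setT (lebesgue_rV n).
Proof.
have [mu ->] := lebesgue_rV_sigma_finite_measure n.
exact: sigma_finiteT.
Qed.

HB.instance Definition _ := Measure_isSigmaFinite.Build _ _ _ (lebesgue_rV n)
  lebesgue_rV_sigma_finite.

End lebesgue_rV_instances.

Lemma lebesgue_rV_box n (A : 'I_n -> set RT) :
  (forall i, measurable (A i)) ->
  lebesgue_rV n [set v | forall i, A i (rV_coord i v)] =
  (\prod_(i < n) @lebesgue_measure R (A i))%E.
Proof.
elim: n A => [|n IHn] A mA.
  by rewrite big_ord0 /= diracE mem_set// => -[].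
have mB : measurable [set v : 'rV[R]_n | forall i, A (lift ord0 i) (rV_coord i v)].
  rewrite (_ : mkset _ = \bigcap_(i in [set: 'I_n])
     (rV_coord i @^-1` A (lift ord0 i))); last first.
    by apply/seteqP; split => v /= Av i; [move=> _|]; exact: Av.
  apply: fin_bigcap_measurable => // i _.
  by rewrite -[X in measurable X]setTI; exact: measurable_rV_coord.
rewrite big_ord_recl -IHn//= /cons_measure /pushforward.
rewrite -product_measure1E//; congr (_ _).
apply/seteqP; split => -[t v] /=.
  move=> h; split=> [|i]; first by have := h ord0; rewrite /rV_coord mxE unlift_none.
  by have := h (lift ord0 i); rewrite /rV_coord mxE liftK.
move=> [At Av] i; rewrite /rV_coord mxE.
by have [j ->|->] := unliftP ord0 i; rewrite ?liftK ?unlift_none//; exact: Av.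
Qed.

End rV_lebesgue.
Arguments lebesgue_rV {R} n.

Section definitions.
Context {R : realType} {n : nat}.
Local Notation E := 'rV[R]_n.
Local Notation mu := (@lebesgue_rV R n).
Implicit Types (O D : set E) (p : R) (q : \bar R) (f u phi : E -> R)
  (G Z : E -> E).

(* The library norm on 'rV[R]_n is the sup norm; it is used only through its
   topology and its bounded sets, which are the Euclidean ones. *)
Definition inner (v w : E) : R := \sum_i v ord0 i * w ord0 i.
Definition enorm (v : E) : R := Num.sqrt (inner v v).

Definition domain O := [/\ open O, connected O & O !=set0].

Definition compactly_contained D O := compact (closure D) /\ closure D `<=` O.

(* Near each boundary point, D is the strict epigraph of a Lipschitz function
   of the component orthogonal to e, in the direction of the unit vector e;
   gamma matters only on the hyperplane orthogonal to e. *)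
Definition lipschitz_boundary D :=
  forall x0 : E, (closure D `\` D^°) x0 ->
    exists r : R, exists e : E, exists gamma : E -> R, exists L : R,
      [/\ 0 < r, enorm e = 1,
          forall y z, `|gamma y - gamma z| <= L * enorm (y - z) &
          forall x, enorm (x - x0) < r ->
            (D x <-> gamma (x - inner x e *: e) < inner x e)].

Definition bounded_lipschitz_domain D :=
  [/\ domain D, bounded_set D & lipschitz_boundary D].

Definition convex_on O u :=
  forall A, convex_set A -> A `<=` O -> convex_function A u.

(* Elements of Lebesgue spaces are given by Borel measurable representatives;
   only the values on D matter. *)
Definition Lp D q f : Prop := f \_ D \in Lfun mu q.
Definition Lp_loc O q f := forall K, compact K -> K `<=` O -> Lp K q f.

Definition partial (i : 'I_n) phi : E -> R :=
  fun x => 'D_(delta_mx ord0 i) phi x.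

Definition smooth phi :=
  forall s : seq 'I_n, let psi := foldr partial phi s in
    continuous psi /\ forall i x, derivable psi x (delta_mx ord0 i).

Definition tsupport phi := closure [set x | phi x != 0].

Definition test_function O phi :=
  [/\ smooth phi, compact (tsupport phi) & tsupport phi `<=` O].

Definition weak_gradient O u G :=
  [/\ Lp_loc O 1%:E u,
      forall i, Lp_loc O 1%:E (fun x => G x ord0 i) &
      forall phi i, test_function O phi ->
        \int[mu]_(x in O) (u x * partial i phi x) =
        - \int[mu]_(x in O) (G x ord0 i * phi x)].

(* In the next three definitions, G is the weak gradient of u. *)
Definition W1p D p u G :=
  [/\ Lp D p%:E u, forall i, Lp D p%:E (fun x => G x ord0 i) &
      weak_gradient D u G].

Definition W1p_loc O p u G :=
  [/\ Lp_loc O p%:E u, forall i, Lp_loc O p%:E (fun x => G x ord0 i) &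
      weak_gradient O u G].

(* The closure of the test functions for the W^{1,p}(D) norm. *)
Definition W1p0 D p u G :=
  W1p D p u G /\
  exists phi : nat -> E -> R,
    [/\ forall k, test_function D (phi k),
        Lnorm mu p%:E (EFin \o ((fun x => phi k x - u x) \_ D))
          @[k --> \oo] --> 0%E &
        forall i,
        Lnorm mu p%:E
          (EFin \o ((fun x => partial i (phi k) x - G x ord0 i) \_ D))
          @[k --> \oo] --> 0%E].

Definition subdifferential (g : E -> R) (z : E) : set E :=
  [set w | forall y, g z + inner w (y - z) <= g y].

(* |z|^(p-2) z; it vanishes at z = 0 whatever the value of the power there. *)
Definition pflux p (z : E) : E := (enorm z `^ (p - 2)) *: z.

Definition weak_solution (b p : R) O f u :=
  exists2 G, W1p_loc O p u G &
    forall D, bounded_lipschitz_domain D -> compactly_contained D O ->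
    exists Z,
      [/\ forall i, Lp D +oo%E (fun x => Z x ord0 i),
          {ae mu, forall x, D x -> subdifferential enorm (G x) (Z x)} &
          forall phi Dphi, W1p0 D p phi Dphi ->
            b * (\int[mu]_(x in D) inner (Z x) (Dphi x)) +
            \int[mu]_(x in D) inner (pflux p (G x)) (Dphi x) =
            \int[mu]_(x in D) (f x * phi x)].

Definition C1_on O u :=
  forall x, O x -> differentiable u x /\
    forall i, {for x, continuous (partial i u)}.

End definitions.

(* Main.v *)
(* Near a point, [u] agrees with a convex function [U] that is Lipschitz on the
   whole space, and [u] is C^1 there as soon as all subdifferentials of [U] are
   singletons. Suppose that [xi + d] and [xi - d], with [d != 0], are subgradients
   of [U] at [x1]. Then, for [eta > 0], the convex function
     w x = U x - U x1 - <xi, x - x1> + eta |x - x1|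
   vanishes at [x1] and is at least |<d, x - x1>| + eta |x - x1|. Let psi be the
   positive part of eps - w. Integrating the gradient of psi^2 by parts against
   x - x1 and against <d, x - x1> d gives
     (n + 2) int psi^2 >= 2 eps int psi,   |d| int psi^2 <= 2 eps int psi |grad w|,
   hence |d| int psi <= (n + 2) int psi |grad w| for every small eps. Conversely,
   test the equation with psi^2 and subtract the constant flux at [xi]: by strict
   monotonicity of the flux, int psi |grad w| is at most a small multiple of
   int psi plus a multiple of eps int |f| psi. The last term is o(1) int psi as
   eps tends to 0, since int psi >= c eps^(n+1) and f is in L^q with q > n. This
   is a contradiction. *)

Require Import Defs.
From HB Require Import structures.
From mathcomp Require Import all_boot all_order all_algebra.
From mathcomp Require Import all_classical all_reals all_analysis.
From mathcomp Require Import measurable_realfun ess_sup_inf.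
From mathcomp Require Import ring lra zify.
Import Order.TTheory GRing.Theory Num.Theory.
Import numFieldNormedType.Exports.
Local Open Scope classical_set_scope.
Local Open Scope ring_scope.

Set Implicit Arguments.
Unset Strict Implicit.
Unset Printing Implicit Defensive.

(** * The Euclidean norm *)

(** The flux is multivalued where the gradient vanishes, and its [p]-part is degenerate there for
    [p > 2] and singular for [p < 2]. Hence no rate of ellipticity is used, only a gain [kappa > 0]
    at the single vector [xi], uniform over all gradients at distance at least [delta] from it;
    smaller distances are absorbed by [delta]. The cone [eta |x - x1|] is needed because
    [|<d, x - x1>|] does not grow in directions orthogonal to [d]; it confines [w < eps] to the ball
    of radius [eps / eta]. Its gradient perturbs the flux inequality by a multiple of [eta], so the
    constants are fixed in the order [delta], [Ck], [eta], [eps]. Squaring [psi] makes the test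
    function differentiable wherever [w] is, even on the level [w = eps], and leaves the weight
    [psi] in its gradient. Integration by parts rests on translation invariance and dominated
    convergence of difference quotients; applied to the one-sided partial derivatives of [U], it
    also identifies them with the weak gradient of [u]. *)

Lemma compact_continuous_bounded (T : topologicalType) (R : realType) (K : set T) (f : T -> R) :
  compact K -> continuous f -> exists M : R, 0 <= M /\ forall x, K x -> `|f x| <= M.
Proof.
move=> cK cf; have : bounded_set (f @` K).
  by apply: compact_bounded; apply: continuous_compact cK; exact: continuous_subspaceT.
move=> [B [_ hB]]; exists (`|B| + 1).
have B1 : B < `|B| + 1 by have := ler_norm B; lra.
by split => [|x Kx]; [exact: addr_ge0 | apply: (hB _ B1); exists x].
Qed.

Section euclid.
Context {R : realType} {n : nat}.
Implicit Types (u v w : 'rV[R]_n) (c : R).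

Lemma innerC v w : inner v w = inner w v.
Proof. by apply: eq_bigr => i _; rewrite mulrC. Qed.

Lemma innerDl u v w : inner (u + v) w = inner u w + inner v w.
Proof. by rewrite /inner -big_split; apply: eq_bigr => i _; rewrite mxE mulrDl. Qed.

Lemma innerZl c v w : inner (c *: v) w = c * inner v w.
Proof. by rewrite /inner mulr_sumr; apply: eq_bigr => i _; rewrite mxE mulrA. Qed.

Lemma innerDr u v w : inner u (v + w) = inner u v + inner u w.
Proof. by rewrite innerC innerDl !(innerC u). Qed.

Lemma innerZr c v w : inner v (c *: w) = c * inner v w.
Proof. by rewrite innerC innerZl innerC. Qed.

Lemma innerNl v w : inner (- v) w = - inner v w.
Proof. by rewrite -scaleN1r innerZl mulN1r. Qed.

Lemma innerNr v w : inner v (- w) = - inner v w.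
Proof. by rewrite innerC innerNl innerC. Qed.

Lemma innerBl u v w : inner (u - v) w = inner u w - inner v w.
Proof. by rewrite innerDl innerNl. Qed.

Lemma innerBr u v w : inner u (v - w) = inner u v - inner u w.
Proof. by rewrite innerDr innerNr. Qed.

Lemma inner0l v : inner 0 v = 0.
Proof. by rewrite -[0](scale0r (0 : 'rV[R]_n)) innerZl mul0r. Qed.

Lemma inner0r v : inner v 0 = 0.
Proof. by rewrite innerC inner0l. Qed.

Lemma inner_ge0 v : 0 <= inner v v.
Proof. by apply: sumr_ge0 => i _; rewrite -expr2 sqr_ge0. Qed.

Lemma inner_delta v i : inner v (delta_mx ord0 i) = v ord0 i.
Proof.
rewrite /inner (bigD1 i)//= mxE !eqxx mulr1 big1 ?addr0// => j ji.
by rewrite mxE (negbTE ji) andbF mulr0.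
Qed.

Lemma enorm_ge0 v : 0 <= enorm v.
Proof. exact: sqrtr_ge0. Qed.

Lemma enorm_sqr v : enorm v ^+ 2 = inner v v.
Proof. by rewrite sqr_sqrtr// inner_ge0. Qed.

Lemma enormE v : enorm v * enorm v = inner v v.
Proof. by rewrite -expr2 enorm_sqr. Qed.

Lemma enorm0 : enorm (0 : 'rV[R]_n) = 0.
Proof. by rewrite /enorm inner0l sqrtr0. Qed.

Lemma enormZ c v : enorm (c *: v) = `|c| * enorm v.
Proof.
by rewrite /enorm innerZl innerZr mulrA -expr2 sqrtrM ?sqr_ge0// sqrtr_sqr.
Qed.

Lemma enormN v : enorm (- v) = enorm v.
Proof. by rewrite -scaleN1r enormZ normrN1 mul1r. Qed.

Lemma enorm_distC v w : enorm (v - w) = enorm (w - v).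
Proof. by rewrite -enormN opprB. Qed.

Lemma coord_le_enorm v i : `|v ord0 i| <= enorm v.
Proof.
rewrite -sqrtr_sqr ler_sqrt ?inner_ge0// /inner (bigD1 i)//= -expr2 lerDl.
by apply: sumr_ge0 => j _; rewrite -expr2 sqr_ge0.
Qed.

Lemma enorm_eq0 v : enorm v = 0 -> v = 0.
Proof.
move=> v0; apply/rowP => i; rewrite mxE; apply/eqP.
by rewrite -normr_eq0 eq_le normr_ge0 andbT -v0 coord_le_enorm.
Qed.

Lemma enorm_gt0 v : v != 0 -> 0 < enorm v.
Proof.
move=> v0; rewrite lt_neqAle enorm_ge0 andbT eq_sym.
by apply: contra_neq v0; exact: enorm_eq0.
Qed.

(** The square of [|w| v - |v| w] expands to [2 |v| |w| (|v| |w| - <v, w>)], which is therefore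
    nonnegative. *)
Lemma cauchy_schwarz v w : inner v w <= enorm v * enorm w.
Proof.
have [->|v0] := eqVneq v 0; first by rewrite inner0l enorm0 mul0r.
have [->|w0] := eqVneq w 0; first by rewrite inner0r enorm0 mulr0.
have v1 := enorm_gt0 v0; have w1 := enorm_gt0 w0.
have := inner_ge0 ((enorm w) *: v - (enorm v) *: w).
rewrite innerBl !innerBr !innerZl !innerZr -!enormE (innerC w v) => h.
have : 0 <= (2 * (enorm v * enorm w)) * (enorm v * enorm w - inner v w).
  by apply: le_trans h _; rewrite le_eqVlt; apply/orP; left; apply/eqP; ring.
by rewrite pmulr_rge0 ?subr_ge0// !mulr_gt0.
Qed.

Lemma cauchy_schwarz_abs v w : `|inner v w| <= enorm v * enorm w.
Proof.
by rewrite ler_norml cauchy_schwarz andbT lerNl -innerNl -(enormN v) cauchy_schwarz.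
Qed.

Lemma enormD v w : enorm (v + w) <= enorm v + enorm w.
Proof.
rewrite -(@ler_pXn2r _ 2)// ?nnegrE ?addr_ge0 ?enorm_ge0//.
rewrite enorm_sqr sqrrD !enorm_sqr innerDl !innerDr (innerC w v).
by have := cauchy_schwarz v w; lra.
Qed.

Lemma enormB v w : enorm (v - w) <= enorm v + enorm w.
Proof. by rewrite -(enormN w) enormD. Qed.

Lemma enorm_triangle u v w : enorm (u - w) <= enorm (u - v) + enorm (v - w).
Proof. by rewrite -[u - w](subrKA v) enormD. Qed.

Lemma enorm_lipschitz v w : `|enorm v - enorm w| <= enorm (v - w).
Proof.
rewrite ler_norml; apply/andP; split.
  by have := enormD (w - v) v; rewrite subrK (enorm_distC w v); lra.
by have := enormD (v - w) w; rewrite subrK; lra.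
Qed.

Lemma enorm_delta i : enorm (delta_mx ord0 i : 'rV[R]_n) = 1.
Proof. by rewrite /enorm inner_delta mxE !eqxx sqrtr1. Qed.

Lemma coord_le_norm v i : `|v ord0 i| <= `|v|.
Proof.
rewrite [leRHS]/Num.Def.normr /= mx_normrE; apply: (le_bigmax _ _ (ord0, i)).
Qed.

Lemma norm_le_enorm v : `|v| <= enorm v.
Proof.
rewrite [leLHS]/Num.Def.normr /= mx_normrE; apply/bigmax_leP; split; first exact: enorm_ge0.
by move=> [i j] _ /=; rewrite ord1 coord_le_enorm.
Qed.

Lemma enorm_le_sum v : enorm v <= \sum_i `|v ord0 i|.
Proof.
rewrite [v in enorm v]row_sum_delta.
apply: (le_trans (y := \sum_i enorm (v ord0 i *: (delta_mx ord0 i : 'rV[R]_n)))).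
  elim/big_ind2 : _ => [|a b c d ab cd|i _]; rewrite ?enorm0//.
  by apply: le_trans (enormD _ _) _; exact: lerD.
by apply: ler_sum => i _; rewrite enormZ enorm_delta mulr1.
Qed.

Lemma enorm_le_coord v (s : R) : (forall i, `|v ord0 i| <= s) -> enorm v <= n%:R * s.
Proof.
move=> vs; apply: le_trans (enorm_le_sum v) _.
rewrite mulr_natl -[X in _ *+ X](card_ord n) -sumr_const.
by apply: ler_sum => i _; exact: vs.
Qed.

Lemma enorm_le_norm v : enorm v <= n%:R * `|v|.
Proof. by apply: enorm_le_coord => i; exact: coord_le_norm. Qed.

Lemma norm_delta i : `|delta_mx ord0 i : 'rV[R]_n| = 1.
Proof.
apply/eqP; rewrite eq_le -{1}(enorm_delta i) norm_le_enorm/=.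
by have := coord_le_norm (delta_mx ord0 i) i; rewrite mxE !eqxx normr1.
Qed.

Lemma norm_le_enormB v w : `|v| <= `|w| + enorm (v - w).
Proof.
rewrite -{1}[v](subrKC w); apply: le_trans (ler_normD _ _) _.
by rewrite lerD2l norm_le_enorm.
Qed.

Lemma enorm_step v i (t : R) : enorm (v + t *: delta_mx ord0 i - v) = `|t|.
Proof. by rewrite [v + _]addrC addrK enormZ enorm_delta mulr1. Qed.

(** Together with [nbhs_enorm], this makes Euclidean balls a neighbourhood base of the sup-norm
    topology; dividing by [n.+1] is safe in dimension 0. *)
Lemma enorm_near (x : 'rV[R]_n) (r : R) : 0 < r ->
  \forall y \near x, enorm (y - x) < r.
Proof.
move=> r0; apply/nbhs_ballP; exists (r / n.+1%:R) => /=; first by rewrite divr_gt0.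
move=> y; rewrite -ball_normE /ball_ /= => xy.
apply: le_lt_trans (enorm_le_norm _) _; rewrite distrC.
apply: le_lt_trans (_ : n.+1%:R * `|x - y| < r).
  by apply: ler_wpM2r => //; rewrite ler_nat.
by rewrite mulrC -ltr_pdivlMr.
Qed.

Lemma open_enorm (x : 'rV[R]_n) (r : R) : open [set y | enorm (y - x) < r].
Proof.
rewrite openE => y /= yr; rewrite /interior.
have r1 : 0 < r - enorm (y - x) by rewrite subr_gt0.
apply: filterS (enorm_near y r1) => z /=; rewrite ltrBrDr.
exact/le_lt_trans/enorm_triangle.
Qed.

Lemma nbhs_enorm (x : 'rV[R]_n) (A : set 'rV[R]_n) :
  nbhs x A -> exists2 r : R, 0 < r & [set y | enorm (y - x) < r] `<=` A.
Proof.
move=> /nbhs_ballP[r /= r0 rA]; exists r => // y /= yr; apply: rA.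
rewrite -ball_normE /ball_ /= distrC; exact: le_lt_trans (norm_le_enorm _) yr.
Qed.

Lemma lipschitz_continuous_enorm (phi : 'rV[R]_n -> R) (C : R) : 0 <= C ->
  (forall x y, `|phi y - phi x| <= C * enorm (y - x)) -> continuous phi.
Proof.
move=> C0 lphi x; apply/(@cvgrPdist_lt _ _ _ (nbhs x)) => e e0.
have C1 : 0 < C + 1 by apply: ltr_wpDl.
apply: filterS (enorm_near x (divr_gt0 e0 C1)) => y; rewrite ltr_pdivlMr// => h.
rewrite distrC; apply: le_lt_trans (lphi _ _) _; apply: le_lt_trans h.
by rewrite mulrC; apply: ler_wpM2l; [exact: enorm_ge0 | rewrite lerDl].
Qed.

Lemma enormB_continuous x0 : continuous (fun x : 'rV[R]_n => enorm (x - x0)).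
Proof.
apply: (lipschitz_continuous_enorm ler01) => x y; rewrite mul1r.
apply: le_trans (enorm_lipschitz _ _) _.
by rewrite (_ : _ - _ = y - x)// opprB addrA subrK.
Qed.

Lemma enorm_ball_compact (x : 'rV[R]_n) (r : R) : compact [set y | enorm (y - x) <= r].
Proof.
apply: bounded_closed_compact.
  exists (`|x| + r); split; first exact: num_real.
  move=> M M0 y /= yr; apply/ltW; apply: le_lt_trans M0.
  by apply: le_trans (norm_le_enormB y x) _; rewrite lerD2l.
have -> : [set y | enorm (y - x) <= r] = (fun y => enorm (y - x)) @^-1` [set t | t <= r].
  by [].
apply: preimage_closed; last exact: closed_le.
by move=> y _; exact: enormB_continuous.
Qed.

End euclid.

(** * Lipschitz extension of convex functions *)

Section convex_extension.
Context {R : realType} {n : nat}.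
Local Notation E := 'rV[R]_n.
Implicit Types (A : set E) (u U : E -> R) (v w x y : E) (L r : R).
Local Notation e_ i := (delta_mx ord0 i : E).

Definition convex_within A u := forall x y (t : R), A x -> A y -> 0 <= t -> t <= 1 ->
  u (t *: x + (1 - t) *: y) <= t * u x + (1 - t) * u y.

(** One-sided on purpose: exchanging [x] and [y] gives the other bound, as [lipschitz_abs]
    records. *)
Definition lipschitz_within A L u := forall x y, A x -> A y ->
  u x - u y <= L * enorm (x - y).

Lemma lipschitz_abs U L x y : lipschitz_within setT L U -> `|U x - U y| <= L * enorm (x - y).
Proof.
move=> lU; rewrite ler_norml (lU _ _ I I) andbT lerNl opprB enorm_distC; exact: lU.
Qed.

Lemma convex_enorm_ball x r (a b : E) (t : R) : enorm (a - x) < r -> enorm (b - x) < r ->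
  0 <= t -> t <= 1 -> enorm (t *: a + (1 - t) *: b - x) < r.
Proof.
move=> ar br t0 t1.
have -> : t *: a + (1 - t) *: b - x = t *: (a - x) + (1 - t) *: (b - x).
  by apply/rowP => i; rewrite !mxE; ring.
apply: le_lt_trans (enormD _ _) _; rewrite !enormZ (ger0_norm t0) ger0_norm ?subr_ge0//.
have [->|t_gt0] := eqVneq t 0; first by rewrite mul0r add0r subr0 mul1r.
have : t * enorm (a - x) < t * r by rewrite ltr_pM2l// lt_def t_gt0.
have : (1 - t) * enorm (b - x) <= (1 - t) * r by rewrite ler_wpM2l ?subr_ge0// ltW.
lra.
Qed.

Lemma convex_on_ball O u x r : convex_on O u -> [set y | enorm (y - x) < r] `<=` O ->
  convex_within [set y | enorm (y - x) < r] u.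
Proof.
move=> uO rO a b t /= ar br t0 t1.
have cB : convex_set [set y | enorm (y - x) < r].
  move=> c d s; rewrite !inE /= => cr dr; rewrite /conv/=.
  by apply: convex_enorm_ball => //; rewrite ?ge0 ?le1.
have := uO _ cB rO (Itv01 t0 t1) a b; rewrite !inE /= => /(_ ar br).
by rewrite /conv /= /conv /=.
Qed.

(** On each axis through [x], convexity bounds [u] by its values at [x + rho e_i] and [x - rho e_i].
    A vector supported on the first [k + 1] coordinates is the midpoint of a vector supported on the
    first [k] and one on an axis, both doubled; hence each coordinate costs a factor 2 in the
    radius. *)
Lemma convex_bounded_above u x r : 0 < r ->
  convex_within [set y | enorm (y - x) < r] u ->
  exists2 s : R, 0 < s & exists M : R, forall v, enorm v < s -> u (x + v) <= M.
Proof.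
move=> r0 cu.
(* Coordinates bounded by [rho] give a Euclidean norm of at most [n * rho < r]. *)
pose rho : R := r / n.+2%:R; have rho0 : 0 < rho by rewrite divr_gt0.
pose M : R := `|u x| + \sum_i (`|u (x + rho *: e_ i)| + `|u (x - rho *: e_ i)|).
have small v : (forall i, `|v ord0 i| <= rho) -> enorm (x + v - x) < r.
  move=> vr; rewrite addrC addKr; apply: le_lt_trans (enorm_le_coord vr) _.
  rewrite mulrC -mulrA gtr_pMr// mulrC ltr_pdivrMr//.
  by rewrite mul1r ltr_nat.
have smalle i (s : R) : `|s| <= rho -> enorm (x + s *: e_ i - x) < r.
  move=> sr; apply: (small (s *: e_ i)) => j; rewrite mxE mxE.
  by case: (_ && _); rewrite ?mulr1// mulr0 normr0 ltW.
have uM i (s : R) : `|s| <= rho -> u (x + s *: e_ i) <= M.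
  move=> sr; have /andP[s1 s2] : - rho <= s <= rho by rewrite -ler_norml.
  pose t := (s + rho) / (2 * rho).
  have t0 : 0 <= t by rewrite divr_ge0//; lra.
  have t1 : t <= 1 by rewrite ler_pdivrMr; lra.
  have := cu (x + rho *: e_ i) (x - rho *: e_ i) t _ _ t0 t1.
  have -> : t *: (x + rho *: e_ i) + (1 - t) *: (x - rho *: e_ i) = x + s *: e_ i.
    by apply/rowP => j; rewrite !mxE /t; field; lra.
  move=> h; apply: le_trans (h _ _) _.
  - by have /= := @smalle i rho; apply; rewrite (ger0_norm (ltW rho0)).
  - by have /= := @smalle i (- rho); rewrite scaleNr; apply; rewrite normrN (ger0_norm (ltW rho0)).
  - apply: (@le_trans _ _ (`|u (x + rho *: e_ i)| + `|u (x - rho *: e_ i)|)).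
      have a1 := ler_norm (u (x + rho *: e_ i)); have a2 := ler_norm (u (x - rho *: e_ i)).
      have a3 := normr_ge0 (u (x + rho *: e_ i)); have a4 := normr_ge0 (u (x - rho *: e_ i)).
      nra.
    rewrite /M (bigD1 i)//= addrCA lerDl; apply: addr_ge0 => //.
    by apply: sumr_ge0 => j _; exact: addr_ge0.
have main k v : (k <= n)%N -> (forall i : 'I_n, (k <= i)%N -> v ord0 i = 0) ->
    (forall i, `|v ord0 i| <= rho / 2 ^+ k) -> u (x + v) <= M.
  elim: k v => [|k IH] v kn v0 vk.
    have -> : v = 0 by apply/rowP => i; rewrite mxE v0.
    rewrite addr0 /M; apply: le_trans (ler_norm _) _; rewrite lerDl.
    by apply: sumr_ge0 => j _; rewrite addr_ge0.
  pose i : 'I_n := Ordinal kn.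
  pose v' := 2 *: (v - v ord0 i *: e_ i).
  have half : rho / 2 ^+ k.+1 = 2^-1 * (rho / 2 ^+ k).
    by rewrite exprS invfM; ring.
  have two : `|2 : R| = 2 by rewrite ger0_norm.
  have sv' j : `|v' ord0 j| <= rho / 2 ^+ k.
    rewrite !mxE normrM two; have [->|ji] := eqVneq j i.
      by rewrite !eqxx/= mulr1 subrr normr0 mulr0 divr_ge0 ?ltW// exprn_ge0.
    rewrite andbF mulr0 subr0; have := vk j; rewrite half; lra.
  have k1 : rho / 2 ^+ k <= rho.
    rewrite ler_pdivrMr ?exprn_gt0//; apply: ler_peMr; first exact: ltW.
    by apply: exprn_ege1; lra.
  have s2 : `|2 * v ord0 i| <= rho.
    apply: le_trans k1; rewrite normrM two; have := vk i; rewrite half; lra.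
  have h1 : (0 : R) <= 2^-1 by lra.
  have h2 : (2^-1 : R) <= 1 by lra.
  have := cu (x + v') (x + (2 * v ord0 i) *: e_ i) 2^-1 _ _ h1 h2.
  have -> : 2^-1 *: (x + v') + (1 - 2^-1) *: (x + (2 * v ord0 i) *: e_ i) = x + v.
    by apply/rowP => j; rewrite !mxE; lra.
  move=> h; apply: le_trans (h _ _) _.
  - have /= := @small v'; apply => j; exact: le_trans (sv' j) k1.
  - by have /= := @smalle i _ s2.
  - have a1 : u (x + v') <= M.
      apply: IH => // [|j kj]; first exact: ltnW.
      rewrite !mxE; have [->|ji] := eqVneq j i; first by rewrite !eqxx/= mulr1 subrr mulr0.
      rewrite andbF mulr0 subr0 v0 ?mulr0//.
      by rewrite ltn_neqAle kj andbT; apply: contra ji => /eqP kj'; apply/eqP/val_inj.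
    have a2 := uM i _ s2; lra.
exists (rho / 2 ^+ n); first by rewrite divr_gt0// exprn_gt0.
exists M => v vn; apply: (main n) => // [i|i]; first by rewrite leqNgt ltn_ord.
by apply/ltW; apply: le_lt_trans vn; exact: coord_le_enorm.
Qed.

(** Reflection through [x] turns the upper bound into a bound on the oscillation. For two points [a]
    and [b], prolonging the segment from [b] to [a] by [q / 2] beyond [a] and using convexity turns
    the oscillation into a slope bound. *)
Lemma convex_locally_lipschitz u x r : 0 < r ->
  convex_within [set y | enorm (y - x) < r] u ->
  exists2 s : R, 0 < s <= r & exists2 L : R, 0 <= L &
    lipschitz_within [set y | enorm (y - x) < s] L u.
Proof.
move=> r0 cu; have [s s0 [M uM]] := convex_bounded_above r0 cu.
pose q := Num.min s r; have q0 : 0 < q by rewrite lt_min s0.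
have qs : q <= s by rewrite ge_min lexx.
have qr : q <= r by rewrite ge_min lexx orbT.
have M0 : u x <= M by have := uM 0; rewrite addr0 enorm0; exact.
pose M' := 2 * (M - u x).
have half : (0 : R) <= 2^-1 /\ (2^-1 : R) <= 1 by split; lra.
have osc a b : enorm (a - x) < q -> enorm (b - x) < q -> u a - u b <= M'.
  move=> aq bq.
  have ua : u a <= M by have := uM (a - x); rewrite subrKC; apply; lra.
  have ub : u (x - (b - x)) <= M.
    by apply: uM; rewrite enormN; lra.
  have := cu b (x - (b - x)) 2^-1 _ _ half.1 half.2.
  have -> : 2^-1 *: b + (1 - 2^-1) *: (x - (b - x)) = x.
    by apply/rowP => j; rewrite !mxE; lra.
  move=> /(_ _ _)h.
  have : u x <= 2^-1 * u b + (1 - 2^-1) * u (x - (b - x)).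
    apply: h => /=; first lra.
    rewrite (_ : x - (b - x) - x = - (b - x)) ?enormN; first lra.
    by rewrite addrAC subrr add0r.
  rewrite /M'; lra.
have q20 : 0 < q / 2 by rewrite divr_gt0.
exists (q / 2); first by apply/andP; split => //; lra.
exists (M' / (q / 2)); first by rewrite divr_ge0// /M'; lra.
move=> a b /= aq bq; have [->|ab] := eqVneq a b.
  by rewrite !subrr enorm0 mulr0.
have ab0 : 0 < enorm (a - b) by rewrite enorm_gt0// subr_eq0.
pose d := enorm (a - b).
pose z := a + ((q / 2) / d) *: (a - b).
pose t := d / (d + q / 2).
have d0 : 0 < d by [].
have dq : 0 < d + q / 2 by rewrite addr_gt0.
have t0 : 0 <= t by rewrite divr_ge0 ?ltW.
have t1 : t <= 1 by rewrite ler_pdivrMr// mul1r; lra.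
have za : enorm (z - x) < q.
  rewrite /z addrAC; apply: le_lt_trans (enormD _ _) _.
  rewrite enormZ ger0_norm ?divr_ge0 ?ltW// -/d divfK ?gt_eqF//; lra.
have := cu z b t _ _ t0 t1.
have -> : t *: z + (1 - t) *: b = a.
  apply/rowP => j; rewrite !mxE /t; field.
  by rewrite !gt_eqF//; lra.
move=> h.
have {}h : u a <= t * u z + (1 - t) * u b by apply: h => /=; lra.
have zb := osc _ _ za (_ : enorm (b - x) < q).
have {}zb : u z - u b <= M' by apply: zb; lra.
have M'0 : 0 <= M' by rewrite /M'; lra.
apply: (@le_trans _ _ (t * M')).
  have : t * (u z - u b) <= t * M' by rewrite ler_wpM2l.
  lra.
rewrite [leLHS]mulrC -[leRHS]mulrA; apply: ler_wpM2l => //.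
rewrite [leRHS]mulrC; apply: ler_wpM2l; first exact: ltW.
by rewrite lef_pV2 ?posrE//; lra.
Qed.

(* Infimal convolution with [L * enorm] extends a Lipschitz function while
   preserving convexity. *)
Lemma convex_lipschitz_extension u x r L : 0 < r -> 0 <= L ->
  convex_within [set y | enorm (y - x) < r] u ->
  lipschitz_within [set y | enorm (y - x) < r] L u ->
  exists U, [/\ convex_within setT U, lipschitz_within setT L U &
    forall y, enorm (y - x) < r -> U y = u y].
Proof.
move=> r0 L0 cu lu.
pose B := [set y | enorm (y - x) < r].
have Bx : B x by rewrite /B /= subrr enorm0.
pose S z := [set u y + L * enorm (z - y) | y in B].
have lbS z : lbound (S z) (u x - L * enorm (z - x)).
  move=> _ [y By <-]; have := lu _ _ Bx By.
  have := ler_wpM2l L0 (enorm_triangle x z y); rewrite (enorm_distC x z); lra.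
have hS z : has_inf (S z).
  split; first by exists (u x + L * enorm (z - x)); exists x.
  by exists (u x - L * enorm (z - x)); exact: lbS.
pose U z := inf (S z).
have Ule z y : B y -> U z <= u y + L * enorm (z - y).
  by move=> By; apply: ge_inf; [exact: (hS z).2 | exists y].
have Uex z (e : R) : 0 < e -> exists2 y, B y & u y + L * enorm (z - y) < U z + e.
  by move=> e0; have [_ [y By <-] h] := inf_adherent e0 (hS z); exists y.
exists U; split.
- move=> z z' t _ _ t0 t1; apply/ler_addgt0Pr => e e0.
  have [y By yz] := Uex z e e0; have [y' By' yz'] := Uex z' e e0.
  have Byy : B (t *: y + (1 - t) *: y') by apply: convex_enorm_ball.
  apply: le_trans (Ule _ _ Byy) _.
  have h1 := cu _ _ _ By By' t0 t1.
  have h2 : L * enorm (t *: z + (1 - t) *: z' - (t *: y + (1 - t) *: y')) <=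
            t * (L * enorm (z - y)) + (1 - t) * (L * enorm (z' - y')).
    have -> : t *: z + (1 - t) *: z' - (t *: y + (1 - t) *: y') =
              t *: (z - y) + (1 - t) *: (z' - y').
      by apply/rowP => i; rewrite !mxE; ring.
    have := ler_wpM2l L0 (enormD (t *: (z - y)) ((1 - t) *: (z' - y'))).
    by rewrite !enormZ (ger0_norm t0) (@ger0_norm _ (1 - t)) ?subr_ge0//; lra.
  have h3 := ler_wpM2l t0 (ltW yz).
  have t1' : 0 <= 1 - t by lra.
  have h4 := ler_wpM2l t1' (ltW yz'); lra.
- move=> z z' _ _; rewrite lerBlDl; apply/ler_addgt0Pr => e e0.
  have [y By yz] := Uex z' e e0.
  apply: le_trans (Ule _ _ By) _.
  have := ler_wpM2l L0 (enorm_triangle z z' y); lra.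
- move=> y yr; apply/eqP; rewrite eq_le; apply/andP; split.
    by have := Ule y y yr; rewrite subrr enorm0 mulr0 addr0.
  apply: lb_le_inf; first by exists (u x + L * enorm (y - x)); exists x.
  by move=> _ [z Bz <-]; have := lu _ _ yr Bz; lra.
Qed.

Lemma convex_on_local_extension O u x : open O -> O x -> convex_on O u ->
  exists2 r : R, 0 < r & [set y | enorm (y - x) < r] `<=` O /\
  exists U, exists2 L : R, 0 <= L &
  [/\ convex_within setT U, lipschitz_within setT L U &
    forall y, enorm (y - x) < r -> U y = u y].
Proof.
move=> oO Ox cu.
have [r r0 rO] := nbhs_enorm (open_nbhs_nbhs (conj oO Ox)).
have cur := convex_on_ball cu rO.
have [s /andP[s0 sr] [L L0 lu]] := convex_locally_lipschitz r0 cur.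
exists s => //; split.
  by move=> y /= ys; apply: rO => /=; lra.
have cus : convex_within [set y | enorm (y - x) < s] u.
  by move=> a b t /= h1 h2; apply: cur => /=; lra.
have [U [U1 U2 U3]] := convex_lipschitz_extension s0 L0 cus lu.
by exists U, L.
Qed.

End convex_extension.

(** * Subgradients *)

Section subgradients.
Context {R : realType} {n : nat}.
Local Notation E := 'rV[R]_n.
Local Notation e_ i := (delta_mx ord0 i : E).
Variable U : E -> R.
Hypothesis cU : convex_within setT U.
Implicit Types (x y v xi zeta : E).

(* Hahn-Banach, one coordinate at a time. *)
Lemma subdifferential_nonempty x : subdifferential U x !=set0.
Proof.
suff main k : (k <= n)%N -> exists xi, forall v,
    (forall i : 'I_n, (k <= i)%N -> v ord0 i = 0) -> U x + inner xi v <= U (x + v).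
  have [xi h] := main n (leqnn n); exists xi => y; have := h (y - x); rewrite subrKC.
  by apply => i; rewrite leqNgt ltn_ord.
elim: k => [_|k IH kn].
  exists 0 => v v0; have -> : v = 0 by apply/rowP => i; rewrite mxE v0.
  by rewrite inner0r !addr0.
have [xi hxi] := IH (ltnW kn).
pose i : 'I_n := Ordinal kn.
pose V v := forall j : 'I_n, (k <= j)%N -> v ord0 j = 0.
(* The missing coordinate of the subgradient must lie above every left slope [a] and below every
   right slope [b]; [ab] shows that this leaves room. *)
pose a v s := (U x + inner xi v - U (x + v - s *: e_ i)) / s.
pose b v s := (U (x + v + s *: e_ i) - U x - inner xi v) / s.
have ab v1 s1 v2 s2 : V v1 -> V v2 -> 0 < s1 -> 0 < s2 -> a v1 s1 <= b v2 s2.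
  move=> V1 V2 s10 s20; rewrite /a /b ler_pdivrMr// mulrAC ler_pdivlMr//.
  have s12 : 0 < s1 + s2 by rewrite addr_gt0.
  (* With this weight the components along [e_i] cancel, so that the induction hypothesis applies to
     the convex combination. *)
  pose t := s2 / (s1 + s2).
  have t0 : 0 <= t by rewrite divr_ge0 ?ltW.
  have t1 : t <= 1 by rewrite ler_pdivrMr// mul1r lerDr ltW.
  have := cU (x := x + v1 - s1 *: e_ i) (y := x + v2 + s2 *: e_ i) I I t0 t1.
  have -> : t *: (x + v1 - s1 *: e_ i) + (1 - t) *: (x + v2 + s2 *: e_ i) =
            x + (t *: v1 + (1 - t) *: v2).
    by apply/rowP => j; rewrite !mxE /t; field; rewrite gt_eqF.
  have := hxi (t *: v1 + (1 - t) *: v2); rewrite innerDr !innerZr => h1 h2.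
  have {}h1 : V (t *: v1 + (1 - t) *: v2).
    by move=> j kj; rewrite !mxE V1// V2// !mulr0 addr0.
  have {h2} := le_trans (hxi _ h1) h2; rewrite innerDr !innerZr.
  rewrite -(ler_pM2r s12).
  have -> : (U x + (t * inner xi v1 + (1 - t) * inner xi v2)) * (s1 + s2) =
            U x * (s1 + s2) + s2 * inner xi v1 + s1 * inner xi v2.
    by rewrite /t; field; rewrite gt_eqF.
  have -> : (t * U (x + v1 - s1 *: e_ i) + (1 - t) * U (x + v2 + s2 *: e_ i)) * (s1 + s2) =
            s2 * U (x + v1 - s1 *: e_ i) + s1 * U (x + v2 + s2 *: e_ i).
    by rewrite /t; field; rewrite gt_eqF.
  lra.
have V0 : V 0 by move=> j _; rewrite mxE.
pose S := [set r | exists v s, [/\ V v, 0 < s & r = a v s]].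
have hS : has_sup S.
  split; first by exists (a 0 1), 0, 1.
  by exists (b 0 1) => _ [v [s [Vv s0 ->]]]; exact: ab.
pose t := sup S.
have at_ v s : V v -> 0 < s -> a v s <= t.
  by move=> Vv s0; apply: ub_le_sup; [exact: hS.2 | exists v, s].
have tb v s : V v -> 0 < s -> t <= b v s.
  move=> Vv s0; apply: ge_sup; first exact: hS.1.
  by move=> _ [v' [s' [Vv' s0' ->]]]; exact: ab.
exists (xi + (t - xi ord0 i) *: e_ i) => w w0.
pose s := w ord0 i; pose v := w - s *: e_ i.
have Vv : V v.
  move=> j kj; rewrite !mxE; have [->|ji] := eqVneq j i; first by rewrite !eqxx mulr1 subrr.
  rewrite andbF mulr0 subr0 w0// ltn_neqAle kj andbT.
  by apply: contra ji => /eqP kj'; apply/eqP/val_inj.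
have we : w = v + s *: e_ i by rewrite subrK.
have -> : inner (xi + (t - xi ord0 i) *: e_ i) w = inner xi v + t * s.
  rewrite innerDl innerZl (innerC (e_ i)) inner_delta [w in inner xi w]we innerDr.
  by rewrite innerZr inner_delta -/s; ring.
have [s0|s0|s0] := ltgtP s 0.
- have s0' : 0 < - s by rewrite oppr_gt0.
  have := at_ _ _ Vv s0'; rewrite /a ler_pdivrMr// scaleNr opprK -(addrA x v) -we; lra.
- by have := tb _ _ Vv s0; rewrite /b ler_pdivlMr// -(addrA x v) -we; lra.
- by have := hxi _ Vv; rewrite s0 mulr0 addr0 we s0 scale0r addr0.
Qed.

Lemma subdifferential_bounded L x xi : 0 <= L -> lipschitz_within setT L U ->
  subdifferential U x xi -> enorm xi <= L.
Proof.
move=> L0 lU h; have := h (x + xi); rewrite [x + xi - x]addrAC subrr add0r => h1.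
have := lU (x + xi) x I I; rewrite [x + xi - x]addrAC subrr add0r => h2.
have [->|xi0] := eqVneq xi 0; first by rewrite enorm0.
rewrite -(ler_pM2r (enorm_gt0 xi0)) enormE; lra.
Qed.

(** The graph of the subdifferential is closed, and compactness gives a cluster point of the bounded
    sequence [z]. The conclusion says that [z] comes near [xi] at arbitrarily large indices, which
    avoids extracting a subsequence. *)
Lemma subdifferential_cluster x (y z : nat -> E) :
  continuous U -> (exists L, forall k, enorm (z k) <= L) ->
  (forall k, subdifferential U (y k) (z k)) ->
  (forall k, enorm (y k - x) < k.+1%:R^-1) ->
  exists2 xi, subdifferential U x xi &
    forall (r : R) N, 0 < r -> exists2 k, (N <= k)%N & enorm (z k - xi) < r.
Proof.
move=> contU [L zL] yz yx.
have [xi [_ clxi]] : [set w | enorm (w - 0) <= L] `&` cluster (z @ \oo) !=set0.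
  apply: enorm_ball_compact; exists 0%N => // k _ /=; rewrite subr0; exact: zL.
have near_xi (r : R) N : 0 < r -> exists2 k, (N <= k)%N & enorm (z k - xi) < r.
  move=> r0; have := clxi [set z k | k in [set k | (N <= k)%N]] [set w | enorm (w - xi) < r].
  case; [by exists N => // k Nk; exists k | exact: enorm_near |].
  by move=> _ [[k Nk <-] kr]; exists k.
exists xi => // w; apply/ler_addgt0Pr => e e0.
(* Sized so that [(L + |w - x|) * (e / M) <= e / 3], the total error of replacing [y k] by [x] and
   [z k] by [xi] in the inner product. *)
pose M := 3 * (enorm (w - x) + 1 + L + enorm xi).
have wx0 := enorm_ge0 (w - x); have xi0 := enorm_ge0 xi.
have L0 : 0 <= L by apply: le_trans (zL 0%N); exact: enorm_ge0.
have M0 : 0 < M by rewrite /M; lra.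
have /nbhs_enorm[d d0 hd] : nbhs x [set y' | `|U x - U y'| < e / 3].
  by move/cvgrPdist_lt: (contU x); apply; rewrite divr_gt0.
have [N hN] : exists N, forall k, (N <= k)%N -> k.+1%:R^-1 < Num.min d (e / M).
  have m0 : 0 < Num.min d (e / M) by rewrite lt_min d0 divr_gt0.
  have [N _ hN] := near_infty_natSinv_lt (PosNum m0).
  by exists N => k Nk; exact: hN.
have eM : 0 < e / M by rewrite divr_gt0.
have [k Nk kr] := near_xi _ N eM.
have := hN _ Nk; rewrite lt_min => /andP[kd keM].
have Uk : `|U x - U (y k)| < e / 3 by apply: hd => /=; exact: lt_trans (yx k) kd.
have hk := yz k w.
have ykx : enorm (y k - x) <= e / M by apply/ltW/(lt_trans (yx k)).
have -> : inner xi (w - x) = inner (z k) (w - y k) + inner (z k) (y k - x) - inner (z k - xi) (w - x).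
  rewrite innerBl -innerDr addrA subrK; ring.
have h1 : inner (z k) (y k - x) <= L * (e / M).
  apply: le_trans (cauchy_schwarz _ _) _.
  by apply: ler_pM => //; exact: enorm_ge0.
have h2 : `|inner (z k - xi) (w - x)| <= (e / M) * enorm (w - x).
  apply: le_trans (cauchy_schwarz_abs _ _) _.
  by apply: ler_wpM2r => //; exact: ltW.
have h3 : L * (e / M) + (e / M) * enorm (w - x) <= e / 3.
  have -> : e / 3 = (e / M) * (M / 3) by field; rewrite gt_eqF.
  have -> : L * (e / M) + (e / M) * enorm (w - x) = (e / M) * (L + enorm (w - x)) by ring.
  by apply: ler_wpM2l; [exact: ltW | rewrite /M; lra].
have := ler_norm (U x - U (y k)); have := ler_norm (- inner (z k - xi) (w - x)).
rewrite normrN; lra.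
Qed.

Lemma lipschitz_continuous L : lipschitz_within setT L U -> continuous U.
Proof.
move=> lU; apply: (lipschitz_continuous_enorm (normr_ge0 L)) => x y.
apply: le_trans (lipschitz_abs _ _ lU) _.
by apply: ler_wpM2r; [exact: enorm_ge0 | exact: ler_norm].
Qed.

Variable L : R.
Hypothesis L0 : 0 <= L.
Hypothesis lU : lipschitz_within setT L U.

(** Frechet differentiability in epsilon-delta form for the Euclidean norm;
    [gradient_at_differentiable] converts it to the library notion. *)
Definition gradient_at (f : E -> R) x xi := forall e : R, 0 < e -> exists2 d : R, 0 < d &
  forall y, enorm (y - x) < d -> `|f y - f x - inner xi (y - x)| <= e * enorm (y - x).

(** Upper semicontinuity of the subdifferential: otherwise subgradients at points tending to [x]
    would cluster at a subgradient at [x] other than [xi]. It serves both the differentiability at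
    [x] and the continuity of the gradient. *)
Lemma unique_subgradient_near x xi :
  (forall zeta, subdifferential U x zeta -> zeta = xi) ->
  forall e : R, 0 < e -> exists2 d : R, 0 < d &
    forall y zeta, enorm (y - x) < d -> subdifferential U y zeta -> enorm (zeta - xi) < e.
Proof.
move=> uniq e e0; apply: contrapT => h.
have hk k : exists yz : E * E, [/\ enorm (yz.1 - x) < k.+1%:R^-1,
    subdifferential U yz.1 yz.2 & e <= enorm (yz.2 - xi)].
  apply: contrapT => hk; apply: h; exists k.+1%:R^-1 => // y z yk yz.
  by rewrite ltNge; apply/negP => ez; apply: hk; exists (y, z).
have [yz hyz] := choice hk.
have [|||k|xi' hxi' near_xi] :=
  @subdifferential_cluster x (fun k => (yz k).1) (fun k => (yz k).2).
- exact: lipschitz_continuous lU.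
- exists L => k; have [_ s _] := hyz k; exact: subdifferential_bounded s.
- by move=> k; have [] := hyz k.
- by have [] := hyz k.
have [k _] := near_xi e 0%N e0.
by rewrite (uniq _ hxi'); have [_ _] := hyz k; rewrite ltNge => ->.
Qed.

(** For a subgradient [zeta] at [y], the difference [U y - U x] lies between [<xi, y - x>] and
    [<zeta, y - x>], and [zeta] is close to [xi]. *)
Lemma unique_subgradient_gradient x xi : subdifferential U x xi ->
  (forall zeta, subdifferential U x zeta -> zeta = xi) -> gradient_at U x xi.
Proof.
move=> sxi uniq e e0; have [d d0 hd] := unique_subgradient_near uniq e0.
exists d => // y yd; have [zeta yz] := subdifferential_nonempty y.
have h1 := sxi y; have h2 := yz x.
rewrite -[x - y]opprB innerNr in h2.
rewrite ger0_norm; last lra.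
have h3 := cauchy_schwarz (zeta - xi) (y - x); rewrite innerBl in h3.
have h4 : enorm (zeta - xi) * enorm (y - x) <= e * enorm (y - x).
  by rewrite ler_wpM2r ?enorm_ge0// ltW// (hd y).
lra.
Qed.

End subgradients.

(** * Integrals of real-valued functions *)

Lemma Rintegral_dominated d (T : measurableType d) (R : realType)
    (mu : {measure set T -> \bar R}) (D : set T) (f_ : nat -> T -> R) (f g : T -> R) :
  measurable D ->
  (forall k, measurable_fun D (f_ k)) -> measurable_fun D f ->
  {ae mu, forall x, D x -> f_ k x @[k --> \oo] --> f x} ->
  mu.-integrable D (EFin \o g) ->
  {ae mu, forall x k, D x -> `|f_ k x| <= g x} ->
  mu.-integrable D (EFin \o f) /\
  \int[mu]_(x in D) f_ k x @[k --> \oo] --> \int[mu]_(x in D) f x.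
Proof.
move=> mD mf_ mf cf ig fg.
have [|||||intf _ cvgf] := @dominated_convergence _ _ _ mu D mD
   (fun k => EFin \o f_ k) (EFin \o f) (EFin \o g).
- by move=> k; exact/measurable_EFinP.
- exact/measurable_EFinP.
- by apply: filterS cf => x h Dx; apply: cvg_EFin; [exact: nearW|exact: h].
- exact: ig.
- by apply: filterS fg => x h k Dx; rewrite /= lee_fin; exact: h.
split => //; have : (\int[mu]_(x in D) (f x)%:E)%E \is a fin_num.
  exact: integrable_fin_num.
by move=> fin; apply: fine_cvg; rewrite /Rintegral fineK.
Qed.

Section Rintegral_tools.
Context {d} {T : measurableType d} {R : realType} (mu : {measure set T -> \bar R}).
Variables (D : set T) (mD : measurable D).
Implicit Types f g : T -> R.

Lemma bounded_integrable f (B : R) : (mu D < +oo)%E ->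
  measurable_fun D f -> (forall x, D x -> `|f x| <= B) -> mu.-integrable D (EFin \o f).
Proof.
move=> Doo mf fB; apply: measurable_bounded_integrable => //.
exists B; split => [|N BN x Dx]; first exact: num_real.
exact: le_trans (fB x Dx) (ltW BN).
Qed.

Lemma ae_bounded_integrable f (B : R) : (mu D < +oo)%E -> measurable_fun D f ->
  {ae mu, forall x, D x -> `|f x| <= B} -> mu.-integrable D (EFin \o f).
Proof.
move=> Doo mf fB; apply/integrableP; split; first exact/measurable_EFinP.
apply: (@le_lt_trans _ _ (\int[mu]_(x in D) (`|B|)%:E)%E).
  apply: ae_ge0_le_integral => //.
  - by apply: measurableT_comp => //; exact/measurable_EFinP.
  - by apply: filterS fB => x h Dx; rewrite lee_fin; apply: le_trans (h Dx) (ler_norm _).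
by rewrite integral_cst// lte_mul_pinfty ?lee_fin.
Qed.

Lemma Rintegral_ae_ge0 f : mu.-integrable D (EFin \o f) ->
  {ae mu, forall x, D x -> 0 <= f x} -> 0 <= \int[mu]_(x in D) f x.
Proof.
move=> /integrableP[/measurable_EFinP mf _] f0.
have -> : \int[mu]_(x in D) f x = \int[mu]_(x in D) `|f x|.
  congr fine; apply: ae_eq_integral => //; first exact/measurable_EFinP.
    by apply/measurable_EFinP; exact: measurableT_comp.
  by apply: filterS f0 => x h Dx; rewrite ger0_norm ?h.
by apply: Rintegral_ge0.
Qed.

Lemma Rintegral_ae_le f g : mu.-integrable D (EFin \o f) -> mu.-integrable D (EFin \o g) ->
  {ae mu, forall x, D x -> f x <= g x} ->
  \int[mu]_(x in D) f x <= \int[mu]_(x in D) g x.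
Proof.
move=> intf intg fg; rewrite -subr_ge0 -RintegralB//; apply: Rintegral_ae_ge0.
  exact: (integrableB mD intg intf).
by apply: filterS fg => x h Dx; rewrite subr_ge0; exact: h.
Qed.

Lemma integrable_sum_EFin I (s : seq I) (f : I -> T -> R) :
  (forall i, mu.-integrable D (EFin \o f i)) ->
  mu.-integrable D (EFin \o (fun x => \sum_(i <- s) f i x)).
Proof.
move=> intf; rewrite (_ : _ \o _ = fun x => (\sum_(i <- s) (f i x)%:E)%E).
  exact: (@integrable_sum _ _ _ mu D mD I s xpredT (fun i x => (f i x)%:E) (fun i _ => intf i)).
by apply/funext => x /=; rewrite sumEFin.
Qed.

Lemma Rintegral_sum I (s : seq I) (f : I -> T -> R) :
  (forall i, mu.-integrable D (EFin \o f i)) ->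
  \int[mu]_(x in D) (\sum_(i <- s) f i x) = \sum_(i <- s) \int[mu]_(x in D) f i x.
Proof.
move=> intf; elim: s => [|i s IH].
  by under eq_Rintegral do rewrite big_nil; rewrite big_nil Rintegral_cst// mul0r.
under eq_Rintegral do rewrite big_cons.
rewrite big_cons -IH RintegralD//; exact: integrable_sum_EFin.
Qed.

Lemma integrable_mul_bounded f g (M : R) :
  mu.-integrable D (EFin \o f) -> measurable_fun D g -> (forall x, D x -> `|g x| <= M) ->
  mu.-integrable D (EFin \o (fun x => f x * g x)).
Proof.
move=> fi mg gM; have mf : measurable_fun D f by apply/measurable_EFinP; have /integrableP[] := fi.
apply: (@le_integrable _ _ _ mu D mD _ (EFin \o (fun x => M * f x))).
- by apply/measurable_EFinP; exact: measurable_funM.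
- move=> x Dx; rewrite /= lee_fin !normrM mulrC; apply: ler_wpM2r => //.
  by apply: le_trans (gM x Dx) _; exact: ler_norm.
- exact: (integrableZl mD M fi).
Qed.

Lemma Rintegral_support f : (forall x, ~ D x -> f x = 0) ->
  \int[mu]_(x in D) f x = \int[mu]_x f x.
Proof.
move=> f0; rewrite Rintegral_mkcond; apply: eq_Rintegral => x _; rewrite patchE.
by case: ifPn => // /negP xD; rewrite f0// => Dx; apply: xD; rewrite inE.
Qed.

End Rintegral_tools.

(** * Boxes, Borel sets and translations *)

Section borel.
Context {R : realType} {n : nat}.
Local Notation E := 'rV[R]_n.
Local Notation mu := (@lebesgue_rV R n).
Implicit Types (a b v x : E) (K : set E).

Definition obox a b : set E := [set v | forall i, a ord0 i < v ord0 i < b ord0 i].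

Lemma oboxE a b : obox a b = [set v | forall i, `]a ord0 i, b ord0 i[%classic (rV_coord i v)].
Proof. by apply/seteqP; split => v h i; have := h i; rewrite /= in_itv. Qed.

Lemma measurable_obox a b : measurable (obox a b).
Proof.
rewrite (_ : obox a b = \bigcap_(i in [set: 'I_n])
     (rV_coord i @^-1` `]a ord0 i, b ord0 i[%classic)); last first.
  by rewrite oboxE; apply/seteqP; split => v /= Av i; [move=> _|]; exact: Av.
apply: fin_bigcap_measurable => // i _.
by rewrite -[X in measurable X]setTI; exact: measurable_rV_coord.
Qed.

Lemma obox_volume a b : (forall i, a ord0 i < b ord0 i) ->
  mu (obox a b) = (\prod_(i < n) (b ord0 i - a ord0 i))%:E.
Proof.
move=> ab; rewrite oboxE (@lebesgue_rV_box R n (fun i => `]a ord0 i, b ord0 i[%classic))//.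
rewrite -prodEFin.
by apply: eq_bigr => i _; rewrite lebesgue_measure_itv/= lte_fin ab EFinB.
Qed.

Lemma obox_empty a b i : b ord0 i <= a ord0 i -> obox a b = set0.
Proof.
move=> ba; apply/seteqP; split => // v /(_ i) /andP[av vb].
by have := lt_le_trans (lt_trans av vb) ba; rewrite ltxx.
Qed.

Lemma obox_cases a b : (forall i, a ord0 i < b ord0 i) \/ obox a b = set0.
Proof.
have [?|/existsNP[i /negP]] := pselect (forall i, a ord0 i < b ord0 i); first by left.
by rewrite -leNgt => ba; right; exact: obox_empty ba.
Qed.

Lemma obox_volume_lty a b : (mu (obox a b) < +oo)%E.
Proof.
have [ab|->] := obox_cases a b; first by rewrite obox_volume// ltry.
by rewrite measure0 ltry.
Qed.

Lemma oboxI a b c d : obox a b `&` obox c d =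
  obox (\row_i Num.max (a ord0 i) (c ord0 i)) (\row_i Num.min (b ord0 i) (d ord0 i)).
Proof.
apply/seteqP; split => v /=.
  move=> [h1 h2] i; rewrite !mxE gt_max lt_min.
  by have /andP[-> ->] := h1 i; have /andP[-> ->] := h2 i.
by move=> h; split => i; have := h i; rewrite !mxE gt_max lt_min;
  move=> /andP[/andP[h1 h2] /andP[h3 h4]]; apply/andP.
Qed.

Definition oboxes : set (set E) := [set A | exists a b, A = obox a b].

Lemma oboxes_setI : setI_closed oboxes.
Proof. by move=> _ _ [a [b ->]] [c [d ->]]; rewrite oboxI; do 2 eexists. Qed.

(** The half-spaces that generate the coordinate sigma-algebra are countable unions of boxes. Boxes
    are also stable under intersection, so measures and integrals can be compared on boxes alone. *)
Lemma measurable_oboxesE : @measurable _ E = <<s oboxes >>.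
Proof.
apply/seteqP; split; last first.
  apply: smallest_sub; first exact: sigma_algebra_measurable.
  by move=> _ [a [b ->]]; exact: measurable_obox.
apply: smallest_sub; first exact: smallest_sigma_algebra.
rewrite -bigcup_seq => B [i _] [C mC <-].
pose T := g_sigma_algebraType oboxes.
suff h : measurable_fun [set: T] (rV_coord i : T -> measurableTypeR R) by exact: h.
apply: (measurability _ (RGenOInfty.measurableE R)) => _ [_ [r ->] <-].
rewrite setTI.
have -> : rV_coord i @^-1` `]r, +oo[ = \bigcup_k
    (obox (\row_j if j == i then r else - k%:R) (\row_j k%:R) : set T).
  apply/seteqP; split => v /=; rewrite in_itv/= andbT.
    move=> rv; have [k kv] : exists k : nat, `|v| < k%:R.
      by exists (Num.truncn `|v|).+1; rewrite truncnS_gt.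
    exists k => // j; rewrite !mxE.
    have := le_lt_trans (coord_le_norm v j) kv; rewrite ltr_norml => /andP[kv1 kv2].
    by case: eqVneq kv1 kv2 => [->|_] kv1 kv2; apply/andP.
  by move=> [k _ /(_ i)]; rewrite !mxE eqxx => /andP[].
apply: bigcupT_measurable => k; apply: sub_sigma_algebra.
by do 2 eexists.
Qed.

Lemma bigcup_obox : \bigcup_k obox (const_mx (- k%:R)) (const_mx k%:R) = setT.
Proof.
apply/seteqP; split => // v _.
exists (Num.truncn `|v|).+1 => // j; rewrite !mxE -ltr_norml.
by apply: le_lt_trans (coord_le_norm v j) _; rewrite truncnS_gt.
Qed.

(** Measurability on ['rV[R]_n] is defined by coordinates, not by the topology; an open set is the
    countable union of the boxes with rational centre and half-side [1 / k.+1] that it contains. *)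
Lemma open_measurable_rV (A : set E) : open A -> measurable A.
Proof.
move=> oA.
pose C (p : 'rV[rat]_n * nat) : set E := obox (\row_i (ratr (p.1 ord0 i) - p.2.+1%:R^-1))
  (\row_i (ratr (p.1 ord0 i) + p.2.+1%:R^-1)).
pose B p := if `[< C p `<=` A >] then C p else set0.
have -> : A = \bigcup_p B p.
  apply/seteqP; split => [v Av|v [p _]]; last first.
    by rewrite /B; case: asboolP => // BA; exact: BA.
  have /nbhs_ballP[r /= r0 rA] := open_nbhs_nbhs (conj oA Av).
  have r20 : 0 < r / 2 by rewrite divr_gt0.
  have [k _ hk] := near_infty_natSinv_lt (PosNum r20).
  have {}hk : k.+1%:R^-1 < r / 2 by exact: hk (leqnn k).
  have hq i : exists q : rat, `|v ord0 i - ratr q| < k.+1%:R^-1.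
    have : v ord0 i - k.+1%:R^-1 < v ord0 i + k.+1%:R^-1.
      by rewrite ltrBlDr -addrA ltrDl addr_gt0 ?invr_gt0.
    move=> /rat_in_itvoo[q]; rewrite in_itv/= => /andP[q1 q2].
    exists q; rewrite ltr_norml.
    by move: (k.+1%:R^-1 : R) q1 q2 => d q1 q2; lra.
  have [q {}hq] := choice hq.
  exists (\row_i q i, k) => //; rewrite /B; case: asboolP => [_ i|].
    have := hq i; rewrite /= !mxE ltr_norml.
    by move: (k.+1%:R^-1 : R) => d /andP[h1 h2]; apply/andP; split; lra.
  case=> w wB; apply: rA; split => // j i; rewrite ord1.
  have := wB i; have := hq i; rewrite /= !mxE !ltr_norml.
  move: (k.+1%:R^-1 : R) hk => d hk /andP[h1 h2] /andP[h3 h4].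
  by rewrite -ball_normE /ball_ /= ltr_norml; apply/andP; split; lra.
apply: (@countable_bigcupT_measurable _ _ _ B); first exact: (@countableP (matrix rat 1 n * nat)%type).
by move=> p; rewrite /B; case: ifP => // _; exact: measurable_obox.
Qed.

Lemma continuous_measurable_rV (f : E -> R) : continuous f -> measurable_fun setT f.
Proof.
move=> /continuousP cf; apply: (measurability _ (RGenOpens.measurableE R)).
move=> _ [_ [a [b ->] <-]]; rewrite setTI; apply: open_measurable_rV; apply: cf.
exact: interval_open.
Qed.

Lemma measurable_shift (w : E) : measurable_fun setT (fun v : E => v + w).
Proof.
apply: measurable_fun_rVP => i.
rewrite (_ : _ \o _ = (fun v => rV_coord i v + w ord0 i)); last first.
  by apply/funext => v; rewrite /rV_coord /= mxE.
by apply: measurable_funD => //; exact: measurable_rV_coord.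
Qed.

(** Both measures agree on boxes, which form a generating pi-system and exhaust the space with
    finite measure. *)
Lemma lebesgue_rV_shift (w : E) (A : set E) : measurable A ->
  pushforward mu (fun v : E => v + w) A = mu A.
Proof.
move=> mA; pose nu : {measure set E -> \bar R} :=
  measure_function_pushforward__canonical__measure_function_Measure mu (measurable_shift w).
apply: (@measure_unique _ _ _ oboxes _ measurable_oboxesE oboxes_setI _ bigcup_obox nu mu)=> //.
- by move=> k; do 2 eexists.
- move=> _ [a [b ->]]; rewrite /nu /= /pushforward.
  have -> : (fun v => v + w) @^-1` obox a b = obox (a - w) (b - w).
    by apply/seteqP; split => v h i; have := h i; rewrite !mxE ltrBlDr ltrBrDr.
  have [ab|ab] := obox_cases a b.
    rewrite !obox_volume//; last by move=> i; rewrite !mxE ltrD2r.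
    by congr EFin; apply: eq_bigr => i _; rewrite !mxE; ring.
  have [ab'|->] := obox_cases (a - w) (b - w); last by rewrite ab.
  have : obox a b (2^-1 *: (a + b)).
    by move=> i; have := ab' i; rewrite !mxE; lra.
  by rewrite ab.
- move=> k; rewrite /nu /= /pushforward.
  have -> : (fun v => v + w) @^-1` obox (const_mx (- k%:R)) (const_mx k%:R) =
     obox (const_mx (- k%:R) - w) (const_mx k%:R - w).
    by apply/seteqP; split => v h i; have := h i; rewrite !mxE ltrBlDr ltrBrDr.
  exact: obox_volume_lty.
Qed.

Lemma compact_measurable_rV K : compact K -> measurable K.
Proof.
move=> cK; rewrite -[K]setCK; apply: measurableC; apply: open_measurable_rV.
by apply: closed_openC; apply: compact_closed => //; exact: norm_hausdorff.
Qed.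

Lemma bounded_measure_lty K (M : R) : measurable K -> (forall x, K x -> `|x| <= M) ->
  (mu K < +oo)%E.
Proof.
move=> mK KM; apply: le_lt_trans (obox_volume_lty (const_mx (- (`|M| + 1))) (const_mx (`|M| + 1))).
apply: le_measure; rewrite ?inE//; first exact: measurable_obox.
move=> x Kx i; rewrite !mxE -ltr_norml.
have := coord_le_norm x i; have := KM _ Kx; have := ler_norm M; lra.
Qed.

Lemma compact_measure_lty K : compact K -> (mu K < +oo)%E.
Proof.
move=> cK; have [M [_ hM]] := compact_bounded cK.
apply: (@bounded_measure_lty _ (`|M| + 1)); first exact: compact_measurable_rV.
by move=> x Kx; apply: (hM (`|M| + 1) _ x Kx); have := ler_norm M; lra.
Qed.

(** [Lnorm] with exponent [+oo] is the essential supremum only under this condition. *)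
Lemma lebesgue_rV_setT_gt0 : (0 < mu setT)%E.
Proof.
have lt01 i : (const_mx 0 : E) ord0 i < (const_mx 1 : E) ord0 i by rewrite !mxE.
apply: (@lt_le_trans _ _ (mu (obox (const_mx 0) (const_mx 1)))).
  by rewrite obox_volume// lte_fin; apply: prodr_gt0 => i _; rewrite subr_gt0.
by apply: le_measure; rewrite ?inE//; exact: measurable_obox.
Qed.

Lemma Lp_measurable K q (f : E -> R) : measurable K -> Lp K q f -> measurable_fun K f.
Proof.
move=> mK; rewrite /Lp inE => /andP[/[!inE]/= mf _].
by apply/(measurable_restrictT _ mK).
Qed.

Lemma Lp1_integrable K (f : E -> R) : measurable K -> Lp K 1%:E f -> mu.-integrable K (EFin \o f).
Proof.
move=> mK /Lfun1_integrable; rewrite -restrict_EFin => /(integrable_mkcond _ mK).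
exact.
Qed.

Lemma measurable_enorm_ball x1 (rho : R) : measurable [set x : E | enorm (x - x1) < rho].
Proof. by apply: open_measurable_rV; exact: open_enorm. Qed.

Lemma enorm_ball_measure_lty x1 (rho : R) : (mu [set x | (enorm (x - x1) < rho)%R] < +oo)%E.
Proof.
apply: (bounded_measure_lty (M := `|x1| + rho)); first exact: measurable_enorm_ball.
by move=> x /ltW hx; apply: le_trans (norm_le_enormB x x1) _; rewrite lerD2l.
Qed.

End borel.

(** * Integration by parts *)

Section integration.
Context {R : realType} {n : nat}.
Local Notation E := 'rV[R]_n.
Local Notation mu := (@lebesgue_rV R n).
Implicit Types (a b v x : E) (f : E -> R).

(** The same [M] bounds the values and the radius of the support. *)
Definition bounded_support f :=
  exists M : R, forall x, `|f x| <= M /\ (M < `|x| -> f x = 0).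

Lemma integrable_bounded_support f : measurable_fun setT f -> bounded_support f ->
  mu.-integrable setT (EFin \o f).
Proof.
move=> mf [M hM].
pose B := obox (const_mx (- (`|M| + 1))) (const_mx (`|M| + 1)) : set E.
have mB : measurable B by exact: measurable_obox.
have fB : f = f \_ B.
  apply/funext => x; rewrite patchE; case: ifPn => // /negP xB.
  apply: (hM x).2; rewrite ltNge; apply/negP => xM; apply: xB; rewrite inE => i.
  rewrite !mxE -ltr_norml; have := coord_le_norm x i; have := ler_norm M; lra.
rewrite fB (_ : EFin \o (f \_ B) = (EFin \o f) \_ B); last first.
  by rewrite restrict_EFin.
apply/(integrable_mkcond _ mB).
apply: (bounded_integrable mB (B := M)); first exact: obox_volume_lty.
  exact: measurable_funTS.
by move=> x _; exact: (hM x).1.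
Qed.

Lemma Rintegral_shift f (w : E) : measurable_fun setT f ->
  mu.-integrable setT (EFin \o (fun x => f (x + w))) ->
  \int[mu]_x f (x + w) = \int[mu]_x f x.
Proof.
move=> mf intf; congr fine.
have mEf : measurable_fun setT (EFin \o f) by exact/measurable_EFinP.
have := @integral_pushforward _ _ _ _ _ _ (measurable_shift w) mu setT (EFin \o f) mEf.
rewrite preimage_setT => /(_ intf measurableT) <-.
apply: eq_measure_integral; first exact: measurable_shift.
by move=> ? A mA _; exact: lebesgue_rV_shift.
Qed.

(** By translation invariance every difference quotient of [F] has integral 0, and the quotients are
    dominated by [C] on a bounded set. Only steps [s / k.+1] of one sign enter, so one-sided
    derivatives are allowed. *)
Lemma integration_by_parts_ae (F F' : E -> R) (i : 'I_n) (s C : R) :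
  `|s| = 1 -> measurable_fun setT F -> measurable_fun setT F' -> bounded_support F ->
  (forall x t, `|t| <= 1 -> `|F (x + t *: delta_mx ord0 i) - F x| <= C * `|t|) ->
  {ae mu, forall x, k.+1%:R * (F (x + (s / k.+1%:R) *: delta_mx ord0 i) - F x)
     @[k --> \oo] --> s * F' x} ->
  \int[mu]_x F' x = 0.
Proof.
move=> s1 mF mF' [M hM] lF aeF.
pose e := (delta_mx ord0 i : E).
pose f_ k x := k.+1%:R * (F (x + (s / k.+1%:R) *: e) - F x).
have M0 : 0 <= M by apply: le_trans (normr_ge0 _) (hM 0).1.
have C0 : 0 <= C by have := lF 0 1; rewrite normr1 mulr1 => /(_ (lexx _)); apply: le_trans.
have ne : `|e| = 1 by exact: norm_delta.
have small k : `|s / k.+1%:R| <= 1.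
  rewrite normrM s1 mul1r ger0_norm ?invr_ge0// invf_le1// ler1n//.
have mFs k : measurable_fun setT (fun x => F (x + (s / k.+1%:R) *: e)).
  exact: measurableT_comp mF (measurable_shift _).
have mf_ k : measurable_fun setT (f_ k).
  by apply: measurable_funM => //; apply: measurable_funB.
have supp x t : `|t| <= 1 -> M + 1 < `|x| -> F (x + t *: e) = 0.
  move=> t1 xM; apply: (hM _).2; have := ler_normB (x + t *: e) (t *: e).
  by rewrite addrK normrZ ne mulr1; lra.
have intFs k : mu.-integrable setT (EFin \o (fun x => F (x + (s / k.+1%:R) *: e))).
  apply: integrable_bounded_support => //; exists (M + 1) => x; split.
    by apply: le_trans (hM _).1 _; lra.
  by apply: supp.
have intF : mu.-integrable setT (EFin \o F).
  by apply: integrable_bounded_support => //; exists M.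
have f_0 k : \int[mu]_x f_ k x = 0.
  rewrite RintegralZl//; last first.
    exact: (integrableB measurableT (intFs k) intF).
  by rewrite RintegralB// Rintegral_shift// subrr mulr0.
pose B := [set x : E | `|x| <= M + 1].
have mB : measurable B.
  rewrite (_ : B = (fun x : E => `|x|) @^-1` `]-oo, M + 1]); last first.
    by apply/seteqP; split => x; rewrite /= in_itv.
  have mi : measurable (`]-oo, M + 1]%classic : set (measurableTypeR R)).
    exact: measurable_itv.
  rewrite -[X in measurable X]setTI.
  exact: (continuous_measurable_rV (@norm_continuous _ E) measurableT mi).
pose g x := C * \1_B x.
have mg : measurable_fun setT g.
  by apply: measurable_funM => //; exact: measurable_indic.
have intg : mu.-integrable setT (EFin \o g).
  apply: integrable_bounded_support => //; exists (M + 1 + C) => x; split.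
    by rewrite /g indicE normrM (ger0_norm C0); case: (_ \in _); rewrite ?normr1 ?normr0; lra.
  by move=> xM; rewrite /g indicE memNset ?mulr0// /B /=; lra.
have f_g k x : `|f_ k x| <= g x.
  rewrite /g indicE; have [xB|xB] := leP `|x| (M + 1).
    rewrite mem_set// mulr1 /f_ normrM ger0_norm//.
    rewrite -ler_pdivlMl//; apply: le_trans (lF _ _ (small k)) _.
    by rewrite normrM s1 mul1r ger0_norm ?invr_ge0// mulrC.
  rewrite memNset; last by rewrite /B /=; lra.
  have := supp x 0; rewrite normr0 scale0r addr0 => Fx.
  by rewrite mulr0 /f_ supp// Fx// subrr mulr0 normr0.
have [intsF' cv] := @Rintegral_dominated _ _ _ mu setT f_ (fun x => s * F' x) g
  measurableT mf_ (measurable_funM (measurable_cst _) mF')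
  (filterS (fun x h _ => h) aeF) intg (aeW _ (fun x k _ => f_g k x)).
have h0 : \int[mu]_x (s * F' x) = 0.
  apply: cvg_unique cv _ => //; rewrite (_ : (fun k => _) = fun=> 0).
    exact: cvg_cst.
  exact/funext.
have s0 : s != 0 by rewrite -normr_eq0 s1 oner_eq0.
rewrite (_ : F' = fun x => s^-1 * (s * F' x)); last first.
  by apply/funext => x; rewrite mulKf.
by rewrite RintegralZl// h0 mulr0.
Qed.

(** The sets whose intersection with the box carries integral 0 form a Dynkin system containing all
    boxes, hence all Borel sets. *)
Lemma integral_obox_ae_eq0 a b (h : E -> R) :
  mu.-integrable (obox a b) (EFin \o h) ->
  (forall c d, obox c d `<=` obox a b -> \int[mu]_(x in obox c d) h x = 0) ->
  {ae mu, forall x, obox a b x -> h x = 0}.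
Proof.
move=> ih h0; pose D := obox a b; have mD : measurable D by exact: measurable_obox.
have ihA A : measurable A -> mu.-integrable (D `&` A) (EFin \o h).
  by move=> mA; apply: integrableS ih => //; exact: measurableI.
have fin A : measurable A -> (\int[mu]_(x in D `&` A) (h x)%:E)%E \is a fin_num.
  by move=> mA; apply: integrable_fin_num; [exact: measurableI | exact: ihA].
have key A : measurable A -> (\int[mu]_(x in D `&` A) (h x)%:E = 0)%E.
  rewrite measurable_oboxesE => gA.
  apply: (@dynkin_induction _ _ oboxes (fun A => \int[mu]_(x in D `&` A) (h x)%:E = 0)%E) gA.
  - exact: measurable_oboxesE.
  - exact: oboxes_setI.
  - have := h0 a b (@subset_refl _ _); rewrite /Rintegral setIT => h1.
    by rewrite -(fineK (integrable_fin_num mD ih)) h1.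
  - move=> _ [c [d ->]].
    have := h0 (\row_i Num.max (a ord0 i) (c ord0 i)) (\row_i Num.min (b ord0 i) (d ord0 i)).
    rewrite -oboxI => /(_ (@subIsetl _ _ _)); rewrite /Rintegral => h1.
    by rewrite -(fineK (fin _ (measurable_obox c d))) h1.
  - move=> S mS hS.
    have hD : (\int[mu]_(x in D) (h x)%:E = 0)%E.
      have := h0 a b (@subset_refl _ _); rewrite /Rintegral => h1.
      by rewrite -(fineK (integrable_fin_num mD ih)) h1.
    have DS : D = (D `&` S) `|` (D `&` ~` S) by rewrite -setIUr setUv setIT.
    move: hD; rewrite DS integral_setU//=.
    + by rewrite -!DS hS add0e.
    + exact: measurableI.
    + by apply: measurableI => //; exact: measurableC.
    + by rewrite -DS; have /integrableP[] := ih.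
    + rewrite disj_set2E; apply/eqP; rewrite setIACA setICr setI0//.
  - move=> F mF tF hF; rewrite setI_bigcupr integral_bigcup//.
    + by rewrite (eq_eseriesr (g := fun=> 0%E)) ?eseries0.
    + apply: trivIset_setIl => //.
    + by move=> k; exact: measurableI.
    + by rewrite -setI_bigcupr; apply: ihA; exact: bigcupT_measurable.
have : ae_eq mu D (EFin \o h) (cst 0%E).
  apply: integral_ae_eq => // A AD mA; rewrite integral0.
  by have := key _ mA; rewrite setIidr.
by apply: filterS => x + Dx => /(_ Dx) [].
Qed.

End integration.

(** * Approximation of Lipschitz functions by test functions *)

Section smooth_real.
Context {R : realType}.
Implicit Types (f g : R -> R) (k : nat).

(** [smooth1 k f] means that [f] is of class C^k. Carrying the derivative as a witness lets the
    closure properties be proved by induction on [k]. *)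
Fixpoint smooth1 k f : Prop :=
  if k is k'.+1 then
    exists2 f' : R -> R, (forall x : R, is_derive x 1 f (f' x)) & smooth1 k' f'
  else continuous f.

Definition smooth_fun f := forall k, smooth1 k f.

Lemma is_derive_continuous f (f' : R -> R) : (forall x : R, is_derive x 1 f (f' x)) -> continuous f.
Proof.
move=> df x; apply/differentiable_continuous/derivable1_diffP.
by have [] := df x.
Qed.

Lemma smooth1W k f : smooth1 k.+1 f -> smooth1 k f.
Proof.
elim: k f => [|k IH] f [f' df sf']; first exact: is_derive_continuous df.
by exists f' => //; exact: IH.
Qed.

Lemma smooth1_cst k (c : R) : smooth1 k (fun=> c).
Proof.
elim: k c => [|k IH] c /=; first by move=> x; exact: cvg_cst.
by exists (fun=> 0) => // x; exact: is_derive_cst.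
Qed.

Lemma smooth1_id k : smooth1 k (fun x => x).
Proof.
case: k => [|k] /=; first by move=> x; exact: cvg_id.
exists (fun=> 1); last exact: smooth1_cst.
by move=> x; exact: is_derive_id.
Qed.

Lemma smooth1D k f g : smooth1 k f -> smooth1 k g -> smooth1 k (fun x => f x + g x).
Proof.
elim: k f g => [|k IH] f g /=; first by move=> cf cg x; apply: cvgD; [exact: cf|exact: cg].
move=> [f' df sf] [g' dg sg]; exists (fun x => f' x + g' x); last exact: IH.
by move=> x; exact: is_deriveD.
Qed.

Lemma smooth1M k f g : smooth1 k f -> smooth1 k g -> smooth1 k (fun x => f x * g x).
Proof.
elim: k f g => [|k IH] f g; first by move=> cf cg x; apply: cvgM; [exact: cf|exact: cg].
move=> sf sg; have sf' := smooth1W sf; have sg' := smooth1W sg.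
case: sf sg => [f' df sf] [g' dg sg].
exists (fun x => f x * g' x + g x * f' x); last by apply: smooth1D; exact: IH.
by move=> x; exact: is_deriveM.
Qed.

Lemma smooth1V k f : (forall x, f x != 0) -> smooth1 k f -> smooth1 k (fun x => (f x)^-1).
Proof.
move=> f0; elim: k => [|k IH]; first by move=> cf x; apply: cvgV; [exact: f0|exact: cf].
move=> sf; have sfk := smooth1W sf; case: sf => f' df sf'.
exists (fun x => - 1 * (((f x)^-1 * (f x)^-1) * f' x)).
  move=> x; have [d1 d2] := df x; split; first exact: derivableV.
  by rewrite deriveV// d2 /GRing.scale/= expr2 invfM; ring.
by apply: smooth1M; [exact: smooth1_cst | apply: smooth1M => //; apply: smooth1M; exact: IH].
Qed.

Lemma is_derive_affine f (f' a b x : R) : is_derive (a * x + b) 1 f f' ->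
  is_derive x 1 (fun t => f (a * t + b)) (a * f').
Proof.
move=> df.
have da : is_derive x 1 (fun t => a * t + b) a.
  have h : is_derive x 1 ((a \*: (@id R)) + cst b) (a *: 1 + 0).
    by apply: is_deriveD.
  by rewrite /GRing.scale /= mulr1 addr0 in h.
have := @is_derive1_comp R f (fun t => a * t + b) x f' a df da.
by rewrite mulrC.
Qed.

Lemma smooth1_affine k f (a b : R) : smooth1 k f -> smooth1 k (fun x => f (a * x + b)).
Proof.
elim: k f => [|k IH] f.
  move=> cf x; apply: (@continuous_comp _ _ _ (fun x => a * x + b) f); last exact: cf.
  by apply: cvgD; [apply: cvgM; [exact: cvg_cst|exact: cvg_id]|exact: cvg_cst].
move=> [f' df sf]; exists (fun x => a * f' (a * x + b)).
  by move=> x; exact: is_derive_affine.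
by apply: smooth1M; [exact: smooth1_cst | exact: IH].
Qed.

(** The exponent [m] makes the family stable under differentiation: the derivative of a member is a
    combination of two others, so all are smooth at once. *)
Definition flat m (t : R) : R := if 0 < t then t ^- m * expR (- t^-1) else 0.

Lemma flat_ge0 m t : 0 <= flat m t.
Proof.
rewrite /flat; case: ifPn => // t0.
by rewrite mulr_ge0 ?expR_ge0// invr_ge0 exprn_ge0// ltW.
Qed.

(** From [1 + s <= exp s] at [s = 1 / ((m + 1) t)], raised to the power [m + 1]. This linear bound,
    applied to [flat m.+1], gives the derivative 0 of [flat m] at the origin. *)
Lemma flat_le m t : flat m t <= m.+1%:R ^+ m.+1 * `|t|.
Proof.
rewrite /flat; case: ifPn => [t0|_]; last by rewrite mulr_ge0// exprn_ge0.
have h : (t^-1 / m.+1%:R) ^+ m.+1 <= expR t^-1.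
  have -> : expR t^-1 = expR (t^-1 / m.+1%:R) ^+ m.+1.
    by rewrite -expRM_natl mulrC divfK// pnatr_eq0.
  apply: lerXn2r; rewrite ?nnegrE ?expR_ge0//; first by rewrite divr_ge0// invr_ge0 ltW.
  by apply: le_trans (expR_ge1Dx _); rewrite lerDr.
rewrite (gtr0_norm t0) expRN ler_pdivrMr ?expR_gt0//.
apply: (le_trans (y := m.+1%:R ^+ m.+1 * t * (t^-1 / m.+1%:R) ^+ m.+1)); last first.
  by apply: ler_wpM2l => //; rewrite mulr_ge0 ?exprn_ge0// ltW.
have t_neq0 : t != 0 by rewrite gt_eqF.
have B0 : (m.+1%:R ^+ m.+1 : R) != 0 by rewrite expf_neq0// pnatr_eq0.
have tm0 : t ^+ m != 0 by rewrite expf_neq0.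
rewrite expr_div_n exprVn [t ^+ m.+1]exprS le_eqVlt; apply/orP; left; apply/eqP.
move: (m.+1%:R ^+ m.+1 : R) B0 (t ^+ m) tm0 => B B0 a a0.
by field; rewrite a0 B0 t_neq0.
Qed.

Lemma flatS m t : flat m t = t * flat m.+1 t.
Proof.
rewrite /flat; case: ifPn => [t0|_]; last by rewrite mulr0.
by rewrite exprS invfM mulrA mulrA divff ?mul1r// gt_eqF.
Qed.

Lemma is_derive_flat m (t : R) : is_derive t 1 (flat m) (flat m.+2 t - m%:R * flat m.+1 t).
Proof.
have [t0|t0|->] := ltgtP t 0.
- have -> : flat m.+2 t - m%:R * flat m.+1 t = 0.
    by rewrite /flat ltNge (ltW t0)/= mulr0 subrr.
  apply: (@near_eq_is_derive R R R (cst 0)).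
  near=> s; rewrite /flat ifF//; apply/negbTE; rewrite -leNgt ltW//.
  by near: s; exact: lt_nbhsl.
- apply: (@near_eq_is_derive R R R (fun s => s ^- m * expR (- s^-1))).
    near=> s; rewrite /flat ifT//.
    by near: s; exact: lt_nbhsr.
  rewrite /flat t0.
  have t_neq0 : t != 0 by rewrite gt_eqF.
  have d1 : is_derive t 1 (fun s : R => s^-1) (- t ^- 2).
    have [e1 e2] := @is_derive_id R R t 1; split; first exact: derivableV.
    by rewrite deriveV// e2 /GRing.scale/= mulr1.
  have d2 : is_derive t 1 (fun s : R => - s^-1) (t ^- 2).
    by have := is_deriveN d1; rewrite opprK.
  have d3 : is_derive t 1 (fun s : R => expR (- s^-1)) (expR (- t^-1) * t ^- 2).
    exact: (@is_derive1_comp R expR (fun s => - s^-1) t _ _ (is_derive_expR _) d2).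
  have d4 : is_derive t 1 (fun s : R => s ^- m) (- m%:R * t ^- m.+1).
    have d5 : is_derive t 1 (fun s : R => (s ^-1) ^+ m) ((m%:R * t^-1 ^+ m.-1) *: - t ^- 2).
      by have := is_deriveX m d1; rewrite exprfctE.
    have -> : - m%:R * t ^- m.+1 = (m%:R * t^-1 ^+ m.-1) *: - t ^- 2 :> R.
      rewrite /GRing.scale /= -!exprVn; case: m {d5} => [|m]/=; first by rewrite !mulNr !mul0r !oppr0.
      by rewrite mulNr mulrN -mulrA -exprD addn2.
    by under [X in is_derive _ _ X]eq_fun do rewrite -exprVn.
  have d5 : is_derive t 1 (fun s : R => s ^- m * expR (- s^-1)) _ := is_deriveM d4 d3.
  apply: (is_derive_eq d5).
  rewrite /GRing.scale /= -!exprVn; set a := t^-1; set E := expR _.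
  have -> : a ^+ m.+2 = a ^+ m * a ^+ 2 by rewrite -exprD addn2.
  ring.
(* At the origin the difference quotient of [flat m] is [flat m.+1] itself, by [flatS]. *)
- have f0 k : flat k 0 = 0 by rewrite /flat ltxx.
  rewrite !f0 mulr0 subrr.
  suff h : (fun h => h^-1 *: ((flat m \o shift 0) (h *: 1) - flat m 0)) @ 0^' --> (0 : R).
    by split; [apply/cvg_ex; exists 0 | exact: cvg_lim h].
  apply/cvgrPdist_lt => e e0.
  pose C := m.+2%:R ^+ m.+2 : R.
  have C0 : 0 < C by rewrite exprn_gt0.
  near=> h; rewrite f0 subr0 /= addr0 sub0r normrN /GRing.scale /= mulr1 flatS mulKf; last first.
    by near: h; exact: nbhs_dnbhs_neq.
  rewrite ger0_norm ?flat_ge0//; apply: le_lt_trans (flat_le _ _) _.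
  rewrite -ltr_pdivlMl//; near: h; apply: dnbhs0_lt.
  by rewrite mulr_gt0// invr_gt0.
Unshelve. all: by end_near. Qed.

Lemma smooth_flat m : smooth_fun (flat m).
Proof.
move=> k; elim: k m => [|k IH] m; first by apply: is_derive_continuous => x; exact: is_derive_flat.
exists (fun t => flat m.+2 t - m%:R * flat m.+1 t); first exact: is_derive_flat.
rewrite (_ : (fun _ => _) = (fun t => flat m.+2 t + (- m%:R) * flat m.+1 t)); last first.
  by apply/funext => t; rewrite mulNr.
by apply: smooth1D; [exact: IH | apply: smooth1M; [exact: smooth1_cst | exact: IH]].
Qed.

Lemma flat_gt0 m t : (0 < flat m t) = (0 < t).
Proof.
rewrite /flat; case: ifPn => [t0|_]; last by rewrite ltxx.
by rewrite mulr_gt0 ?expR_gt0// invr_gt0 exprn_gt0.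
Qed.

Lemma flat0 m t : t <= 0 -> flat m t = 0.
Proof. by move=> t0; rewrite /flat ltNge t0. Qed.

Definition smoothstep (t : R) : R := flat 0 (t + 1) / (flat 0 (t + 1) + flat 0 (1 - t)).

Lemma smoothstep_den t : 0 < flat 0 (t + 1) + flat 0 (1 - t).
Proof.
have h1 := flat_ge0 0 (t + 1); have h2 := flat_ge0 0 (1 - t).
have [t0|t0] : 0 < t + 1 \/ 0 < 1 - t by case: (ltP 0 t) => ?; [left|right]; lra.
  have h3 : 0 < flat 0 (t + 1) by rewrite flat_gt0.
  lra.
have h3 : 0 < flat 0 (1 - t) by rewrite flat_gt0.
lra.
Qed.

Lemma smoothstep0 t : t <= -1 -> smoothstep t = 0.
Proof. by move=> t1; rewrite /smoothstep flat0 ?mul0r//; lra. Qed.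

Lemma smoothstep1 t : 1 <= t -> smoothstep t = 1.
Proof.
move=> t1; have := smoothstep_den t; rewrite /smoothstep [flat 0 (1 - t)]flat0; last lra.
by rewrite addr0 => h; rewrite divff// gt_eqF.
Qed.

Lemma smoothstep_itv t : 0 <= smoothstep t <= 1.
Proof.
have h := smoothstep_den t; rewrite /smoothstep divr_ge0 ?flat_ge0 ?(ltW h)//=.
by rewrite ler_pdivrMr// mul1r lerDl flat_ge0.
Qed.

Lemma smooth_smoothstep : smooth_fun smoothstep.
Proof.
move=> k; have h1 : smooth1 k (fun t => flat 0 (t + 1)).
  have := @smooth1_affine k _ 1 1 (smooth_flat 0 k).
  by under [X in smooth1 _ X]eq_fun do rewrite mul1r.
have h2 : smooth1 k (fun t => flat 0 (1 - t)).
  have := @smooth1_affine k _ (-1) 1 (smooth_flat 0 k).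
  by under [X in smooth1 _ X]eq_fun do rewrite mulN1r addrC.
apply: smooth1M => //; apply: smooth1V; last exact: smooth1D.
by move=> t; rewrite gt_eqF// smoothstep_den.
Qed.

End smooth_real.

(** * Smooth functions built from tensor products *)

Section tensor.
Context {R : realType} {n : nat}.
Local Notation E := 'rV[R]_n.
Local Notation e_ i := (delta_mx ord0 i : E).
Implicit Types (x : E) (th : 'I_n -> R -> R).

Lemma smooth_fun_derive (f : R -> R) : smooth_fun f ->
  exists2 f' : R -> R, (forall t : R, is_derive t 1 f (f' t)) & smooth_fun f'.
Proof.
move=> sf; have [f' df _] := sf 1%N; exists f' => // k.
have [g dg sg] := sf k.+1; rewrite (_ : f' = g)//; apply/funext => t.
by have [_ <-] := df t; have [_ <-] := dg t.
Qed.

Definition tensor th x : R := \prod_i th i (x ord0 i).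

Definition tensor_upd th (k : 'I_n) (g : R -> R) i := if i == k then g else th i.

Lemma tensor_updE th k g x :
  tensor (tensor_upd th k g) x = g (x ord0 k) * \prod_(i < n | i != k) th i (x ord0 i).
Proof.
rewrite /tensor (bigD1 k)//= /tensor_upd eqxx; congr (_ * _).
by apply: eq_bigr => i /negbTE ->.
Qed.

Lemma tensorD1 th k x :
  tensor th x = th k (x ord0 k) * \prod_(i < n | i != k) th i (x ord0 i).
Proof. by rewrite /tensor (bigD1 k). Qed.

Lemma is_derive_tensor th k x (g : R -> R) :
  is_derive (x ord0 k) 1 (th k) (g (x ord0 k)) ->
  is_derive x (e_ k) (tensor th) (tensor (tensor_upd th k g) x).
Proof.
move=> [d1 d2]; pose P := \prod_(i < n | i != k) th i (x ord0 i).
suff h : (fun h => h^-1 *: ((tensor th \o shift x) (h *: e_ k) - tensor th x)) @ 0^'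
    --> tensor (tensor_upd th k g) x.
  by split; [apply/cvg_ex; eexists; exact: h | exact: cvg_lim h].
have -> : (fun h => h^-1 *: ((tensor th \o shift x) (h *: e_ k) - tensor th x)) =
  (fun h : R => (h^-1 *: ((th k \o shift (x ord0 k)) (h *: 1) - th k (x ord0 k))) * P).
  apply/funext => h; rewrite /= !(tensorD1 _ k) !mxE !eqxx/= !mulr1.
  rewrite [X in _ * X - _](_ : _ = P); last first.
    by apply: eq_bigr => i ik; rewrite !mxE (negbTE ik) andbF mulr0 add0r.
  by rewrite -mulrBl /GRing.scale/= mulr1 mulrA.
by rewrite tensor_updE; apply: cvgM; [rewrite -d2; exact: d1 | exact: cvg_cst].
Qed.

(** Finite sums of products of one-variable functions: the class is stable under [partial], so the
    iterated partial derivatives required by [smooth] reduce to smoothness in one variable. *)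
Definition tensor_sum (s : seq (R * ('I_n -> R -> R))) x : R :=
  \sum_(p <- s) p.1 * tensor p.2 x.

Definition smooth_family (s : seq (R * ('I_n -> R -> R))) :=
  forall p, List.In p s -> forall i, smooth_fun (p.2 i).

Lemma is_derive_tensor_sum s k (D : ('I_n -> R -> R) -> R -> R) x :
  (forall p, List.In p s -> is_derive (x ord0 k) 1 (p.2 k) (D p.2 (x ord0 k))) ->
  is_derive x (e_ k) (tensor_sum s)
    (\sum_(p <- s) p.1 * tensor (tensor_upd p.2 k (D p.2)) x).
Proof.
elim: s => [|p s IH] h.
  rewrite big_nil (_ : tensor_sum [::] = cst 0); first exact: is_derive_cst.
  by apply/funext => y; rewrite /tensor_sum big_nil.
rewrite big_cons (_ : tensor_sum (p :: s) = (p.1 \*: tensor p.2) + tensor_sum s); last first.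
  by apply/funext => y; rewrite /tensor_sum big_cons.
apply: is_deriveD; last by apply: IH => q qs; apply: h; right.
apply: is_deriveZ; apply: is_derive_tensor; apply: h; by left.
Qed.

Lemma tensor_continuous th : (forall i, continuous (th i)) -> continuous (tensor th).
Proof.
move=> cth x; rewrite /tensor; elim: (index_enum _) => [|i r IH].
  rewrite (_ : (fun _ => _) = cst 1); first exact: cst_continuous.
  by apply/funext => y; rewrite big_nil.
rewrite (_ : (fun _ => _) = (fun y : E => th i (y ord0 i) * \prod_(j <- r) th j (y ord0 j))); last first.
  by apply/funext => y; rewrite big_cons.
apply: (@continuousM _ _ (fun y : E => th i (y ord0 i))); last exact: IH.
exact: (@continuous_comp _ _ _ (fun y : E => y ord0 i) (th i) x
  (@coord_continuous R 1 n ord0 i x) (cth i _)).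
Qed.

Lemma tensor_sum_continuous s : smooth_family s -> continuous (tensor_sum s).
Proof.
move=> ss x; rewrite /tensor_sum; elim: s ss => [|p s IH] ss.
  rewrite (_ : (fun _ => _) = cst 0); first exact: cst_continuous.
  by apply/funext => y; rewrite big_nil.
rewrite (_ : (fun _ => _) = (fun y => p.1 * tensor p.2 y + \sum_(q <- s) q.1 * tensor q.2 y)); last first.
  by apply/funext => y; rewrite big_cons.
apply: (@continuousD _ _ _ (fun y : E => p.1 * tensor p.2 y)); last first.
  by apply: IH => q qs; apply: ss; right.
apply: (@continuousM _ _ (fun=> p.1)); first exact: cst_continuous.
by apply: tensor_continuous => i; apply: (ss p _ i 0%N); left.
Qed.

Lemma partial_tensor_sum s k : smooth_family s ->
  (forall x, derivable (tensor_sum s) x (e_ k)) /\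
  exists2 s', partial k (tensor_sum s) = tensor_sum s' & smooth_family s'.
Proof.
move=> ss; pose D (th : 'I_n -> R -> R) (t : R) : R := 'D_1 (th k) t.
have dD p (t : R) : List.In p s -> is_derive t 1 (p.2 k) (D p.2 t).
  move=> ps; have [f' df _] := smooth_fun_derive (ss p ps k).
  by have [d1 d2] := df t; split.
have h x := is_derive_tensor_sum (fun p ps => dD p (x ord0 k) ps).
split; first by move=> x; have [] := h x.
exists [seq (p.1, tensor_upd p.2 k (D p.2)) | p <- s].
  apply/funext => x; rewrite /partial; have [_ ->] := h x.
  by rewrite /tensor_sum big_map.
move=> q /List.in_map_iff[p [<- ps]] i /=; rewrite /tensor_upd.
case: ifP => _; last exact: ss.
have [f' df sf'] := smooth_fun_derive (ss p ps k).
rewrite (_ : D p.2 = f')//; apply/funext => t.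
by have [_ <-] := df t.
Qed.

Lemma smooth_tensor_sum s : smooth_family s -> smooth (tensor_sum s).
Proof.
move=> ss ks.
have [s' -> ss'] : exists2 s', foldr partial (tensor_sum s) ks = tensor_sum s' & smooth_family s'.
  elim: ks => [|k ks [s' e ss']] /=; first by exists s.
  by rewrite e; have [_] := partial_tensor_sum k ss'.
split; first exact: tensor_sum_continuous.
by move=> i x; have [] := partial_tensor_sum i ss'.
Qed.

Lemma tensorE th : tensor th = tensor_sum [:: (1, th)].
Proof. by apply/funext => x; rewrite /tensor_sum big_seq1 mul1r. Qed.

Lemma smooth_tensor th : (forall i, smooth_fun (th i)) -> smooth (tensor th).
Proof. by move=> sth; rewrite tensorE; apply: smooth_tensor_sum => p [<-|[]]. Qed.

Lemma test_function_within (O K : set E) phi : smooth phi -> compact K -> K `<=` O ->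
  (forall x, phi x != 0 -> K x) -> test_function O phi.
Proof.
move=> sphi cK KO h.
have sub : tsupport phi `<=` K.
  rewrite (_ : K = closure K).
    by apply: closureS => x /=; exact: h.
  apply/closure_id; apply: compact_closed => //; exact: norm_hausdorff.
split=> //; last exact: subset_trans sub KO.
by apply: subclosed_compact sub => //; exact: closed_closure.
Qed.

End tensor.

(** * Sums of second differences over the integers *)

Section spline_real.
Context {R : realType}.
Implicit Types (q : R -> R) (t : R).

Definition second_difference q t := q (t + 1) - 2 * q t + q (t - 1).

(** For [m] from 0 to [2 N] these are the integers from [-N] to [N], whence the ranges [N.*2.+1]
    below. *)
Definition node (N m : nat) : R := m%:R - N%:R.

Lemma nodeS N m : node N m.+1 = node N m + 1.
Proof. by rewrite /node -addn1 natrD; ring. Qed.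

Lemma node0 N : node N 0 = - N%:R.
Proof. by rewrite /node sub0r. Qed.

Lemma node_last N : node N N.*2.+1 = N%:R + 1.
Proof. by rewrite /node -addn1 -addnn !natrD; ring. Qed.

(** Telescoping leaves boundary terms only. Well inside the grid, they sum to 1 for [q = ramp], so
    its second differences form a partition of unity, and to 0 for the derivative of [ramp]. *)
Lemma sum_second_difference q N t :
  \sum_(m < N.*2.+1) second_difference q (t - node N m) =
  (q (t + N%:R + 1) - q (t + N%:R)) - (q (t - N%:R) - q (t - N%:R - 1)).
Proof.
pose a m := q (t - node N m) - q (t - node N m + 1).
rewrite -(big_mkord xpredT (fun m => second_difference q (t - node N m))).
rewrite (eq_big_nat _ _ (F2 := fun m => a m.+1 - a m)); last first.
  by move=> m _; rewrite /a nodeS /second_difference (opprD (node N m)) (addrA t) subrK; ring.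
rewrite telescope_sumr// /a node0 node_last (opprD N%:R) (addrA t) subrK (opprK N%:R).
ring.
Qed.

(** Abel summation, again with boundary terms only; for the derivative of [ramp] the value is 1 well
    inside the grid, which says that linear functions are reproduced with the right slope. *)
Lemma sum_node_second_difference q N t :
  \sum_(m < N.*2.+1) node N m * second_difference q (t - node N m) =
  (- N%:R * (q (t + N%:R + 1) - q (t + N%:R)) + q (t + N%:R)) -
  (N.+1%:R * (q (t - N%:R) - q (t - N%:R - 1)) + q (t - N%:R - 1)).
Proof.
pose a m := - (node N m * (q (t - node N m + 1) - q (t - node N m)) + q (t - node N m)).
rewrite -(big_mkord xpredT (fun m => node N m * second_difference q (t - node N m))).
rewrite (eq_big_nat _ _ (F2 := fun m => a m.+1 - a m)); last first.
  by move=> m _; rewrite /a nodeS /second_difference (opprD (node N m)) (addrA t) subrK; ring.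
rewrite telescope_sumr// /a node0 node_last (opprD N%:R) (addrA t) subrK (opprK N%:R).
by rewrite -natr1; ring.
Qed.

Lemma count_close_nodes N t M :
  (\sum_(m < M) (`|t - node N m| <= 2)%R <= 5)%N.
Proof.
pose P m := `|t - node N m| <= 2.
have close m m' : P m -> P m' -> (m' <= m + 4)%N.
  rewrite /P /node !ler_norml => /andP[h1 h2] /andP[h3 h4].
  by rewrite -(ler_nat R) natrD; lra.
rewrite -(big_mkord xpredT (fun m => nat_of_bool (P m))).
have -> : (\sum_(0 <= m < M) P m = size [seq m <- iota 0 M | P m])%N.
  rewrite -sum1_size big_filter [RHS]big_mkcond /index_iota subn0.
  by apply: eq_bigr => m _; case: (P m).
have [/hasP[m0 _ Pm0]|/hasPn h] := boolP (has P (iota 0 M)); last first.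
  rewrite (_ : [seq _ <- _ | _] = [::])//; apply/eqP; rewrite -(negbK (_ == _)) -has_filter.
  by apply/hasPn.
have [m1 Pm1 min1] := ex_minnP (ex_intro P m0 Pm0).
rewrite -(size_iota m1 5); apply: uniq_leq_size; first by rewrite filter_uniq// iota_uniq.
move=> m; rewrite mem_filter mem_iota => /andP[Pm _].
by rewrite mem_iota (min1 _ Pm)/=; have := close _ _ Pm1 Pm; lia.
Qed.

(** At most five nodes lie within distance 2 of [t]. The bound is independent of [N] and [M], hence
    of the mesh. *)
Lemma second_difference_sum_bound (q : R -> R) (B : R) N M t :
  (forall s, `|second_difference q s| <= B) ->
  (forall s, 2 < `|s| -> second_difference q s = 0) ->
  \sum_(m < M) `|second_difference q (t - node N m)| <= 5 * B.
Proof.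
move=> hB h0; have B0 : 0 <= B by apply: le_trans (hB 0); exact: normr_ge0.
apply: (@le_trans _ _ (\sum_(m < M) (nat_of_bool (`|t - node N m| <= 2))%:R * B)).
  apply: ler_sum => m _; have [_|h] := leP (`|t - node N m|) 2; first by rewrite mul1r hB.
  by rewrite h0// normr0 mul0r.
rewrite -mulr_suml; apply: ler_wpM2r => //.
by rewrite -natr_sum ler_nat count_close_nodes.
Qed.

(* [ramp] is a smooth version of the positive part, and the second difference
   of the positive part is the piecewise linear hat function. *)
Definition ramp t : R := t * smoothstep t.

Lemma smooth_ramp : smooth_fun ramp.
Proof. by move=> k; apply: smooth1M; [exact: smooth1_id | exact: smooth_smoothstep]. Qed.

Lemma ramp0 t : t <= -1 -> ramp t = 0.
Proof. by move=> t1; rewrite /ramp smoothstep0 ?mulr0. Qed.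

Lemma rampE t : 1 <= t -> ramp t = t.
Proof. by move=> t1; rewrite /ramp smoothstep1 ?mulr1. Qed.

Lemma ramp_derive : exists dramp : R -> R,
  [/\ forall t : R, is_derive t 1 ramp (dramp t), smooth_fun dramp,
      forall t, t < -1 -> dramp t = 0 & forall t, 1 < t -> dramp t = 1].
Proof.
have [dr hdr sdr] := smooth_fun_derive smooth_ramp.
exists dr; split => // t t1.
  have d0 : is_derive t 1 ramp 0.
    apply: (@near_eq_is_derive R R R (cst 0)).
    near=> s; rewrite ramp0//; apply/ltW; near: s; exact: lt_nbhsl.
  by have [_ <-] := hdr t; have [_ ->] := d0.
have d1 : is_derive t 1 ramp 1.
  apply: (@near_eq_is_derive R R R id).
  near=> s; rewrite rampE//; apply/ltW; near: s; exact: lt_nbhsr.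
by have [_ <-] := hdr t; have [_ ->] := d1.
Unshelve. all: by end_near. Qed.

Lemma is_derive_second_difference (f f' : R -> R) (t : R) :
  (forall s : R, is_derive s 1 f (f' s)) ->
  is_derive t 1 (second_difference f) (second_difference f' t).
Proof.
move=> df.
have d1 : is_derive t 1 (fun s => f (s + 1)) (f' (t + 1)).
  have := @is_derive_affine R f (f' (t + 1)) 1 1 t; rewrite !mul1r => /(_ (df _)).
  by under [X in is_derive _ _ X]eq_fun do rewrite mul1r.
have d2 : is_derive t 1 (fun s => f (s - 1)) (f' (t - 1)).
  have := @is_derive_affine R f (f' (t - 1)) 1 (-1) t; rewrite !mul1r => /(_ (df _)).
  by under [X in is_derive _ _ X]eq_fun do rewrite mul1r.
have d3 : is_derive t 1 (2 \*: f) (2 *: f' t) by exact: is_deriveZ.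
have d4 : is_derive t 1 (second_difference f) _ := is_deriveD (is_deriveB d1 d3) d2.
exact: (is_derive_eq d4).
Qed.

Lemma smooth_second_difference f : smooth_fun f -> smooth_fun (second_difference f).
Proof.
move=> sf k.
have h1 : smooth1 k (fun t => f (t + 1)).
  have := @smooth1_affine R k _ 1 1 (sf k).
  by under [X in smooth1 _ X]eq_fun do rewrite mul1r.
have h2 : smooth1 k (fun t => f (t - 1)).
  have := @smooth1_affine R k _ 1 (-1) (sf k).
  by under [X in smooth1 _ X]eq_fun do rewrite mul1r.
have h3 : smooth1 k (fun t => f (t + 1) + (-2) * f t + f (t - 1)).
  apply: smooth1D => //; apply: smooth1D => //; apply: smooth1M => //.
  exact: smooth1_cst.
rewrite (_ : second_difference f = fun t => f (t + 1) + (-2) * f t + f (t - 1))//.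
by apply/funext => t; rewrite /second_difference mulNr.
Qed.

Lemma compact_support_bounded (f : R -> R) (r : R) : continuous f ->
  (forall t, r < `|t| -> f t = 0) -> exists B, forall t, `|f t| <= B.
Proof.
move=> cf f0; have cK : compact (`[- r, r]%classic : set R) by exact: segment_compact.
have [B [B0 hB]] := compact_continuous_bounded cK cf; exists B => t.
have [rt|tr] := ltP r `|t|; first by rewrite f0// normr0.
by apply: hB; rewrite /= in_itv/= -ler_norml.
Qed.

End spline_real.

(** * Weights of product form on a grid *)

Section weights.
Context {R : realType} {n M : nat}.
Variables (r : 'I_M -> R) (a : 'I_n -> 'I_M -> R).
Local Notation J := {ffun 'I_n -> 'I_M}.

Definition weight (j : J) := \prod_i a i (j i).

Lemma sum_weight : \sum_(j : J) weight j = \prod_i \sum_m a i m.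
Proof. by rewrite bigA_distr_bigA. Qed.

Lemma sum_weight_norm : \sum_(j : J) `|weight j| = \prod_i \sum_m `|a i m|.
Proof. by rewrite bigA_distr_bigA; apply: eq_bigr => j _; rewrite normr_prod. Qed.

Lemma sum_weight_norm_le K : (forall i, \sum_m `|a i m| <= K) -> \sum_(j : J) `|weight j| <= K ^+ n.
Proof.
move=> aK; rewrite sum_weight_norm -[X in K ^+ X]card_ord -prodr_const.
by apply: ler_prod => i _; rewrite aK sumr_ge0.
Qed.

Lemma sum_weight_coord k : \sum_(j : J) r (j k) * weight j =
  (\sum_m r m * a k m) * \prod_(i < n | i != k) \sum_m a i m.
Proof.
pose a' i m := if i == k then r m * a i m else a i m.
have -> : \sum_(j : J) r (j k) * weight j = \sum_(j : J) \prod_i a' i (j i).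
  apply: eq_bigr => j _; rewrite /weight (bigD1 k)//= [in RHS](bigD1 k)//= mulrA.
  congr (_ * _); first by rewrite /a' eqxx.
  by apply: eq_bigr => i ik; rewrite /a' (negbTE ik).
rewrite -bigA_distr_bigA (bigD1 k)//=; congr (_ * _).
  by apply: eq_bigr => m _; rewrite /a' eqxx.
by apply: eq_bigr => i ik; apply: eq_bigr => m _; rewrite /a' (negbTE ik).
Qed.

(** Since the weights sum to 1, the error is the weighted sum of the [f j - c], where only nodes of
    nonzero weight count. The power of [K] bounds the sum of the absolute values of the weights,
    which may have either sign. *)
Lemma weighted_value_error (f : J -> R) (c eps K : R) : 0 <= eps ->
  (forall i, \sum_m a i m = 1) -> (forall i, \sum_m `|a i m| <= K) ->
  (forall j, weight j != 0 -> `|f j - c| <= eps) ->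
  `|\sum_(j : J) f j * weight j - c| <= eps * K ^+ n.
Proof.
move=> e0 a1 aK hf.
have -> : \sum_(j : J) f j * weight j - c = \sum_(j : J) (f j - c) * weight j.
  under [RHS]eq_bigr do rewrite mulrBl.
  rewrite sumrB -mulr_sumr sum_weight; under eq_bigr do rewrite a1.
  by rewrite big1_eq mulr1.
apply: le_trans (ler_norm_sum _ _ _) _.
apply: (@le_trans _ _ (\sum_(j : J) eps * `|weight j|)).
  apply: ler_sum => j _; rewrite normrM.
  have [->|wj] := eqVneq (weight j) 0; first by rewrite normr0 !mulr0.
  by apply: ler_wpM2r => //; exact: hf.
by rewrite -mulr_sumr; apply: ler_wpM2l => //; exact: sum_weight_norm_le.
Qed.

(** The weights, differentiated in direction [k], annihilate constants and return coordinate [k] of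
    linear functions. Subtracting the affine function with gradient [p] leaves values of size
    [eps * h], and this [h] absorbs the factor [h^-1]. *)
Lemma weighted_derivative_error (f : J -> R) (k : 'I_n) (p x : 'rV[R]_n) (c eps K h : R) :
  0 < h -> 0 <= eps ->
  \sum_m a k m = 0 -> \sum_m r m * a k m = 1 ->
  (forall i, i != k -> \sum_m a i m = 1) -> (forall i, \sum_m `|a i m| <= K) ->
  (forall j, weight j != 0 ->
     `|f j - c - inner p (h *: (\row_i r (j i)) - x)| <= eps * h) ->
  `|\sum_(j : J) f j * (h^-1 * weight j) - p ord0 k| <= eps * K ^+ n.
Proof.
move=> h0 e0 ak0 ak1 ai aK hf.
have w0 : \sum_(j : J) weight j = 0 by rewrite sum_weight (bigD1 k)//= ak0 mul0r.
have wk l : \sum_(j : J) r (j l) * weight j = (l == k)%:R.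
  rewrite sum_weight_coord; have [->|lk] := eqVneq l k.
    by rewrite ak1 mul1r big1// => i /ai.
  by rewrite (bigD1 k)/= 1?eq_sym// ak0 mul0r mulr0.
have -> : \sum_(j : J) f j * (h^-1 * weight j) - p ord0 k =
  \sum_(j : J) (f j - c - inner p (h *: (\row_i r (j i)) - x)) * (h^-1 * weight j).
  have -> : \sum_(j : J) (f j - c - inner p (h *: (\row_i r (j i)) - x)) * (h^-1 * weight j) =
     \sum_(j : J) (f j * (h^-1 * weight j) - (c - inner p x) * h^-1 * weight j
       - inner p (\row_i r (j i)) * weight j).
    apply: eq_bigr => j _; rewrite innerBr innerZr; field.
    by rewrite gt_eqF.
  rewrite !sumrB -mulr_sumr w0 mulr0 subr0; congr (_ - _).
  rewrite /inner; under eq_bigr do rewrite mulr_suml.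
  rewrite exchange_big /= (bigD1 k)//= [X in _ = _ + X]big1 ?addr0.
    by under eq_bigr do rewrite mxE -mulrA; rewrite -mulr_sumr wk eqxx mulr1.
  move=> l lk; under eq_bigr do rewrite mxE -mulrA.
  by rewrite -mulr_sumr wk (negbTE lk) mulr0.
apply: le_trans (ler_norm_sum _ _ _) _.
apply: (@le_trans _ _ (\sum_(j : J) eps * `|weight j|)).
  apply: ler_sum => j _; rewrite normrM.
  have [->|wj] := eqVneq (weight j) 0; first by rewrite mulr0 normr0 !mulr0.
  have habs : `|h^-1| = h^-1 by rewrite gtr0_norm// invr_gt0.
  rewrite [X in _ * X]normrM habs mulrA; apply: ler_wpM2r => //.
  by rewrite ler_pdivrMr//; exact: hf.
by rewrite -mulr_sumr; apply: ler_wpM2l => //; exact: sum_weight_norm_le.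
Qed.

End weights.

(** * Interpolation of a Lipschitz function on a fine grid *)

Section approximation.
Context {R : realType} {n : nat}.
Local Notation E := 'rV[R]_n.
Variables (phi : E -> R) (C : R) (x1 : E) (r0 rho : R).
Hypothesis C0 : 0 <= C.
Hypothesis lphi : forall x y, `|phi y - phi x| <= C * enorm (y - x).
Hypothesis r0rho : r0 < rho.
Hypothesis sphi : forall x, phi x != 0 -> enorm (x - x1) <= r0.

Let D : set E := [set x | enorm (x - x1) < rho].

(* [phi] is interpolated on a grid of mesh [h] by translates of a smoothed
   hat function, which reproduces affine functions. *)
Lemma lipschitz_approximation :
  exists (B : R) (phi_ : nat -> E -> R),
  [/\ forall k, test_function D (phi_ k),
      forall k x, D x -> `|phi_ k x - phi x| <= B / k.+1%:R,
      forall k i x, D x -> `|partial i (phi_ k) x| <= B &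
      forall i x p, D x -> gradient_at phi x p ->
        partial i (phi_ k) x @[k --> \oo] --> p ord0 i].
Proof.
have [dramp [hdramp sdramp dramp0 dramp1]] := @ramp_derive R.
pose th := second_difference (@ramp R).
pose dth := second_difference dramp.
have sth : smooth_fun th by apply: smooth_second_difference; exact: smooth_ramp.
have sdth : smooth_fun dth by exact: smooth_second_difference.
have hdth (t : R) : is_derive t 1 th (dth t) by exact: is_derive_second_difference.
have th0 t : 2 < `|t| -> th t = 0.
  rewrite ltr_normr /th /second_difference => /orP[t2|t2].
    by rewrite !rampE; lra.
  by rewrite !ramp0; lra.
have dth0 t : 2 < `|t| -> dth t = 0.
  rewrite ltr_normr /dth /second_difference => /orP[t2|t2].
    by rewrite !dramp1; lra.
  by rewrite !dramp0; lra.
have [B1 hB1] := compact_support_bounded (sth 0%N) th0.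
have [B2 hB2] := compact_support_bounded (sdth 0%N) dth0.
pose K := 5 * Num.max B1 B2.
have K0 : 0 <= K.
  by rewrite /K mulr_ge0// le_max; apply/orP; left; apply: le_trans (hB1 0).
have thK N M t : \sum_(m < M) `|th (t - node N m)| <= K.
  apply: le_trans (second_difference_sum_bound N M t hB1 th0) _.
  by rewrite /K ler_pM2l// le_max lexx.
have dthK N M t : \sum_(m < M) `|dth (t - node N m)| <= K.
  apply: le_trans (second_difference_sum_bound N M t hB2 dth0) _.
  by rewrite /K ler_pM2l// le_max lexx orbT.
have sum_th N (t : R) : `|t| < N%:R - 2 -> \sum_(m < N.*2.+1) th (t - node N m) = 1.
  rewrite ltr_norml => /andP[t1 t2]; rewrite sum_second_difference.
  rewrite [ramp (t + N%:R + 1)]rampE ?[ramp (t + N%:R)]rampE; [|lra..].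
  by rewrite !ramp0; lra.
have sum_dth N (t : R) : `|t| < N%:R - 2 -> \sum_(m < N.*2.+1) dth (t - node N m) = 0.
  rewrite ltr_norml => /andP[t1 t2]; rewrite sum_second_difference.
  rewrite [dramp (t + N%:R + 1)]dramp1 ?[dramp (t + N%:R)]dramp1; [|lra..].
  by rewrite !dramp0; lra.
have sum_node_dth N (t : R) : `|t| < N%:R - 2 ->
    \sum_(m < N.*2.+1) node N m * dth (t - node N m) = 1.
  rewrite ltr_norml => /andP[t1 t2]; rewrite sum_node_second_difference.
  rewrite [dramp (t + N%:R + 1)]dramp1 ?[dramp (t + N%:R)]dramp1; [|lra..].
  by rewrite !dramp0; lra.
(* Interpolation on mesh [h] enlarges the support by at most [2 * n * h]; this choice keeps it in
   [D] for every [h <= h0]. *)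
pose h0 := (rho - r0) / (2 * n.+1%:R).
have h0_gt0 : 0 < h0 by rewrite divr_gt0 ?mulr_gt0// subr_gt0.
pose h k := h0 / k.+1%:R.
have h_gt0 k : 0 < h k by rewrite divr_gt0.
have h_ge0 k : 0 <= h k by exact: ltW.
have nn : 0 <= 2 * n%:R :> R by exact: mulr_ge0.
have habs k : `|(h k)^-1| = (h k)^-1 by rewrite gtr0_norm// invr_gt0.
have h_le k : h k <= h0 by rewrite ler_pdivrMr// ler_peMr ?ler1n// ltW.
(* Of the three units added, one makes the integer part exceed its argument and two cover the
   half-width of the hat, so the sums over the grid are complete at every point of [D]. *)
pose N k := (Num.truncn ((`|x1| + rho) / h k)).+3.
pose J k := {ffun 'I_n -> 'I_(N k).*2.+1}.
pose nodes k (j : J k) : E := h k *: (\row_i node (N k) (j i)).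
pose fam (g : R -> R) k (j : J k) (i : 'I_n) (t : R) := g ((h k)^-1 * t - node (N k) (j i)).
pose s k := [seq (phi (nodes k j), fam th k j) | j <- index_enum (J k)].
have ss k : smooth_family (s k).
  move=> p; rewrite /s; elim: (index_enum (J k)) => //= j js IH [<-|/IH//] i /=.
  by move=> l; apply: smooth1_affine; exact: sth.
pose phi_ k := tensor_sum (s k).
pose al k (x : E) (i : 'I_n) (m : 'I_(N k).*2.+1) := th ((h k)^-1 * x ord0 i - node (N k) m).
pose be k (x : E) l (i : 'I_n) (m : 'I_(N k).*2.+1) :=
  if i == l then dth ((h k)^-1 * x ord0 i - node (N k) m)
  else th ((h k)^-1 * x ord0 i - node (N k) m).
have phiE k x : phi_ k x = \sum_(j : J k) phi (nodes k j) * weight (al k x) j.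
  by rewrite /phi_ /tensor_sum /s big_map.
have dphiE k l x : partial l (phi_ k) x =
    \sum_(j : J k) phi (nodes k j) * ((h k)^-1 * weight (be k x l) j).
  have hd (j : J k) : is_derive (x ord0 l) 1 (fam th k j l)
      ((h k)^-1 * fam dth k j l (x ord0 l)).
    exact: is_derive_affine.
  have [_] : is_derive x (delta_mx ord0 l) (phi_ k)
     (\sum_(j : J k) phi (nodes k j) * ((h k)^-1 * weight (be k x l) j)).
    rewrite /phi_ /s; elim: (index_enum (J k)) => [|j js IH].
      rewrite big_nil (_ : tensor_sum _ = cst 0); first exact: is_derive_cst.
      by apply/funext => y; rewrite /tensor_sum big_nil.
    rewrite big_cons /= (_ : tensor_sum _ = (phi (nodes k j) \*: tensor (fam th k j)) +
       tensor_sum [seq (phi (nodes k j), fam th k j) | j <- js]); last first.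
      by apply/funext => y; rewrite /tensor_sum big_cons.
    have dj : is_derive x (delta_mx ord0 l) (tensor (fam th k j))
        ((h k)^-1 * weight (be k x l) j).
      apply: (is_derive_eq (@is_derive_tensor R n (fam th k j) l x
        (fun t => (h k)^-1 * fam dth k j l t) (hd j))).
      rewrite tensor_updE /weight [in RHS](bigD1 l)//= /be eqxx -mulrA; congr (_ * (_ * _)).
      by apply: eq_bigr => i /negbTE ->.
    exact: (is_deriveD (is_deriveZ (phi (nodes k j)) dj) IH).
  by [].
have close k (x : E) (j : J k) (w : 'I_n -> R) : (forall i, w i != 0 -> `|(h k)^-1 * x ord0 i - node (N k) (j i)| <= 2) ->
    \prod_i w i != 0 -> enorm (nodes k j - x) <= 2 * n%:R * h k.
  move=> hw /prodf_neq0 w0.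
  rewrite [2 * _]mulrC -mulrA; apply: enorm_le_coord => i; have := hw i (w0 i isT).
  rewrite !mxE distrC.
  have -> : node (N k) (j i) - (h k)^-1 * x ord0 i = (h k)^-1 * (h k * node (N k) (j i) - x ord0 i).
    by field; rewrite gt_eqF.
  by rewrite normrM habs ler_pdivrMl// [h k * 2]mulrC.
have close_al k x j : weight (al k x) j != 0 -> enorm (nodes k j - x) <= 2 * n%:R * h k.
  apply: close => i; apply: contra_neqT; rewrite -ltNge; exact: th0.
have close_be k l x j : weight (be k x l) j != 0 -> enorm (nodes k j - x) <= 2 * n%:R * h k.
  apply: close => i; apply: contra_neqT; rewrite -ltNge /be => ?.
  by case: ifP => _; [exact: dth0 | exact: th0].
have inD k (x : E) (i : 'I_n) : D x -> `|(h k)^-1 * x ord0 i| < (N k)%:R - 2.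
  rewrite /D /= => xD; rewrite normrM habs.
  have : `|x ord0 i| < `|x1| + rho.
    apply: le_lt_trans (coord_le_norm _ _) _.
    by apply: le_lt_trans (norm_le_enormB x x1) _; rewrite ltrD2l.
  rewrite -(ltr_pM2l (_ : 0 < (h k)^-1)) ?invr_gt0// => /lt_le_trans; apply.
  rewrite mulrC /N -addn2 natrD addrK; apply/ltW; exact: truncnS_gt.
(* Used twice: with [p = 0] and the Lipschitz bound for the uniform bound on the partial
   derivatives, and with [p] the gradient for their convergence. *)
have derr k l x p (A : R) : D x -> 0 <= A ->
    (forall y, enorm (y - x) <= 2 * n%:R * h k ->
       `|phi y - phi x - inner p (y - x)| <= A * h k) ->
    `|partial l (phi_ k) x - p ord0 l| <= A * K ^+ n.
  move=> xD A0 hA; rewrite dphiE.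
  apply: (@weighted_derivative_error R n _ (fun m => node (N k) m) (be k x l)
    (fun j => phi (nodes k j)) l p x (phi x) A K (h k)) => //.
  - by rewrite /be eqxx; apply: sum_dth; exact: inD.
  - by rewrite /be eqxx; apply: sum_node_dth; exact: inD.
  - by move=> i /negbTE il; rewrite /be il; apply: sum_th; exact: inD.
  - by move=> i; rewrite /be; case: (i == l).
  - by move=> j /close_be; exact: hA.
have h2n k : r0 + 2 * n%:R * h k < rho.
  have : 2 * n%:R * h k <= 2 * n%:R * h0 by rewrite ler_wpM2l// mulr_ge0.
  have : 2 * n%:R * h0 < rho - r0.
    rewrite /h0 mulrCA gtr_pMr ?subr_gt0// ltr_pdivrMr ?mulr_gt0// mul1r.
    by rewrite ltr_pM2l// ltr_nat.
  lra.
have cv_h : 2 * n%:R * h k @[k --> \oo] --> (0 : R).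
  rewrite (_ : (fun k => _) = (fun k => (2 * n%:R * h0) * k.+1%:R^-1)); last first.
    by apply/funext => k; rewrite /h; ring.
  rewrite -[X in _ --> X](mulr0 (2 * n%:R * h0)).
  by apply: cvgM; [exact: cvg_cst | exact: cvg_harmonic].
pose B := 2 * n%:R * C * K ^+ n * (1 + h0).
have B0 : 0 <= 2 * n%:R * C * K ^+ n by rewrite !mulr_ge0// exprn_ge0.
exists B, phi_; split.
- move=> k; apply: (@test_function_within _ _ _ [set x | enorm (x - x1) <= r0 + 2 * n%:R * h k]).
  + exact: smooth_tensor_sum.
  + exact: enorm_ball_compact.
  + by move=> x /= hx; rewrite /D /= (le_lt_trans hx).
  + move=> x /=; rewrite phiE => /eqP nz.
    have [j /eqP jnz] : exists j : J k, phi (nodes k j) * weight (al k x) j <> 0.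
      by apply: contrapT => /forallNP h'; apply: nz; apply: big1 => j _; exact: contrapT (h' j).
    move: jnz; rewrite mulf_eq0 negb_or => /andP[/sphi h1 /close_al h2].
    apply: le_trans (enorm_triangle _ (nodes k j) _) _.
    by rewrite enorm_distC addrC lerD.
- move=> k x xD; rewrite phiE.
  apply: le_trans (weighted_value_error (eps := C * (2 * n%:R * h k)) _ _ _ _) _.
  + exact: mulr_ge0 C0 (mulr_ge0 nn (h_ge0 k)).
  + by move=> i; apply: sum_th; exact: inD.
  + by move=> i; exact: thK.
  + by move=> j /close_al hj; apply: le_trans (lphi _ _) _; apply: ler_wpM2l.
  + have -> : C * (2 * n%:R * h k) * K ^+ n = 2 * n%:R * C * K ^+ n * h0 / k.+1%:R.
      by rewrite /h; ring.
    rewrite ler_pM2r ?invr_gt0// /B; apply: ler_wpM2l => //; lra.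
- move=> k l x xD; have := derr k l x 0 (C * (2 * n%:R)) xD.
  rewrite mxE subr0 => hd; apply: le_trans (hd _ _) _.
  + exact: mulr_ge0 C0 nn.
  + move=> y hy; rewrite inner0l subr0; apply: le_trans (lphi _ _) _.
    by rewrite -mulrA; exact: ler_wpM2l.
  + have -> : C * (2 * n%:R) * K ^+ n = 2 * n%:R * C * K ^+ n by ring.
    by rewrite /B ler_peMr//; lra.
- move=> l x p xD gp; apply/cvgrPdist_le => e e0.
  (* The increments by 1 keep [A] positive; what matters is [2 * n * K ^+ n <= A]. *)
  pose A := 2 * n.+1%:R * (K ^+ n + 1).
  have A0 : 0 < A by rewrite !mulr_gt0// ltr_wpDl// exprn_ge0.
  have [d d0 hd] := gp (e / A) (divr_gt0 e0 A0).
  move/cvgrPdist_lt: cv_h => /(_ _ d0)[k0 _ hk0].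
  have {}hk0 k : (k0 <= k)%N -> 2 * n%:R * h k < d.
    by move=> /hk0; rewrite /= sub0r normrN; apply: le_lt_trans; exact: ler_norm.
  have eA : 0 <= e / A by apply: divr_ge0; exact: ltW.
  exists k0 => // k kk0 /=; rewrite distrC.
  apply: le_trans (derr k l x p (e / A * (2 * n%:R)) xD _ _) _.
  + exact: mulr_ge0 eA nn.
  + move=> y hy; apply: le_trans (hd _ (le_lt_trans hy (hk0 k kk0))) _.
    by rewrite -[leRHS]mulrA; apply: ler_wpM2l.
  + have -> : e / A * (2 * n%:R) * K ^+ n = e * ((2 * n%:R * K ^+ n) / A) by ring.
    apply: ler_piMr; first exact: ltW.
    rewrite ler_pdivrMr// mul1r /A; apply: ler_pM => //; first exact: exprn_ge0.
      by rewrite ler_pM2l// ler_nat.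
    by rewrite lerDl.
Qed.

End approximation.

(** * Almost everywhere uniqueness of the subgradient *)

Section test_functions.
Context {R : realType} {n : nat}.
Local Notation E := 'rV[R]_n.
Local Notation mu := (@lebesgue_rV R n).
Local Notation e_ i := (delta_mx ord0 i : E).
Implicit Types (x : E) (psi : E -> R).

Lemma test_function_support (O : set E) psi x : test_function O psi -> psi x != 0 -> O x.
Proof. by move=> [_ _ sub] px; apply: sub; exact: subset_closure. Qed.

Lemma test_function_partial0 (O : set E) psi i x :
  test_function O psi -> ~ tsupport psi x -> partial i psi x = 0.
Proof.
move=> tp nx; rewrite /partial (@near_eq_derive R E R psi (cst 0)) ?derive_cst//.
have : nbhs x (~` tsupport psi).
  by apply: open_nbhs_nbhs; split => //; apply: closed_openC; exact: closed_closure.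
apply: filterS => y; apply: contra_notP => /eqP py; exact: subset_closure.
Qed.

Lemma test_function_eq0 (O : set E) psi x : test_function O psi -> ~ O x -> psi x = 0.
Proof. by move=> tp; apply: contra_notP => /eqP; exact: test_function_support tp. Qed.

Lemma test_function_partial_eq0 (O : set E) psi i x : test_function O psi -> ~ O x ->
  partial i psi x = 0.
Proof.
move=> tp nx; apply: (test_function_partial0 _ tp) => h; apply: nx.
by have [_ _] := tp; apply.
Qed.

Lemma test_function_continuous (O : set E) psi : test_function O psi -> continuous psi.
Proof. by move=> [/(_ [::])[]]. Qed.

Lemma test_function_partial_continuous (O : set E) psi i :
  test_function O psi -> continuous (partial i psi).
Proof. by move=> [/(_ [:: i])[]]. Qed.

Lemma test_function_is_derive (O : set E) psi i x :
  test_function O psi -> is_derive x (e_ i) psi (partial i psi x).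
Proof. by move=> [/(_ [::])[_ /(_ i x)]]. Qed.

(** The Lipschitz bound along [e_i] comes from the mean value theorem on the line; a single constant
    for all the bounds keeps later estimates short. *)
Lemma test_function_bounds (O : set E) psi i : test_function O psi ->
  exists M : R, [/\ 0 <= M, forall x, `|psi x| <= M, forall x, `|partial i psi x| <= M,
    forall x, M < `|x| -> ~ tsupport psi x &
    forall x t, `|psi (x + t *: e_ i) - psi x| <= M * `|t|].
Proof.
move=> tp; have [sp cp subp] := tp.
have [M1 [M10 h1]] := compact_continuous_bounded cp (test_function_continuous tp).
have [M2 [M20 h2]] := compact_continuous_bounded cp (test_function_partial_continuous (i := i) tp).
have [M3 [M30 h3]] : exists M : R, 0 <= M /\ forall x, tsupport psi x -> `|x| <= M.
  have [M [_ hM]] := compact_bounded cp; exists (`|M| + 1).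
  have B1 : M < `|M| + 1 by have := ler_norm M; lra.
  by split => [|x Kx]; [exact: addr_ge0 | exact: (hM _ B1)].
have psi_le x : `|psi x| <= M1.
  have [/h1//|nx] := pselect (tsupport psi x).
  have -> : psi x = 0 by apply: contra_notP nx => /eqP px; exact: subset_closure.
  by rewrite normr0.
have dpsi_le x : `|partial i psi x| <= M2.
  have [/h2//|nx] := pselect (tsupport psi x).
  by rewrite (test_function_partial0 _ tp nx) normr0.
exists (M1 + M2 + M3); split.
- by rewrite !addr_ge0.
- by move=> x; have := psi_le x; lra.
- by move=> x; have := dpsi_le x; lra.
- by move=> x xM /h3; lra.
- move=> x t; pose g (s : R) := psi (x + s *: e_ i).
  have dg (s : R) : is_derive s 1 g (partial i psi (x + s *: e_ i)).
    have [d1 d2] := test_function_is_derive i (x + s *: e_ i) tp.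
    have eg : (fun h => h^-1 *: ((g \o shift s) (h *: 1) - g s)) =
      (fun h => h^-1 *: ((psi \o shift (x + s *: e_ i)) (h *: e_ i) - psi (x + s *: e_ i))).
      apply/funext => h; rewrite /g /=; congr (_ *: (psi _ - _)).
      by rewrite [_ *: 1]mulr1 scalerDl addrCA.
    by split; [rewrite /derivable eg | rewrite /derive eg].
  have cg : continuous g by exact: is_derive_continuous dg.
  have mvt (a b : R) : a < b -> `|g b - g a| <= M2 * (b - a).
    move=> ab; have [c _ ->] := MVT ab (fun s _ => dg s) (continuous_subspaceT cg).
    rewrite normrM (gtr0_norm (_ : 0 < b - a)) ?subr_gt0//.
    by apply: ler_wpM2r => //; rewrite subr_ge0 ltW.
  have gE : psi (x + t *: e_ i) - psi x = g t - g 0 by rewrite /g scale0r addr0.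
  have : `|g t - g 0| <= M2 * `|t|.
    have [t0|t0|->] := ltgtP t 0.
    - by rewrite distrC (ltr0_norm t0); have := mvt _ _ t0; rewrite sub0r.
    - by rewrite (gtr0_norm t0); have := mvt _ _ t0; rewrite subr0.
    - by rewrite subrr normr0 mulr0.
  rewrite gE => /le_trans; apply; apply: ler_wpM2r => //; lra.
Qed.

Lemma cvg_directional (f : E -> R) x i (df s : R) : s != 0 -> is_derive x (e_ i) f df ->
  k.+1%:R * (f (x + (s / k.+1%:R) *: e_ i) - f x) @[k --> \oo] --> s * df.
Proof.
move=> s0 [d1 <-]; pose h (k : nat) : R := s / k.+1%:R.
have h0 k : h k != 0 by rewrite mulf_neq0// invr_neq0// pnatr_eq0.
have hcv : h k @[k --> \oo] --> (0 : R).
  rewrite -[X in _ --> X](mulr0 s).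
  by apply: cvgM; [exact: cvg_cst | exact: cvg_harmonic].
have /cvgr_dnbhsP/(_ h (conj h0 hcv)) cv := d1.
rewrite (_ : (fun k => _) = (fun k => s * ((h k)^-1 *: ((f \o shift x) (h k *: e_ i) - f x)))).
  by apply: cvgM; [exact: cvg_cst | exact: cv].
apply/funext => k /=; rewrite [h k *: _ + x]addrC.
by rewrite -[(h k)^-1 *: _]/((h k)^-1 * _) mulrA /h invfM invrK mulrA divff// mul1r.
Qed.

Lemma bounded_support_mul (f g : E -> R) (A M : R) : 0 <= A -> 0 <= M ->
  (forall x, `|x| <= M -> `|f x| <= A) -> (forall x, `|g x| <= M) ->
  (forall x, M < `|x| -> g x = 0) -> bounded_support (fun x => f x * g x).
Proof.
move=> A0 M0 fA gM g0; exists (M + A * M) => x; split.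
  have [xM|xM] := leP `|x| M; last by rewrite g0// mulr0 normr0 addr_ge0// mulr_ge0.
  rewrite normrM; apply: le_trans (_ : A * M <= _); last by rewrite lerDr.
  by apply: ler_pM => //; exact: fA.
by move=> xM; rewrite g0 ?mulr0//; apply: le_lt_trans xM; rewrite lerDl mulr_ge0.
Qed.

(** This is [integration_by_parts_ae] for the product [F * psi]. Convergence of the quotients of [F]
    is asked only where [psi] is nonzero, since a gradient of [F] may be known only inside a
    domain. *)
Lemma integration_by_parts_test (O : set E) (F F' : E -> R) psi i (s C : R) :
  `|s| = 1 -> test_function O psi -> continuous F -> measurable_fun setT F' ->
  (forall x, `|F' x| <= C) ->
  (forall x t, `|F (x + t *: e_ i) - F x| <= C * `|t|) ->
  {ae mu, forall x, psi x != 0 -> k.+1%:R * (F (x + (s / k.+1%:R) *: e_ i) - F x)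
     @[k --> \oo] --> s * F' x} ->
  \int[mu]_x (F x * partial i psi x) = - \int[mu]_x (F' x * psi x).
Proof.
move=> s1 tp cF mF' F'C lF aeF.
have [M [M0 psiM dpsiM suppM lpsi]] := test_function_bounds i tp.
have cpsi := test_function_continuous tp.
have cdpsi := test_function_partial_continuous (i := i) tp.
have psi0 x : M < `|x| -> psi x = 0.
  by move=> /suppM nx; apply: contra_notP nx => /eqP px; exact: subset_closure.
have dpsi0 x : M < `|x| -> partial i psi x = 0.
  by move=> /suppM nx; exact: test_function_partial0 tp nx.
have C0 : 0 <= C by apply: le_trans (F'C 0); exact: normr_ge0.
have [MF [MF0 hMF]] : exists B : R, 0 <= B /\ forall x, `|x| <= M + 1 -> `|F x| <= B.
  have cK := @enorm_ball_compact R n 0 (n%:R * (M + 1)).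
  have [B [B0 hB]] := compact_continuous_bounded cK cF.
  exists B; split => // x xM; apply: hB => /=; rewrite subr0.
  by apply: le_trans (enorm_le_norm _) _; apply: ler_wpM2l.
have ne : `|e_ i| = 1 :> R by exact: norm_delta.
have shift0 x t : `|t| <= 1 -> M + 1 < `|x| -> psi (x + t *: e_ i) = 0.
  move=> t1 xM; apply: psi0; have := ler_normB (x + t *: e_ i) (t *: e_ i).
  by rewrite addrK normrZ ne mulr1; lra.
have mF : measurable_fun setT F by exact: continuous_measurable_rV.
have mpsi : measurable_fun setT psi by exact: continuous_measurable_rV.
have mdpsi : measurable_fun setT (partial i psi) by exact: continuous_measurable_rV.
have hMF' x : `|x| <= M -> `|F x| <= MF by move=> xM; apply: hMF; lra.
have i1 : mu.-integrable setT (EFin \o (fun x => F x * partial i psi x)).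
  apply: integrable_bounded_support; first exact: measurable_funM.
  exact: (bounded_support_mul MF0 M0 hMF').
have i2 : mu.-integrable setT (EFin \o (fun x => F' x * psi x)).
  apply: integrable_bounded_support; first exact: measurable_funM.
  by apply: (bounded_support_mul C0 M0).
apply/eqP; rewrite -subr_eq0 opprK -RintegralD//; apply/eqP.
apply: (@integration_by_parts_ae R n (fun x => F x * psi x) _ i s (C * M + MF * M)) => //.
- exact: measurable_funM.
- by apply: measurable_funD; exact: measurable_funM.
- exact: (bounded_support_mul MF0 M0 hMF').
- move=> x t t1; have [xM|xM] := leP `|x| (M + 1); last first.
    rewrite shift0// psi0; last lra.
    by rewrite !mulr0 subrr normr0 mulr_ge0// addr_ge0// mulr_ge0.
  have -> : F (x + t *: e_ i) * psi (x + t *: e_ i) - F x * psi x =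
    (F (x + t *: e_ i) - F x) * psi (x + t *: e_ i) + F x * (psi (x + t *: e_ i) - psi x).
    by ring.
  apply: le_trans (ler_normD _ _) _; rewrite !normrM mulrDl; apply: lerD.
    by rewrite mulrAC; apply: ler_pM.
  by rewrite -mulrA; apply: ler_pM => //; exact: hMF.
- have s0 : s != 0 by rewrite -normr_eq0 s1 oner_eq0.
  apply: filterS aeF => x hx.
  have cvx : psi (x + (s / k.+1%:R) *: e_ i) @[k --> \oo] --> psi x.
    have h1 : x + (s / k.+1%:R) *: e_ i @[k --> \oo] --> x.
      rewrite -[X in _ --> X]addr0 -[X in _ --> x + X](scale0r (e_ i)).
      apply: cvgD; first exact: cvg_cst.
      apply: cvgZ; last exact: cvg_cst.
      rewrite -[X in _ --> X](mulr0 s).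
      by apply: cvgM; [exact: cvg_cst | exact: cvg_harmonic].
    exact: (cvg_comp _ _ h1 (cpsi x)).
  have cvd := cvg_directional s0 (test_function_is_derive i x tp).
  rewrite (_ : (fun k => _) = (fun k =>
     (k.+1%:R * (F (x + (s / k.+1%:R) *: e_ i) - F x)) * psi (x + (s / k.+1%:R) *: e_ i) +
     F x * (k.+1%:R * (psi (x + (s / k.+1%:R) *: e_ i) - psi x)))); last first.
    by apply/funext => k; ring.
  have -> : s * (F x * partial i psi x + F' x * psi x) =
     s * F' x * psi x + F x * (s * partial i psi x) by ring.
  apply: cvgD; last by apply: cvgM; [exact: cvg_cst | exact: cvd].
  (* Where [psi x = 0] the quotients of [F] need not converge, but they are bounded by [C] and the
     values of [psi] along the steps tend to 0. *)
  have [px|px] := eqVneq (psi x) 0; last by apply: cvgM => //; exact: hx.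
  rewrite px mulr0; rewrite px in cvx; apply/cvgr0Pnorm_lt => e e0.
  have C1 : 0 < C + 1 by lra.
  move/cvgr0Pnorm_lt: cvx => /(_ _ (divr_gt0 e0 C1)); apply: filterS => k.
  rewrite ltr_pdivlMr// => hk; rewrite normrM; apply: le_lt_trans hk.
  rewrite mulrC; apply: ler_wpM2l => //; rewrite normrM ger0_norm//.
  apply: (le_trans (ler_wpM2l (ler0n _ _) (lF x (s / k.+1%:R)))).
  rewrite normrM s1 mul1r ger0_norm ?invr_ge0// mulrCA divff ?mulr1; last by rewrite pnatr_eq0.
  by lra.
Qed.

Implicit Types (c d : E).

Lemma obox_indicator_approximation c d : exists psi_ : nat -> E -> R,
  [/\ forall k, test_function (obox c d) (psi_ k),
      forall k x, 0 <= psi_ k x <= 1 &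
      forall x, psi_ k x @[k --> \oo] --> (\1_(obox c d) x : R)].
Proof.
(* Because of the shift by 2, this step is 0 up to [c_i + 1 / k.+1] and 1 from [c_i + 3 / k.+1] on,
   and symmetrically at [d_i]: the support is compact in the open box and the limit is its
   indicator. *)
pose left k i (t : R) := smoothstep (k.+1%:R * t + (- k.+1%:R * c ord0 i - 2)) : R.
pose right k i (t : R) := smoothstep (- k.+1%:R * t + (k.+1%:R * d ord0 i - 2)) : R.
pose th k i t := left k i t * right k i t.
have sth k i : smooth_fun (th k i).
  by move=> l; apply: smooth1M; apply: smooth1_affine; exact: smooth_smoothstep.
have k0 k : (0 : R) < k.+1%:R by [].
have th_itv k i t : 0 <= th k i t <= 1.
  rewrite /th /left /right; have /andP[a1 a2] := smoothstep_itv (k.+1%:R * t + (- k.+1%:R * c ord0 i - 2)).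
  have /andP[b1 b2] := smoothstep_itv (- k.+1%:R * t + (k.+1%:R * d ord0 i - 2)).
  by rewrite mulr_ge0//= mulr_ile1.
have th_neq0 k i t : th k i t != 0 -> c ord0 i + k.+1%:R^-1 <= t <= d ord0 i - k.+1%:R^-1.
  rewrite mulf_eq0 negb_or => /andP[l r]; apply/andP; split.
    rewrite leNgt; apply: contra_neqN l => h; apply: smoothstep0.
    have : k.+1%:R * t < k.+1%:R * (c ord0 i + k.+1%:R^-1) by rewrite ltr_pM2l.
    by rewrite mulrDr divff ?gt_eqF//; lra.
  rewrite leNgt; apply: contra_neqN r => h; apply: smoothstep0.
  have : k.+1%:R * (d ord0 i - k.+1%:R^-1) < k.+1%:R * t by rewrite ltr_pM2l.
  by rewrite mulrBr divff ?gt_eqF//; lra.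
exists (fun k => tensor (th k)); split.
- move=> k; apply: (@test_function_within _ _ _
    [set v : E | forall i, `[c ord0 i + k.+1%:R^-1, d ord0 i - k.+1%:R^-1]%classic (v ord0 i)]).
  + by apply: smooth_tensor => i; exact: sth.
  + by apply: (@rV_compact _ _ (fun i => `[c ord0 i + k.+1%:R^-1, d ord0 i - k.+1%:R^-1]%classic)) => i; exact: segment_compact.
  + move=> v /= h i; have := h i; rewrite in_itv/= => /andP[h1 h2].
    have kV : (0 : R) < k.+1%:R^-1 by rewrite invr_gt0.
    apply/andP; split; first by apply: lt_le_trans h1; rewrite ltrDl.
    by apply: le_lt_trans h2 _; rewrite ltrBlDr ltrDl.
  + by move=> v /prodf_neq0 h i /=; rewrite in_itv/=; apply: th_neq0; exact: h.
- move=> k x; apply/andP; split.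
    by apply: prodr_ge0 => i _; have /andP[] := th_itv k i (x ord0 i).
  by apply: prodr_ile1 => i _; exact: th_itv.
- move=> x; rewrite indicE; have [/set_mem xB|/negP xB] := boolP (x \in obox c d).
    have big_k i : \forall k \near \oo, th k i (x ord0 i) = 1.
      have /andP[h1 h2] := xB i.
      have e0 : 0 < Num.min (x ord0 i - c ord0 i) (d ord0 i - x ord0 i) / 3.
        by rewrite divr_gt0// lt_min !subr_gt0 h1.
      apply: filterS (near_infty_natSinv_lt (PosNum e0)) => k /= hk.
      have m1 : Num.min (x ord0 i - c ord0 i) (d ord0 i - x ord0 i) <= x ord0 i - c ord0 i.
        by rewrite ge_min lexx.
      have m2 : Num.min (x ord0 i - c ord0 i) (d ord0 i - x ord0 i) <= d ord0 i - x ord0 i.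
        by rewrite ge_min lexx orbT.
      have k1 : 3 < k.+1%:R * (x ord0 i - c ord0 i).
        rewrite mulrC -ltr_pdivrMr//.
        by move: (k.+1%:R^-1 : R) hk => y hy; lra.
      have k2 : 3 < k.+1%:R * (d ord0 i - x ord0 i).
        rewrite mulrC -ltr_pdivrMr//.
        by move: (k.+1%:R^-1 : R) hk => y hy; lra.
      by rewrite /th /left /right !smoothstep1 ?mulr1//; lra.
    have : \forall k \near \oo, tensor (th k) x = 1.
      have hall : \forall k \near \oo, forall i, th k i (x ord0 i) = 1.
        exact: filter_forall.
      by apply: filterS hall => k hk; apply: big1 => i _; exact: hk.
    move=> h1; apply: cvg_near_cst; exact: h1.
  apply: cvg_near_cst; apply: nearW => k /=.
  have [i hi] : exists i, ~ (c ord0 i < x ord0 i < d ord0 i).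
    by apply: contrapT => /forallNP h; apply: xB; rewrite inE => i; exact: contrapT (h i).
  rewrite (tensorD1 _ i) (_ : th k i (x ord0 i) = 0) ?mul0r//.
  apply/eqP; apply: contra_notT hi => /th_neq0 /andP[h1 h2].
  have kV : (0 : R) < k.+1%:R^-1 by rewrite invr_gt0.
  apply/andP; split; first by apply: lt_le_trans h1; rewrite ltrDl.
  by apply: le_lt_trans h2 _; rewrite ltrBlDr ltrDl.
Qed.

(** The fundamental lemma of the calculus of variations: test functions approximate the indicators
    of subboxes, and the integrals over subboxes determine [h] almost everywhere. *)
Lemma test_function_ae_eq0 c d (h : E -> R) :
  mu.-integrable (obox c d) (EFin \o h) ->
  (forall psi, test_function (obox c d) psi ->
     \int[mu]_(x in obox c d) (h x * psi x) = 0) ->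
  {ae mu, forall x, obox c d x -> h x = 0}.
Proof.
move=> ih h0; apply: integral_obox_ae_eq0 => // c' d' sub.
have [psi_ [tpsi psi01 cvpsi]] := obox_indicator_approximation c' d'.
have mB := measurable_obox c d; have mB' := measurable_obox c' d'.
have mh : measurable_fun (obox c d) h by apply/measurable_EFinP; have /integrableP[] := ih.
have mpsi k : measurable_fun setT (psi_ k).
  by apply: continuous_measurable_rV; exact: test_function_continuous (tpsi k).
have m1 k : measurable_fun (obox c d) (fun x => h x * psi_ k x).
  by apply: measurable_funM => //; exact: measurable_funTS.
have m2 : measurable_fun (obox c d) (fun x => h x * \1_(obox c' d') x).
  by apply: measurable_funM => //; exact: measurable_indic.
have cv0 : {ae mu, forall x, obox c d x ->
    h x * psi_ k x @[k --> \oo] --> h x * (\1_(obox c' d') x : R)}.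
  by apply: aeW => x _; apply: cvgM; [exact: cvg_cst | exact: cvpsi].
have le0 : {ae mu, forall x k, obox c d x -> `|h x * psi_ k x| <= `|h x|}.
  apply: aeW => x k _; have /andP[p0 p1] := psi01 k x.
  by rewrite normrM ler_piMr// ger0_norm.
have [_ cv] := Rintegral_dominated mB m1 m2 cv0 (integrable_norm ih) le0.
have tpsi' k : test_function (obox c d) (psi_ k).
  by have [t1 t2 t3] := tpsi k; split => //; exact: subset_trans t3 sub.
have e0 : \int[mu]_(x in obox c d) (h x * \1_(obox c' d') x) = 0.
  apply: cvg_unique cv _ => //.
  rewrite (_ : (fun k => _) = fun=> 0); first exact: cvg_cst.
  by apply/funext => k; exact: h0.
rewrite -e0 (_ : obox c' d' = obox c d `&` obox c' d'); last by rewrite setIidr.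
rewrite Rintegral_mkcondr setIidr//; congr fine; apply: eq_integral => x _.
by rewrite patchE indicE; case: (x \in obox c' d'); rewrite ?mulr1 ?mulr0.
Qed.

End test_functions.

(** * One-sided partial derivatives of a convex function and the weak gradient *)

Section one_sided_derivatives.
Context {R : realType} {n : nat}.
Local Notation E := 'rV[R]_n.
Local Notation mu := (@lebesgue_rV R n).
Local Notation e_ i := (delta_mx ord0 i : E).
Variables (U : E -> R) (L : R).
Hypotheses (cU : convex_within setT U) (L0 : 0 <= L) (lU : lipschitz_within setT L U).
Implicit Types (x : E) (i : 'I_n) (s : R).

Definition difference_quotient i s x k : R :=
  k.+1%:R * (U (x + (s / k.+1%:R) *: e_ i) - U x).

(* The derivative along the half-line of direction [s e_i], where [s = 1] or
   [s = -1]; the factor [s] makes it the right or left partial derivative. *)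
Definition one_sided_partial i s x : R := s * limn (difference_quotient i s x).

Lemma difference_quotient_le i s x k : `|s| = 1 -> `|difference_quotient i s x k| <= L.
Proof.
move=> s1; rewrite /difference_quotient normrM ger0_norm// -ler_pdivlMl//.
apply: le_trans (lipschitz_abs _ _ lU) _; rewrite enorm_step.
by rewrite normrM s1 mul1r ger0_norm ?invr_ge0// mulrC.
Qed.

Lemma difference_quotient_nonincreasing i s x :
  {homo difference_quotient i s x : k m / (k <= m)%N >-> m <= k}.
Proof.
move=> k m km; rewrite /difference_quotient.
have k0 : 0 < k.+1%:R :> R by []. have m0 : 0 < m.+1%:R :> R by [].
pose t : R := k.+1%:R / m.+1%:R.
have t0 : 0 <= t by rewrite divr_ge0.
have t1 : t <= 1 by rewrite ler_pdivrMr// mul1r ler_nat.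
have := cU (x := x + (s / k.+1%:R) *: e_ i) (y := x) I I t0 t1.
have -> : t *: (x + (s / k.+1%:R) *: e_ i) + (1 - t) *: x = x + (s / m.+1%:R) *: e_ i.
  by apply/rowP => j; rewrite !mxE /t; field; rewrite !gt_eqF.
move=> h; rewrite -ler_pdivlMl// mulrA [_^-1 * _]mulrC -/t; lra.
Qed.

Lemma one_sided_partial_cvg i s x : `|s| = 1 ->
  difference_quotient i s x k @[k --> \oo] --> s * one_sided_partial i s x.
Proof.
move=> s1; rewrite /one_sided_partial mulrA -expr2 -real_normK ?num_real// s1 expr1n mul1r.
apply: nonincreasing_is_cvgn; first exact: difference_quotient_nonincreasing.
exists (- L) => _ [k _ <-]; rewrite lerNl; apply: le_trans (ler_norm _) _.
by rewrite normrN; exact: difference_quotient_le.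
Qed.

Lemma one_sided_partial_le i s x : `|s| = 1 -> `|one_sided_partial i s x| <= L.
Proof.
move=> s1; have cv := @one_sided_partial_cvg i s x s1.
have -> : `|one_sided_partial i s x| = `|s * one_sided_partial i s x|.
  by rewrite [in RHS]normrM s1 mul1r.
have cvq : cvgn (difference_quotient i s x) by apply/cvg_ex; eexists; exact: cv.
rewrite -(cvg_lim _ cv)// ler_norml; apply/andP; split.
  apply: limr_ge => //; apply: nearW => k.
  by have := @difference_quotient_le i s x k s1; rewrite ler_norml => /andP[].
apply: limr_le => //; apply: nearW => k.
by have := @difference_quotient_le i s x k s1; rewrite ler_norml => /andP[].
Qed.

Lemma measurable_one_sided_partial i s : `|s| = 1 ->
  measurable_fun setT (one_sided_partial i s).
Proof.
move=> s1; have mU : measurable_fun setT U.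
  by apply: continuous_measurable_rV; exact: lipschitz_continuous lU.
have s2 : s * s = 1 by rewrite -expr2 -real_normK ?num_real// s1 expr1n.
apply: (@measurable_fun_cvg _ _ _ _ (fun k x => s * difference_quotient i s x k)).
  move=> k; apply: measurable_funM => //; apply: measurable_funM => //.
  apply: measurable_funB => //.
  exact: measurableT_comp mU (measurable_shift _).
move=> x _; rewrite -[one_sided_partial i s x]mul1r -s2 -mulrA.
by apply: cvgM; [exact: cvg_cst | exact: one_sided_partial_cvg].
Qed.

(** For [s = 1] this bounds the coordinate of [xi] above by the right derivative, for [s = -1] below
    by the left one; a subgradient is thus determined where the two agree. *)
Lemma subdifferential_one_sided x (xi : E) i s : `|s| = 1 -> subdifferential U x xi ->
  s * xi ord0 i <= s * one_sided_partial i s x.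
Proof.
move=> s1 hxi; have cv := @one_sided_partial_cvg i s x s1.
rewrite -(cvg_lim _ cv)//; apply: limr_ge; first by apply/cvg_ex; eexists; exact: cv.
apply: nearW => k; rewrite /difference_quotient.
have := hxi (x + (s / k.+1%:R) *: e_ i).
rewrite [x + _ - x]addrAC subrr add0r innerZr inner_delta => h.
rewrite -ler_pdivrMl// (_ : _^-1 * _ = (s / k.+1%:R) * xi ord0 i); last ring.
by rewrite lerBrDl.
Qed.

(** Both one-sided partial derivatives exist everywhere, are bounded, and by integration by parts
    are weak partial derivatives of [u] on the box; so each equals the coordinate of [G] almost
    everywhere, and any subgradient is squeezed between them. Differentiability almost everywhere is
    thus obtained rather than presupposed. *)
Lemma unique_subgradient_ae (O : set E) (u : E -> R) (G : E -> E) (c d : E) :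
  weak_gradient O u G ->
  [set v : E | forall i, c ord0 i <= v ord0 i <= d ord0 i] `<=` O ->
  (forall x, obox c d x -> U x = u x) ->
  {ae mu, forall x, obox c d x ->
    subdifferential U x (G x) /\ forall zeta, subdifferential U x zeta -> zeta = G x}.
Proof.
move=> [_ GL wG] KO Uu.
(* The closed box, because integrability of [G] is given on compact subsets of [O]. *)
pose K : set E := [set v : E | forall i, `[c ord0 i, d ord0 i]%classic (v ord0 i)].
have cK : compact K.
  by apply: (@rV_compact _ _ (fun i => `[c ord0 i, d ord0 i]%classic)) => i; exact: segment_compact.
have {}KO : K `<=` O by move=> v Kv; apply: KO => i; have := Kv i; rewrite /= in_itv.
have QK : obox c d `<=` K.
  by move=> v Qv i; have /andP[h1 h2] := Qv i; rewrite /= in_itv/= !ltW.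
have mQ := measurable_obox c d.
have mK := compact_measurable_rV cK.
have key i s : `|s| = 1 -> {ae mu, forall x, obox c d x -> G x ord0 i - one_sided_partial i s x = 0}.
  move=> s1.
  have iG : mu.-integrable (obox c d) (EFin \o (fun x => G x ord0 i)).
    exact: integrableS mK mQ QK (Lp1_integrable mK (GL i K cK KO)).
  have mp := @measurable_one_sided_partial i s s1.
  have ip : mu.-integrable (obox c d) (EFin \o one_sided_partial i s).
    apply: (bounded_integrable mQ (B := L)); first exact: obox_volume_lty.
      exact: measurable_funTS.
    by move=> x _; exact: one_sided_partial_le.
  apply: test_function_ae_eq0.
    exact: (integrableB mQ iG ip).
  move=> psi tpsi.
  have tpsiO : test_function O psi.
    by have [t1 t2 t3] := tpsi; split => // x /t3 /QK /KO.
  have psi0 x := test_function_eq0 (x := x) tpsi.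
  have dpsi0 x := test_function_partial_eq0 i (x := x) tpsi.
  have mpsi : measurable_fun setT psi.
    by apply: continuous_measurable_rV; exact: test_function_continuous tpsi.
  have [M [_ psiM _ _ _]] := test_function_bounds i tpsi.
  have restr (h : E -> R) (W : set E) : obox c d `<=` W ->
      \int[mu]_(x in W) (h x * psi x) = \int[mu]_(x in obox c d) (h x * psi x).
    move=> QW; rewrite Rintegral_support => [|x nW]; last by rewrite psi0 ?mulr0// => /QW.
    by rewrite [RHS]Rintegral_support// => x /psi0 ->; rewrite mulr0.
  have h1 := wG psi i tpsiO.
  have h2 : \int[mu]_(x in O) (u x * partial i psi x) = \int[mu]_x (U x * partial i psi x).
    rewrite Rintegral_mkcond; apply: eq_Rintegral => x _; rewrite patchE.
    have [Qx|nQx] := pselect (obox c d x).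
      by rewrite Uu// mem_set//; exact/KO/QK.
    by rewrite dpsi0// !mulr0; case: ifP.
  have h3 : \int[mu]_x (U x * partial i psi x) =
            - \int[mu]_x (one_sided_partial i s x * psi x).
    apply: (@integration_by_parts_test R n (obox c d) U _ psi i s L) => //.
    + exact: lipschitz_continuous lU.
    + by move=> x; exact: one_sided_partial_le.
    + move=> x t; apply: le_trans (lipschitz_abs _ _ lU) _.
      by rewrite enorm_step.
    + by apply: aeW => x _; exact: one_sided_partial_cvg.
  rewrite h2 h3 (restr (fun x => one_sided_partial i s x))// in h1.
  rewrite (restr (fun x => G x ord0 i)) in h1; last by move=> x /QK /KO.
  have -> : (fun x => (G x ord0 i - one_sided_partial i s x) * psi x) =
     (fun x => G x ord0 i * psi x - one_sided_partial i s x * psi x).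
    by apply/funext => x; rewrite mulrBl.
  rewrite RintegralB//.
  - by move/oppr_inj: h1 => ->; rewrite subrr.
  - exact: (integrable_mul_bounded mQ iG (measurable_funTS mpsi) (fun x _ => psiM x)).
  - exact: (integrable_mul_bounded mQ ip (measurable_funTS mpsi) (fun x _ => psiM x)).
have keys s : `|s| = 1 -> {ae mu, forall x i, obox c d x ->
    G x ord0 i - one_sided_partial i s x = 0}.
  by move=> s1; apply: filter_forall => i; exact: key.
have aeR := keys 1 (normr1 _); have aeL := keys (-1) (normrN1 _).
apply: filterS2 aeR aeL => x hR hL Qx.
have uniq zeta : subdifferential U x zeta -> zeta = G x.
  move=> hz; apply/rowP => i.
  have := @subdifferential_one_sided x zeta i 1 (normr1 _) hz.
  have := @subdifferential_one_sided x zeta i (-1) (normrN1 _) hz.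
  have := hR i Qx; have := hL i Qx; rewrite !mul1r !mulN1r lerN2 => h1 h2 h3 h4.
  by apply/eqP; rewrite eq_le; apply/andP; split; lra.
split => //; have [zeta hz] := subdifferential_nonempty cU x.
by rewrite -(uniq _ hz).
Qed.

End one_sided_derivatives.

(** * Balls as Lipschitz domains *)

Section ball_domain.
Context {R : realType} {n : nat}.
Local Notation E := 'rV[R]_n.
Variables (x1 : E) (rho : R).
Hypothesis rho0 : 0 < rho.
Let D : set E := [set x | enorm (x - x1) < rho].

Lemma closure_enorm_ball : closure D `<=` [set x | enorm (x - x1) <= rho].
Proof.
rewrite (_ : [set x | _] = closure [set x | enorm (x - x1) <= rho]).
  by apply: closureS => x /= /ltW.
apply/closure_id; apply: compact_closed; first exact: norm_hausdorff.
exact: enorm_ball_compact.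
Qed.

Lemma connected_enorm_ball : connected D.
Proof.
have Dx1 : D x1 by rewrite /D /= subrr enorm0.
pose seg (x : E) (t : R) : E := x1 + t *: (x - x1).
have -> : D = \bigcup_(x in D) (seg x @` `[0, 1]%classic).
  apply/seteqP; split => [x Dx|y [x Dx [t /= tI <-]]].
    by exists x => //; exists 1; rewrite /= ?in_itv/= ?ler01 ?lexx// /seg scale1r subrKC.
  move: tI; rewrite in_itv/= => /andP[t0 t1].
  rewrite /D /= /seg [x1 + _]addrC addrK enormZ ger0_norm//.
  by apply: le_lt_trans Dx; rewrite ler_piMl// enorm_ge0.
apply: bigcup_connected.
  exists x1 => x Dx; exists 0; rewrite /= ?in_itv/= ?lexx ?ler01//.
  by rewrite /seg scale0r addr0.
move=> x Dx; apply: connected_continuous_connected; first exact: segment_connected.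
apply: continuous_subspaceT => t; rewrite /seg.
apply: cvgD; first exact: cvg_cst.
by apply: cvgZ; [exact: cvg_id | exact: cvg_cst].
Qed.

(** Both roots [A] and [B] are at least [rho / 2], and [A^2 - B^2 = (b - a) (b + a)] with
    [a + b <= rho <= A + B]. *)
Lemma sqrt_sub_sqr_lipschitz (a b : R) : 0 <= a <= rho / 2 -> 0 <= b <= rho / 2 ->
  Num.sqrt (rho ^+ 2 - a ^+ 2) - Num.sqrt (rho ^+ 2 - b ^+ 2) <= `|a - b|.
Proof.
move=> /andP[a0 a1] /andP[b0 b1].
have A0 : 0 <= rho ^+ 2 - a ^+ 2 by nra.
have B0 : 0 <= rho ^+ 2 - b ^+ 2 by nra.
have half0 : 0 < rho / 2 by rewrite divr_gt0.
have half c : 0 <= c -> c <= rho / 2 -> rho / 2 <= Num.sqrt (rho ^+ 2 - c ^+ 2).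
  move=> c0 c1; rewrite -[leLHS]ger0_norm ?(ltW half0)// -sqrtr_sqr ler_sqrt; nra.
have SA := half _ a0 a1; have SB := half _ b0 b1.
set A := Num.sqrt _ in SA *; set B := Num.sqrt _ in SB *.
have e1 : (A - B) * (A + B) = (b - a) * (a + b).
  by rewrite -subr_sqr /A /B !sqr_sqrtr//; ring.
have S0 : 0 < A + B by lra.
rewrite -(ler_pM2r S0) e1.
apply: (@le_trans _ _ (`|a - b| * (a + b))).
  by apply: ler_wpM2r; [exact: addr_ge0 | rewrite distrC; exact: ler_norm].
by apply: ler_wpM2l => //; lra.
Qed.

Lemma enorm_sqr_sub_scale (w e : E) (s : R) : inner e e = 1 ->
  enorm (w - s *: e) ^+ 2 = enorm w ^+ 2 - 2 * s * inner w e + s ^+ 2.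
Proof.
move=> ee; rewrite !enorm_sqr innerBl !innerBr !innerZl !innerZr ee (innerC e w).
ring.
Qed.

(** The equation is posed on bounded Lipschitz domains, and balls are the ones it is used on. Near a
    boundary point the ball lies above a hemisphere, which is a graph in the direction of the inward
    normal [e]. *)
Lemma ball_bounded_lipschitz_domain : bounded_lipschitz_domain D.
Proof.
have Dx1 : D x1 by rewrite /D /= subrr enorm0.
have oD : open D by exact: open_enorm.
split.
- by split => //; [exact: connected_enorm_ball | exists x1].
- have [M [Mr hM]] := compact_bounded (@enorm_ball_compact R n x1 rho).
  by exists M; split => // N MN x /= /ltW Dx; exact: (hM N MN x Dx).
move=> x0 [cx0 nx0].
have x0rho : enorm (x0 - x1) = rho.
  apply/eqP; rewrite eq_le (closure_enorm_ball cx0)/= leNgt; apply/negP => h.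
  by apply: nx0; rewrite /= (interior_id _).1.
pose e : E := - rho^-1 *: (x0 - x1).
have e1 : enorm e = 1.
  by rewrite /e enormZ normrN gtr0_norm ?invr_gt0// x0rho mulVf// gt_eqF.
have ee : inner e e = 1 by rewrite -enorm_sqr e1 expr1n.
have x0E : x0 - x1 = - rho *: e.
  by rewrite /e scalerA mulrNN divff ?scale1r// gt_eqF.
pose c := inner x1 e; pose x1' := x1 - c *: e.
(* Distance to the projection [x1'] of the centre, cut off at [rho / 2]: this makes [gamma]
   Lipschitz on the whole space, and the cut-off is inactive within [rho / 2] of [x0]. *)
pose m (y : E) := Num.min (enorm (y - x1')) (rho / 2).
have m_itv y : 0 <= m y <= rho / 2.
  by rewrite /m le_min enorm_ge0 ge_min lexx orbT divr_ge0 ?ltW.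
pose gamma y := c - Num.sqrt (rho ^+ 2 - m y ^+ 2).
exists (rho / 2), e, gamma, 1; split => //.
- by rewrite divr_gt0.
- have mlip y z : `|m y - m z| <= enorm (y - z).
    have h : `|enorm (y - x1') - enorm (z - x1')| <= enorm (y - z).
      apply: le_trans (enorm_lipschitz _ _) _; rewrite (_ : _ - _ - _ = y - z)//.
      by apply/rowP => i; rewrite !mxE; ring.
    move: h; rewrite !ler_norml /m => /andP[h1 h2].
    by case: (leP (enorm (y - x1'))) => h3; case: (leP (enorm (z - x1'))) => h4;
      apply/andP; split; have := enorm_ge0 (y - z); lra.
  move=> y z; rewrite mul1r; apply: le_trans (mlip y z).
  have h1 := sqrt_sub_sqr_lipschitz (m_itv y) (m_itv z).
  have h2 := sqrt_sub_sqr_lipschitz (m_itv z) (m_itv y).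
  by rewrite distrC in h2; rewrite /gamma ler_norml; apply/andP; split; lra.
- move=> x xr.
  pose w := x - x0; pose t := inner x e.
  have tE : t - c = inner w e - rho.
    have : inner (x - x1) e = inner w e + inner (x0 - x1) e.
      by rewrite -innerDl /w addrA subrK.
    by rewrite x0E innerZl ee mulr1 innerBl.
  have we : `|inner w e| < rho / 2.
    by apply: le_lt_trans (cauchy_schwarz_abs _ _) _; rewrite e1 mulr1.
  have tc : t - c < 0 by move: we; rewrite ltr_norml => /andP[w1 w2]; lra.
  pose y := x - t *: e.
  have yE : y - x1' = w - inner w e *: e.
    have wE : w = (x - x1) + rho *: e.
      by rewrite -[rho *: e]opprK -scaleNr -x0E /w opprB addrA subrK.
    have -> : inner w e = t - c + rho by rewrite tE subrK.
    by rewrite wE /y /x1'; apply/rowP => i; rewrite !mxE; ring.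
  have ysq : enorm (y - x1') ^+ 2 = enorm w ^+ 2 - inner w e ^+ 2.
    by rewrite yE enorm_sqr_sub_scale//; ring.
  have my : m y = enorm (y - x1').
    rewrite /m min_l// -(@ler_pXn2r _ 2)// ?nnegrE ?enorm_ge0 ?divr_ge0 ?(ltW rho0)//.
    rewrite ysq; have : enorm w ^+ 2 <= (rho / 2) ^+ 2.
      by rewrite ler_pXn2r ?nnegrE ?enorm_ge0 ?divr_ge0 ?(ltW rho0)// ltW.
    by have := sqr_ge0 (inner w e); lra.
  have xsq : enorm (x - x1) ^+ 2 = m y ^+ 2 + (t - c) ^+ 2.
    have xE : x - x1 = w - rho *: e by rewrite -scaleNr -x0E /w addrA subrK.
    by rewrite my ysq tE xE enorm_sqr_sub_scale//; ring.
  have /andP[m0 m1] := m_itv y.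
  have A0 : 0 <= rho ^+ 2 - m y ^+ 2 by nra.
  have Dsq : D x <-> enorm (x - x1) ^+ 2 < rho ^+ 2.
    by rewrite /D /= ltr_pXn2r ?nnegrE ?enorm_ge0 ?(ltW rho0).
  rewrite -/t -/y /gamma ltrBlDr -ltrBlDl.
  have -> : (c - t < Num.sqrt (rho ^+ 2 - m y ^+ 2)) = (enorm (x - x1) ^+ 2 < rho ^+ 2).
    rewrite -[in LHS](@ltr_pXn2r _ 2)// ?nnegrE ?sqrtr_ge0//; last lra.
    by rewrite (sqr_sqrtr A0) xsq -[(c - t) ^+ 2]sqrrN opprB ltrBrDl.
  exact: Dsq.
Qed.

End ball_domain.

(** * Monotonicity of the flux *)

Section monotonicity.
Context {R : realType} {n : nat}.
Local Notation E := 'rV[R]_n.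
Implicit Types (z w xi : E) (p : R).

Lemma subdifferential_enorm_le z w : subdifferential enorm z w -> enorm w <= 1.
Proof.
move=> h; have := h (z + w); rewrite [z + w - z]addrAC subrr add0r => h1.
have h2 := enormD z w.
have [->|w0] := eqVneq w 0; first by rewrite enorm0.
rewrite -(ler_pM2r (enorm_gt0 w0)) mul1r enormE; lra.
Qed.

Lemma subdifferential_enorm_nonempty z : exists w, subdifferential enorm z w.
Proof.
have [->|z0] := eqVneq z 0.
  by exists 0 => y; rewrite enorm0 inner0l addr0 enorm_ge0.
have ez := enorm_gt0 z0.
exists ((enorm z)^-1 *: z) => y; rewrite innerZl innerBr -enormE.
rewrite mulrBr mulrA mulVf ?gt_eqF// mul1r addrC subrK.
by rewrite ler_pdivrMl//; exact: cauchy_schwarz.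
Qed.

Lemma subdifferential_monotone (g : E -> R) z z' w w' :
  subdifferential g z w -> subdifferential g z' w' -> 0 <= inner (w - w') (z - z').
Proof.
move=> h h'; have := h z'; have := h' z.
rewrite -[z' - z]opprB innerNr innerBl; lra.
Qed.

Lemma powR_subr2 p (a : R) : 1 < p -> 0 <= a -> a `^ (p - 2) * a = a `^ (p - 1).
Proof.
move=> p1; rewrite le_eqVlt => /predU1P[<-|a0].
  by rewrite mulr0 powR0// gt_eqF// subr_gt0.
rewrite -[X in _ * X](powRr1 (ltW a0)) -powRD; last by rewrite (gt_eqF a0) implybT.
by congr (_ `^ _); ring.
Qed.

Lemma enorm_pflux p z : 1 < p -> enorm (pflux p z) = enorm z `^ (p - 1).
Proof. by move=> p1; rewrite /pflux enormZ ger0_norm ?powR_ge0// powR_subr2// enorm_ge0. Qed.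

(** The product splits into a radial and an angular part, both nonnegative for [p > 1]; this form
    avoids distinguishing [p < 2] from [p > 2]. *)
Lemma inner_pflux p z xi : 1 < p ->
  inner (pflux p z - pflux p xi) (z - xi) =
  (enorm z `^ (p - 1) - enorm xi `^ (p - 1)) * (enorm z - enorm xi) +
  (enorm z `^ (p - 2) + enorm xi `^ (p - 2)) * (enorm z * enorm xi - inner z xi).
Proof.
move=> p1; rewrite /pflux innerBl !innerBr !innerZl (innerC xi z).
rewrite -!powR_subr2 ?enorm_ge0// -!enormE; ring.
Qed.

Lemma inner_pflux_ge0_part p z xi :
  0 <= (enorm z `^ (p - 2) + enorm xi `^ (p - 2)) * (enorm z * enorm xi - inner z xi).
Proof.
apply: mulr_ge0; first by rewrite addr_ge0 ?powR_ge0.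
by rewrite subr_ge0; exact: cauchy_schwarz.
Qed.

(** Either [|z|] differs from [|xi|] by at least [delta / 2] and the radial part is large, or it
    does not and the angular part is; there only the coefficient [|xi|^(p-2)], which is fixed and
    positive, is kept. For [xi = 0] the only case that occurs is [|z| >= |xi| + delta / 2]. *)
Lemma pflux_strongly_monotone p xi (delta : R) : 1 < p -> 0 < delta ->
  exists2 kappa : R, 0 < kappa & forall z, delta <= enorm (z - xi) ->
    kappa <= inner (pflux p z - pflux p xi) (z - xi).
Proof.
move=> p1 d0; pose s := enorm xi; have s0 : 0 <= s by exact: enorm_ge0.
have p10 : 0 < p - 1 by rewrite subr_gt0.
have mono (a b : R) : 0 <= a -> a <= b -> a `^ (p - 1) <= b `^ (p - 1).
  by move=> a0 ab; apply: ge0_ler_powR; rewrite ?nnegrE ?(ltW p10) ?(le_trans a0).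
pose r := Num.max 0 (s - delta / 2).
have r0 : 0 <= r by rewrite /r le_max lexx.
have d2 : 0 < delta / 2 by rewrite divr_gt0.
pose k1 := ((s + delta / 2) `^ (p - 1) - s `^ (p - 1)) * (delta / 2).
have k1_gt0 : 0 < k1.
  by rewrite mulr_gt0// subr_gt0 gt0_ltr_powR// ?nnegrE ?addr_ge0 ?(ltW d2)// ltrDl.
pose k2 := (s `^ (p - 1) - r `^ (p - 1)) * (delta / 2).
(* The constant comes from [|z - xi|^2 = (|z| - |xi|)^2 + 2 (|z| |xi| - <z, xi>)], where the first
   square is at most [delta^2 / 4]. *)
pose k3 := s `^ (p - 2) * (3 / 8 * delta ^+ 2).
have k2_gt0 : 0 < s -> 0 < k2.
  move=> s_gt0; rewrite mulr_gt0// subr_gt0 gt0_ltr_powR// ?nnegrE//.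
  by rewrite /r gt_max s_gt0 ltrBlDr ltrDl.
have k3_gt0 : 0 < s -> 0 < k3.
  by move=> s_gt0; rewrite mulr_gt0 ?powR_gt0// mulr_gt0 ?exprn_gt0// divr_gt0.
have main z : delta <= enorm (z - xi) ->
   [\/ k1 <= inner (pflux p z - pflux p xi) (z - xi),
       0 < s /\ k2 <= inner (pflux p z - pflux p xi) (z - xi) |
       0 < s /\ k3 <= inner (pflux p z - pflux p xi) (z - xi)].
  move=> hz; rewrite inner_pflux// -/s; have q := inner_pflux_ge0_part p z xi.
  have sq : enorm (z - xi) ^+ 2 =
      (enorm z - enorm xi) ^+ 2 + 2 * (enorm z * enorm xi - inner z xi).
    by rewrite enorm_sqr innerBl !innerBr (innerC xi z) -!enormE; ring.
  rewrite -/s in q sq; set a := enorm z in q sq *; have a0 : 0 <= a by exact: enorm_ge0.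
  have [h1|h1] := leP (s + delta / 2) a.
    apply: Or31; apply: le_trans (_ : (a `^ (p - 1) - s `^ (p - 1)) * (a - s) <= _); last by rewrite lerDl.
    apply: ler_pM; [|exact: ltW| |lra].
      by rewrite subr_ge0; apply: mono => //; rewrite lerDl ltW.
    by rewrite lerB//; apply: mono => //; rewrite addr_ge0// ltW.
  have [h2|h2] := leP a (s - delta / 2).
    have s_gt0 : 0 < s by lra.
    apply: Or32; split => //.
    apply: le_trans (_ : (a `^ (p - 1) - s `^ (p - 1)) * (a - s) <= _); last by rewrite lerDl.
    rewrite -[leRHS]mulrNN !opprB; apply: ler_pM; [|exact: ltW| |lra].
      by rewrite subr_ge0; apply: mono => //; rewrite /r ge_max s0; lra.
    by rewrite lerB//; apply: mono => //; rewrite /r le_max h2 orbT.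
  have hsq : delta ^+ 2 <= enorm (z - xi) ^+ 2 by rewrite ler_pXn2r ?nnegrE ?enorm_ge0 ?(ltW d0).
  have has : (a - s) ^+ 2 <= delta ^+ 2 / 4 by nra.
  have c0 : 3 / 8 * delta ^+ 2 <= a * s - inner z xi by lra.
  have s_gt0 : 0 < s.
    rewrite lt_def s0 andbT; apply/eqP => sz.
    have xz : xi = 0 by apply: enorm_eq0.
    have dd : 0 < delta ^+ 2 by rewrite exprn_gt0.
    by move: c0; rewrite sz xz inner0r; lra.
  apply: Or33; split => //.
  apply: (@le_trans _ _ ((a `^ (p - 2) + s `^ (p - 2)) * (a * s - inner z xi))).
    apply: ler_pM; rewrite ?powR_ge0 ?lerDr ?powR_ge0//.
    by rewrite mulr_ge0 ?sqr_ge0// divr_ge0.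
  rewrite lerDr; have [sa|sa] := leP s a.
    by apply: mulr_ge0; rewrite subr_ge0//; exact: mono.
  by rewrite -mulrNN !opprB; apply: mulr_ge0; rewrite subr_ge0; [apply: mono|]; rewrite ?(ltW sa).
have [s_gt0|s_le0] := ltP 0 s.
  exists (Num.min k1 (Num.min k2 k3)); first by rewrite !lt_min k1_gt0 k2_gt0// k3_gt0.
  move=> z /main[h|[_ h]|[_ h]]; apply: le_trans h; rewrite !ge_min lexx ?orbT//.
exists k1 => // z /main[//|[h]|[h]]; by move: h; rewrite ltNge s_le0.
Qed.

End monotonicity.

(** * Lebesgue and Sobolev functions *)

Section lebesgue_spaces.
Context {R : realType} {n : nat}.
Local Notation E := 'rV[R]_n.
Local Notation mu := (@lebesgue_rV R n).
Implicit Types (K D : set E) (f : E -> R).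

(** Puts finite and infinite [q] in one form: for finite [q] take [r = q] and [F = |f|^q]; for
    [q = +oo] any finite exponent above [n] serves, here [n + 1], with [F] constant. *)
Lemma Lp_majorant K q f : (0 < n)%N -> compact K -> (n%:R%:E < q)%E -> Lp K q f ->
  exists (r : R) (F : E -> R), [/\ n%:R < r, mu.-integrable K (EFin \o F),
    forall x, 0 <= F x & {ae mu, forall x, K x -> `|f x| `^ r <= F x}].
Proof.
move=> n0 cK nq Kf; have mK := compact_measurable_rV cK.
have n1 : 1 <= n%:R :> R by rewrite ler1n.
case: q nq Kf => [r|_ Kf|//].
  rewrite lte_fin => nr Kf; exists r, (fun x => `|f x| `^ r); split => //.
  - have r1 : 1 <= r by apply: le_trans n1 (ltW nr).
    have /(Lfun_integrable r1) h := Kf.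
    have {}h := integrableS measurableT mK (@subsetT _ _) h.
    apply: eq_integrable h => // x /set_mem Kx /=.
    by rewrite patchE mem_set.
  - exact: (aeW mu (fun x _ => lexx _)).
move: Kf; rewrite /Lp inE => /andP[/[!inE]/= mf]; rewrite /finite_norm unlock.
rewrite lebesgue_rV_setT_gt0 => hlt.
have := ess_sup_ge mu (abse \o (EFin \o (f \_ K))).
move: hlt; set M := ess_sup _ _ => hlt hM.
pose m := `|fine M|; have m0 : 0 <= m by exact: normr_ge0.
exists n.+1%:R, (fun=> m `^ n.+1%:R); split.
- by rewrite ltr_nat.
- apply: (bounded_integrable mK (B := m `^ n.+1%:R)) => //; first exact: compact_measure_lty.
  by move=> x _; rewrite ger0_norm ?powR_ge0.
- by move=> x; rewrite powR_ge0.
- apply: filterS hM => x hx Kx.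
  have fm : `|f x| <= m.
    move: hx; rewrite /= patchE mem_set// => hx.
    have Mfin : M \is a fin_num.
      by rewrite fin_numElt hlt andbT (lt_le_trans _ hx)// ltNyr.
    rewrite -lee_fin; apply: le_trans hx _; rewrite -(fineK Mfin) lee_fin.
    exact: ler_norm.
  by apply: ge0_ler_powR; rewrite ?nnegrE.
Qed.

Lemma le1_powR (t r : R) : 0 <= t -> 1 <= r -> t <= 1 + t `^ r.
Proof.
move=> t0 r1; have [t1|t1] := leP t 1; first by have := powR_ge0 t r; lra.
apply: le_trans (_ : t `^ r <= _); last by rewrite lerDr.
by rewrite -{1}(powRr1 t0); apply: ler_powR => //; exact: ltW.
Qed.

Lemma Lp_integrable K q f : (0 < n)%N -> compact K -> (n%:R%:E < q)%E -> Lp K q f ->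
  mu.-integrable K (EFin \o f).
Proof.
move=> n0 cK nq Kf; have mK := compact_measurable_rV cK.
have mf := Lp_measurable mK Kf.
have [r [F [nr iF F0 hF]]] := Lp_majorant n0 cK nq Kf.
have r1 : 1 <= r by apply: le_trans (ltW nr); rewrite ler1n.
have i1 : mu.-integrable K (EFin \o (fun x => 1 + F x)).
  have i0 : mu.-integrable K (EFin \o (fun=> 1)).
    apply: (bounded_integrable mK (B := 1)) => //; first exact: compact_measure_lty.
    by move=> x _; rewrite normr1.
  exact: (integrableD mK i0 iF).
apply/integrableP; split; first exact/measurable_EFinP.
have /integrableP[_] := i1; apply: le_lt_trans.
apply: ae_ge0_le_integral => //.
- by do 2 apply: measurableT_comp => //.
- apply: measurableT_comp => //; apply/measurable_EFinP.
  by apply: measurable_funD => //; apply/measurable_EFinP; have /integrableP[] := iF.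
- apply: filterS hF => x hx Kx; rewrite /= lee_fin [leRHS]ger0_norm ?addr_ge0//.
  by apply: le_trans (le1_powR (normr_ge0 _) r1) _; rewrite lerD2l; exact: hx.
Qed.

(* This is where [q > n] enters: the weights [psi] have height [eps] and mass at
   least [c * eps ^ n.+1]. *)
Lemma source_term_small K q f (c delta : R) : (0 < n)%N -> compact K ->
  (n%:R%:E < q)%E -> Lp K q f -> 0 < c -> 0 < delta ->
  exists2 e0 : R, 0 < e0 & forall (eps : R) (psi : E -> R), 0 < eps -> eps < e0 ->
    measurable_fun setT psi -> (forall x, 0 <= psi x <= eps) ->
    c * eps ^+ n.+1 <= \int[mu]_(x in K) psi x ->
    eps * \int[mu]_(x in K) (`|f x| * psi x) <= delta * \int[mu]_(x in K) psi x.
Proof.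
move=> n0 cK nq Kf c0 d0; have mK := compact_measurable_rV cK.
have mf := Lp_measurable mK Kf.
have [r [F [nr iF F0 hF]]] := Lp_majorant n0 cK nq Kf.
have r1 : 1 <= r by apply: le_trans (ltW nr); rewrite ler1n.
pose I := \int[mu]_(x in K) F x + 1.
have I0 : 0 < I by rewrite ltr_wpDl//; apply: Rintegral_ge0.
have [d dd dE] : exists2 d : R, 0 < d & delta = 2 * d.
  by exists (delta / 2); [exact: divr_gt0 | lra].
(* Chosen so that [eps^r <= C eps^n] is what lets the second term of [lhs] be absorbed; [r > n]
   turns this into a smallness condition on [eps]. *)
pose C := d `^ r * c / I.
have C0 : 0 < C by rewrite divr_gt0// mulr_gt0// powR_gt0.
pose e0 := C `^ (r - n%:R)^-1.
have rn : 0 < r - n%:R by rewrite subr_gt0.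
exists e0; first exact: powR_gt0.
move=> eps psi eps0 eps_e0 mpsi psi01 hc.
have small : eps `^ r <= C * eps ^+ n.
  have h : eps `^ (r - n%:R) <= C.
    have -> : C = e0 `^ (r - n%:R) by rewrite /e0 -powRrM mulVf ?powRr1 ?ltW// gt_eqF.
    by apply: ge0_ler_powR; rewrite ?nnegrE ?powR_ge0 ?ltW.
  rewrite -powR_mulrn ?(ltW eps0)// -[r in leLHS](subrK n%:R) powRD; last first.
    by rewrite (gt_eqF eps0) implybT.
  by apply: ler_wpM2r => //; exact: powR_ge0.
have psiM x : K x -> `|psi x| <= eps.
  by move=> _; have /andP[p0 p1] := psi01 x; rewrite ger0_norm.
have ipsi : mu.-integrable K (EFin \o psi).
  apply: (bounded_integrable mK _ _ psiM); first exact: compact_measure_lty.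
  exact: measurable_funTS.
have iff := Lp_integrable n0 cK nq Kf.
have ifpsi : mu.-integrable K (EFin \o (fun x => `|f x| * psi x)).
  exact: (integrable_mul_bounded mK (integrable_norm iff) (measurable_funTS mpsi) psiM).
(* From [t <= 1 + t^r] with [t = eps |f| / d], multiplied by [d psi], and [psi <= eps] in the second
   term. *)
have lhs : eps * \int[mu]_(x in K) (`|f x| * psi x) <=
    \int[mu]_(x in K) (d * psi x + d * (eps / d) `^ r * eps * F x).
  rewrite -RintegralZl//; apply: fine_le.
  - by apply: integrable_fin_num => //; exact: (integrableZl mK eps ifpsi).
  - apply: integrable_fin_num => //.
    by apply: (integrableD mK (integrableZl mK d ipsi) (integrableZl mK _ iF)).
  apply: ae_ge0_le_integral => //.
  - by move=> x _; have /andP[p0 p1] := psi01 x; rewrite lee_fin !mulr_ge0// ltW.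
  - by have /integrableP[] := integrableZl mK eps ifpsi.
  - move=> x _; have /andP[p0 p1] := psi01 x.
    by rewrite lee_fin addr_ge0// !mulr_ge0// ?powR_ge0// ltW.
  - by have /integrableP[] := integrableD mK (integrableZl mK d ipsi) (integrableZl mK (d * (eps / d) `^ r * eps) iF).
  - apply: filterS hF => x hx Kx; rewrite lee_fin; have /andP[p0 p1] := psi01 x.
    have ed : 0 <= eps / d * `|f x| by rewrite mulr_ge0// divr_ge0 ?ltW.
    have h := le1_powR ed r1; rewrite powRM ?divr_ge0 ?(ltW eps0) ?(ltW dd)// in h.
    have h2 : eps * `|f x| <= d + d * ((eps / d) `^ r * F x).
      have -> : eps * `|f x| = d * (eps / d * `|f x|) by field; rewrite gt_eqF.
      rewrite -[X in _ <= X + _]mulr1 -mulrDr ler_pM2l//; apply: le_trans h _.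
      by rewrite lerD2l; apply: ler_wpM2l; [exact: powR_ge0 | exact: hx].
    rewrite mulrA; apply: le_trans (ler_wpM2r p0 h2) _; rewrite mulrDl lerD2l.
    have -> : d * (eps / d) `^ r * eps * F x = d * ((eps / d) `^ r * F x) * eps by ring.
    apply: ler_wpM2l => //; apply: mulr_ge0; first exact: ltW.
    exact: mulr_ge0 (powR_ge0 _ _) (F0 x).
apply: le_trans lhs _; rewrite RintegralD//; last 2 first.
- exact: (integrableZl mK d ipsi).
- exact: (integrableZl mK (d * (eps / d) `^ r * eps) iF).
rewrite !RintegralZl//.
have : d * (eps / d) `^ r * eps * \int[mu]_(x in K) F x <= d * \int[mu]_(x in K) psi x.
  rewrite -!mulrA ler_pM2l//; apply: le_trans hc.
  apply: (@le_trans _ _ ((eps / d) `^ r * (eps * I))).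
    by rewrite ler_wpM2l ?powR_ge0// ler_pM2l// /I lerDl.
  have dr0 : 0 < d `^ r by exact: powR_gt0.
  have -> : (eps / d) `^ r = eps `^ r / d `^ r.
    have {2}-> : eps = (eps / d) * d by rewrite divfK// gt_eqF.
    by rewrite [in RHS]powRM ?divr_ge0 ?(ltW eps0) ?(ltW dd)// mulfK// gt_eqF.
  have -> : c * eps ^+ n.+1 = C * eps ^+ n / d `^ r * (eps * I).
    by rewrite exprS /C; field; rewrite !gt_eqF.
  by rewrite ler_pM2r ?mulr_gt0// ler_pM2r ?invr_gt0.
by rewrite dE mulr_natl mulr2n [in X in _ -> X]mulrDl lerD2l.
Qed.

Local Notation e_ i := (delta_mx ord0 i : E).

Lemma measurable_powR_norm D f p : measurable_fun D f -> measurable_fun D (fun x => `|f x| `^ p).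
Proof.
move=> mf; apply: (measurableT_comp (measurable_powR _)).
exact: measurableT_comp.
Qed.

Lemma Lnorm_restrict D f p (B : R) : 0 < p -> measurable D -> (mu D < +oo)%E ->
  measurable_fun D f -> (forall x, D x -> `|f x| <= B) ->
  Lnorm mu p%:E (EFin \o (f \_ D)) = ((\int[mu]_(x in D) (`|f x| `^ p)) `^ p^-1)%:E.
Proof.
move=> p0 mD Doo mf fB; rewrite unlock -poweR_EFin; congr (_ `^ _)%E.
have mp := measurable_powR_norm p mf.
have ip : mu.-integrable D (EFin \o (fun x => `|f x| `^ p)).
  apply: (@bounded_integrable _ _ _ mu D mD _ (B `^ p)) => // x Dx.
  rewrite ger0_norm ?powR_ge0//; apply: ge0_ler_powR => //; rewrite ?nnegrE.
  - exact: ltW.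
  - by apply: le_trans (fB x Dx).
  - exact: fB.
rewrite /Rintegral fineK; last exact: integrable_fin_num.
rewrite [RHS]integral_mkcond; apply: eq_integral => x _ /=; rewrite !patchE.
by case: ifP => _; rewrite /= ?normr0 ?powR0// gt_eqF.
Qed.

Lemma Lp_bounded D f p (B : R) : 0 < p -> measurable D -> (mu D < +oo)%E ->
  measurable_fun D f -> (forall x, D x -> `|f x| <= B) -> Lp D p%:E f.
Proof.
move=> p0 mD Doo mf fB; rewrite /Lp inE; apply/andP; split; rewrite inE/=.
  exact/(measurable_restrictT _ mD).
by rewrite /finite_norm (Lnorm_restrict p0 mD Doo mf fB) ltry.
Qed.

Lemma Lnorm_cvg0 D (f_ : nat -> E -> R) p (B : R) : 0 < p ->
  measurable D -> (mu D < +oo)%E ->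
  (forall k, measurable_fun D (f_ k)) -> (forall k x, D x -> `|f_ k x| <= B) ->
  {ae mu, forall x, D x -> f_ k x @[k --> \oo] --> (0 : R)} ->
  Lnorm mu p%:E (EFin \o (f_ k \_ D)) @[k --> \oo] --> 0%E.
Proof.
move=> p0 mD Doo mf fB cvf; have pn0 : p != 0 by rewrite gt_eqF.
have mp k := measurable_powR_norm p (mf k).
have cv0 : {ae mu, forall x, D x -> `|f_ k x| `^ p @[k --> \oo] --> (0 : R)}.
  apply: filterS cvf => x hx Dx; apply/cvgr0Pnorm_lt => e e0.
  have /cvgr0Pnorm_lt/(_ (e `^ p^-1)) := hx Dx.
  move=> /(_ (powR_gt0 _ e0)); apply: filterS => k hk.
  rewrite ger0_norm ?powR_ge0//.
  rewrite -[ltRHS](powRr1 (ltW e0)) -(mulVf pn0) powRrM.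
  by apply: gt0_ltr_powR; rewrite ?nnegrE ?powR_ge0.
have iB : mu.-integrable D (EFin \o (fun=> B `^ p)).
  by apply: (@bounded_integrable _ _ _ mu D mD _ (B `^ p)) => // x _; rewrite ger0_norm ?powR_ge0.
have le0 : {ae mu, forall x k, D x -> `| `|f_ k x| `^ p| <= B `^ p}.
  apply: (aeW mu) => x k Dx; rewrite ger0_norm ?powR_ge0//.
  apply: ge0_ler_powR => //; rewrite ?nnegrE; [exact: ltW| |exact: fB].
  by apply: le_trans (fB k x Dx).
have [_ cv] := Rintegral_dominated mD mp (measurable_cst (0 : R)) cv0 iB le0.
have i0 : \int[mu]_(x in D) (0 : R) = 0 by rewrite Rintegral_cst// mul0r.
rewrite i0 in cv.
rewrite (_ : (fun k => _) = (fun k => ((\int[mu]_(x in D) (`|f_ k x| `^ p)) `^ p^-1)%:E)).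
  apply: cvg_EFin; first exact: nearW.
  rewrite /comp /=; apply/cvgr0Pnorm_lt => e e0.
  move/cvgr0Pnorm_lt: cv => /(_ (e `^ p) (powR_gt0 _ e0)); apply: filterS => k.
  set I := Rintegral _ _ _ => hI.
  have I0 : 0 <= I by apply: Rintegral_ge0 => x _; exact: powR_ge0.
  rewrite ger0_norm// in hI; rewrite /= ger0_norm ?powR_ge0//.
  rewrite -[ltRHS](powRr1 (ltW e0)) -(mulfV pn0) powRrM.
  by apply: gt0_ltr_powR; rewrite ?nnegrE ?powR_ge0 ?invr_gt0.
by apply/funext => k; rewrite (Lnorm_restrict p0 mD Doo (mf k) (fB k)).
Qed.

Lemma gradient_at_directional f (x xi : E) i (s : R) : `|s| = 1 -> gradient_at f x xi ->
  k.+1%:R * (f (x + (s / k.+1%:R) *: e_ i) - f x) @[k --> \oo] --> s * xi ord0 i.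
Proof.
move=> s1 gf; apply/cvgrPdist_le => e e0; have [d d0 hd] := gf e e0.
apply: filterS (near_infty_natSinv_lt (PosNum d0)) => k /= hk.
have k0 : 0 < k.+1%:R :> R by [].
have hk' : enorm (x + (s / k.+1%:R) *: e_ i - x) = k.+1%:R^-1.
  by rewrite enorm_step normrM s1 mul1r ger0_norm// invr_ge0.
have := hd (x + (s / k.+1%:R) *: e_ i); rewrite hk' => /(_ hk).
rewrite [x + _ - x]addrC addKr innerZr inner_delta => h.
have -> : s * xi ord0 i - k.+1%:R * (f (x + (s / k.+1%:R) *: e_ i) - f x) =
   - (k.+1%:R * (f (x + (s / k.+1%:R) *: e_ i) - f x - s / k.+1%:R * xi ord0 i)).
  by field; rewrite nat1r pnatr_eq0.
rewrite normrN normrM (gtr0_norm k0) -ler_pdivlMl// [leRHS]mulrC; exact: h.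
Qed.

Section lipschitz_W1p0.
Variables (phi : E -> R) (Dphi : E -> E) (C : R) (x1 : E) (r0 rho p : R).
Hypotheses (C0 : 0 <= C) (lphi : forall x y, `|phi y - phi x| <= C * enorm (y - x)).
Hypotheses (r0rho : r0 < rho) (sphi : forall x, phi x != 0 -> enorm (x - x1) <= r0).
Hypotheses (mDphi : forall i, measurable_fun setT (fun x => Dphi x ord0 i))
  (DphiC : forall i x, `|Dphi x ord0 i| <= C) (p1 : 1 < p).
Let D : set E := [set x | enorm (x - x1) < rho].
Hypothesis gphi : {ae mu, forall x, D x -> gradient_at phi x (Dphi x)}.

Let mD : measurable D. Proof. exact: measurable_enorm_ball. Qed.

Let Doo : (mu D < +oo)%E. Proof. exact: enorm_ball_measure_lty. Qed.

Lemma lipschitz_support_bounded : exists B, forall x, `|phi x| <= B.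
Proof.
have cK := @enorm_ball_compact R n x1 r0.
have [B [B0 hB]] := compact_continuous_bounded cK (lipschitz_continuous_enorm C0 lphi).
exists B => x; have [->|px] := eqVneq (phi x) 0; first by rewrite normr0.
exact/hB/sphi.
Qed.

(** The grid interpolants converge uniformly, and their partial derivatives are bounded and converge
    wherever [Dphi] is a gradient; dominated convergence makes this convergence in the Sobolev
    norm. *)
Lemma lipschitz_W1p0 : W1p0 D p phi Dphi.
Proof.
have p0 : 0 < p by exact: lt_trans p1.
have cphi := lipschitz_continuous_enorm C0 lphi.
have mphi : measurable_fun setT phi by exact: continuous_measurable_rV.
have [B hB] := lipschitz_support_bounded.
have B0 : 0 <= B by apply: le_trans (hB 0).
have [A [phi_ [tphi aphi bphi cvphi]]] := lipschitz_approximation C0 lphi r0rho sphi.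
have A0 : 0 <= A \/ forall x, ~ D x.
  have [[x Dx]|h] := pselect (exists x, D x); last by right; exact/forallNP.
  left; have := aphi 0%N x Dx; rewrite divr1; exact: le_trans.
split; [split; [|move=> i|]|].
- by apply: (Lp_bounded (B := B)) => //; exact: measurable_funTS.
- by apply: (Lp_bounded (B := C)) => //; exact: measurable_funTS.
- split.
  + move=> K cK KD; apply: (Lp_bounded (B := B)) => //; first exact: compact_measurable_rV.
      exact: compact_measure_lty.
    exact: measurable_funTS.
  + move=> i K cK KD; apply: (Lp_bounded (B := C)) => //; first exact: compact_measurable_rV.
      exact: compact_measure_lty.
    exact: measurable_funTS.
  + move=> psi i tpsi.
    have psi0 x := test_function_eq0 (x := x) tpsi.
    have dpsi0 x := test_function_partial_eq0 i (x := x) tpsi.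
    rewrite Rintegral_support => [|x /dpsi0 ->]; last by rewrite mulr0.
    rewrite [in RHS]Rintegral_support => [|x /psi0 ->]; last by rewrite mulr0.
    apply: (@integration_by_parts_test R n D phi _ psi i 1 C); rewrite ?normr1//.
    * move=> x t; apply: le_trans (lphi _ _) _.
      by rewrite enorm_step.
    * apply: filterS gphi => x gx px.
      by apply: gradient_at_directional; [exact: normr1 | exact/gx/(test_function_support tpsi)].
exists phi_; split => //.
- apply: (@Lnorm_cvg0 _ _ _ A) => //.
  + move=> k; apply: measurable_funTS; apply: measurable_funB => //.
    by apply: continuous_measurable_rV; exact: test_function_continuous (tphi k).
  + move=> k x Dx; apply: le_trans (aphi k x Dx) _.
    have {}A0 : 0 <= A by case: A0 => // /(_ x).
    by rewrite ler_pdivrMr// ler_peMr// ler1n.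
  + apply: (aeW mu) => x Dx.
    have cvA : A / k.+1%:R @[k --> \oo] --> (0 : R).
      rewrite -[X in _ --> X](mulr0 A).
      by apply: cvgM; [exact: cvg_cst | exact: cvg_harmonic].
    apply/cvgr0Pnorm_lt => e e0; move/cvgr0Pnorm_lt: cvA => /(_ e e0).
    apply: filterS => k; apply: le_lt_trans; apply: le_trans (aphi k x Dx) _.
    exact: ler_norm.
- move=> i; apply: (@Lnorm_cvg0 _ _ _ (A + C)) => //.
  + move=> k; apply: measurable_funTS; apply: measurable_funB => //.
    apply: continuous_measurable_rV.
    exact: test_function_partial_continuous (tphi k).
  + move=> k x Dx; apply: le_trans (ler_normB _ _) _; apply: lerD => //.
    exact: bphi.
  + apply: filterS gphi => x gx Dx.
    rewrite -[X in _ --> X](subrr (Dphi x ord0 i)); apply: cvgB; last exact: cvg_cst.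
    exact: cvphi Dx (gx Dx).
Qed.

End lipschitz_W1p0.

End lebesgue_spaces.

(** * Integral identities for the level bump *)

Section level_bump.
Context {R : realType} {n : nat}.
Local Notation E := 'rV[R]_n.
Local Notation mu := (@lebesgue_rV R n).
Local Notation e_ i := (delta_mx ord0 i : E).

Lemma measurable_inner D (f g : E -> E) :
  (forall i, measurable_fun D (fun x => f x ord0 i)) ->
  (forall i, measurable_fun D (fun x => g x ord0 i)) ->
  measurable_fun D (fun x => inner (f x) (g x)).
Proof. by move=> mf mg; apply: measurable_sum => i; exact: measurable_funM. Qed.

Lemma measurable_enorm D (f : E -> E) :
  (forall i, measurable_fun D (fun x => f x ord0 i)) ->
  measurable_fun D (fun x => enorm (f x)).
Proof.
move=> mf; have msqrt : measurable_fun setT (Num.sqrt : R -> R).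
  by apply: continuous_measurable_fun; exact: sqrt_continuous.
exact: (measurableT_comp msqrt (measurable_inner mf mf)).
Qed.

(** As a function of [s], [max(0, a - s)^2] has the 2-Lipschitz derivative [-2 max(0, a - s)], so
    its first-order Taylor remainder is at most [(t - s)^2]. There is no exceptional point, in
    contrast to the positive part itself. *)
Lemma pos_part_sqr (a s t : R) :
  `|Num.max 0 (a - t) ^+ 2 - Num.max 0 (a - s) ^+ 2 + 2 * Num.max 0 (a - s) * (t - s)|
  <= (t - s) ^+ 2.
Proof.
rewrite ler_norml; have [h1|h1] := leP 0 (a - t); have [h2|h2] := leP 0 (a - s).
- by have := sqr_ge0 (t - s); rewrite !expr2 => ?; apply/andP; split; lra.
- have := sqr_ge0 (t - s); have : 0 <= (s - t - (a - t)) * (s - t + (a - t)).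
    by apply: mulr_ge0; lra.
  by have := sqr_ge0 (a - t); rewrite !expr2 => ? ? ?; apply/andP; split; lra.
- have := sqr_ge0 (t - s - (a - s)); have : 0 <= (a - s) * (t - a).
    by apply: mulr_ge0; lra.
  have : 0 <= (a - s) * (t - s) by apply: mulr_ge0; lra.
  by have := sqr_ge0 (t - s); rewrite !expr2 => ? ? ? ?; apply/andP; split; lra.
- by have := sqr_ge0 (t - s); rewrite !expr2 => ?; apply/andP; split; lra.
Qed.

(** The field [h] is bounded and defined everywhere, and is a gradient of [w] almost everywhere in
    the ball. The bound [wlow] confines the sublevel sets of [w] around [x1]. Convexity enters
    through [cw], the subgradient inequality at [x] evaluated at [x1], where [w] vanishes. *)
Variables (w : E -> R) (h : E -> E) (M eta rho eps p : R) (x1 d : E).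
Let D : set E := [set x | enorm (x - x1) < rho].
Hypotheses (M0 : 0 <= M) (eta0 : 0 < eta) (eps0 : 0 < eps) (epsrho : eps / eta < rho).
Hypotheses (p1 : 1 < p) (lw : forall x y, `|w y - w x| <= M * enorm (y - x)) (w0 : w x1 = 0)
  (wlow : forall x, `|inner d (x - x1)| + eta * enorm (x - x1) <= w x)
  (mh : forall i, measurable_fun setT (fun x => h x ord0 i))
  (hM : forall x, enorm (h x) <= M)
  (gw : {ae mu, forall x, D x -> gradient_at w x (h x)})
  (cw : {ae mu, forall x, D x -> w x <= inner (h x) (x - x1)}).

Definition level_bump x := Num.max 0 (eps - w x).
Local Notation psi := level_bump.
Local Notation phi := (fun x => psi x ^+ 2).
Local Notation Dphi := (fun x => (- (2 * psi x)) *: h x : E).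

Lemma bump_ge0 x : 0 <= psi x. Proof. by rewrite le_max lexx. Qed.

Let w_ge0 x : 0 <= w x.
Proof.
apply: le_trans (wlow x); apply: addr_ge0 => //.
by apply: mulr_ge0; [exact: ltW | exact: enorm_ge0].
Qed.

Lemma bump_le x : psi x <= eps.
Proof. by rewrite ge_max (ltW eps0)/= gerBl. Qed.

Lemma bump_support x : psi x != 0 -> w x = eps - psi x /\ enorm (x - x1) < eps / eta.
Proof.
rewrite /level_bump; have [h1|h1] := leP 0 (eps - w x); last by rewrite eqxx.
move=> h2; split; first by ring.
have h3 : w x < eps by rewrite -subr_gt0 lt_neqAle eq_sym h2.
rewrite ltr_pdivlMr// mulrC; apply: le_lt_trans h3; apply: le_trans (wlow x).
by rewrite lerDr.
Qed.

Let bump_eq0 x : eps / eta <= enorm (x - x1) -> psi x = 0.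
Proof.
by move=> hx; apply/eqP/contraT => /bump_support[_]; rewrite ltNge hx.
Qed.

Lemma bump_lipschitz x y : `|psi y - psi x| <= M * enorm (y - x).
Proof.
apply: le_trans (lw x y); rewrite /level_bump.
have a1 := ler_norm (w y - w x); have a2 := ler_norm (w x - w y).
rewrite distrC in a2; have a3 := normr_ge0 (w y - w x).
have [h1|h1] := leP 0 (eps - w x); have [h2|h2] := leP 0 (eps - w y);
  by rewrite ler_norml; apply/andP; split; lra.
Qed.

Let C : R := 2 * eps * M.
Let C0 : 0 <= C. Proof. by rewrite !mulr_ge0// ltW. Qed.

Lemma bump_sqr_lipschitz x y : `|phi y - phi x| <= C * enorm (y - x).
Proof.
rewrite subr_sqr normrM mulrC /C -mulrA; apply: ler_pM => //; last exact: bump_lipschitz.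
have := bump_ge0 x; have := bump_ge0 y; have := bump_le x; have := bump_le y.
by move: (psi x) (psi y) => a b a1 b1 a2 b2; rewrite ger0_norm; lra.
Qed.

Lemma measurable_bump : measurable_fun setT psi.
Proof.
apply: continuous_measurable_rV; exact: (lipschitz_continuous_enorm M0 bump_lipschitz).
Qed.

Let mphi : measurable_fun setT phi. Proof. exact: measurable_funX measurable_bump. Qed.

Let mD : measurable D. Proof. exact: measurable_enorm_ball. Qed.

Let Doo : (mu D < +oo)%E. Proof. exact: enorm_ball_measure_lty. Qed.

Lemma measurable_bump_gradient i : measurable_fun setT (fun x => Dphi x ord0 i).
Proof.
rewrite (_ : (fun x => _) = (fun x => (- (2 * psi x)) * h x ord0 i)); last first.
  by apply/funext => x; rewrite mxE.
apply: measurable_funM (mh i); apply: measurableT_comp => //.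
by apply: measurable_funM; [exact: measurable_cst | exact: measurable_bump].
Qed.

Lemma bump_gradient_le i x : `|Dphi x ord0 i| <= C.
Proof.
rewrite mxE normrM normrN /C; apply: ler_pM => //.
  rewrite ger0_norm; first by apply: ler_wpM2l => //; exact: bump_le.
  by apply: mulr_ge0 => //; exact: bump_ge0.
exact: le_trans (coord_le_enorm _ _) (hM x).
Qed.

Lemma bump_gradient_at x : gradient_at w x (h x) -> gradient_at phi x (Dphi x).
Proof.
move=> gx e e_gt0.
(* The factor [2 psi <= 2 eps] turns this into [e / 2]; the quadratic remainder takes the other
   half, through the second bound on [|y - x|]. *)
have e1 : 0 < e / (4 * eps) by rewrite divr_gt0// mulr_gt0.
have [d1 d10 hd1] := gx _ e1.
have M1 : 0 < 2 * (M ^+ 2 + 1) by have := sqr_ge0 M; lra.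
exists (Num.min d1 (e / (2 * (M ^+ 2 + 1)))); first by rewrite lt_min d10 divr_gt0.
move=> y; rewrite lt_min => /andP[y1 y2]; rewrite ltr_pdivlMr// in y2.
have a1 := hd1 y y1; have a2 := pos_part_sqr eps (w x) (w y); have a3 := lw x y.
rewrite -/(level_bump x) -/(level_bump y) in a2; rewrite innerZl.
set z := enorm (y - x) in y1 y2 a1 a3 *; have z0 : 0 <= z by exact: enorm_ge0.
set W := w y - w x in a1 a2 a3 *; set I := inner _ _ in a1 *.
have b1 : W ^+ 2 <= M ^+ 2 * z ^+ 2.
  by rewrite -exprMn -(real_normK (num_real W)) lerXn2r ?nnegrE ?mulr_ge0.
have b2 : 2 * psi x * `|W - I| <= 2 * eps * (e / (4 * eps) * z).
  apply: ler_pM => //; first by apply: mulr_ge0 => //; exact: bump_ge0.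
  by apply: ler_wpM2l => //; exact: bump_le.
have b3 : 2 * eps * (e / (4 * eps) * z) = e / 2 * z by field; rewrite gt_eqF.
have -> : psi y ^+ 2 - psi x ^+ 2 - - (2 * psi x) * I =
  (psi y ^+ 2 - psi x ^+ 2 + 2 * psi x * W) - 2 * psi x * (W - I) by ring.
apply: le_trans (ler_normB _ _) _; rewrite [X in _ + X <= _]normrM.
rewrite (@ger0_norm _ (2 * psi x)); last by apply: mulr_ge0 => //; exact: bump_ge0.
rewrite b3 in b2.
have b4 : M ^+ 2 * z ^+ 2 <= e / 2 * z.
  rewrite [z ^+ 2]expr2 mulrA; apply: ler_wpM2r => //.
  have := sqr_ge0 M; nra.
lra.
Qed.

(** Outside the ball [psi] vanishes near [x], since [eps / eta < rho]; so the gradient is available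
    on the whole space, where integration by parts takes place. *)
Lemma bump_gradient_at_ae : {ae mu, forall x, gradient_at phi x (Dphi x)}.
Proof.
apply: filterS gw => x hx; have [xD|xD] := ltP (enorm (x - x1)) rho.
  exact/bump_gradient_at/hx.
have xe : eps / eta < enorm (x - x1) by exact: lt_le_trans xD.
move=> e e0; exists (enorm (x - x1) - eps / eta); first by rewrite subr_gt0.
move=> y yx; rewrite !bump_eq0 ?(ltW xe)//.
  rewrite mulr0 oppr0 scale0r inner0l subrr subr0 normr0.
  by apply: mulr_ge0; [exact: ltW | exact: enorm_ge0].
have := enorm_triangle x y x1; rewrite (enorm_distC x y) => ?; lra.
Qed.

Lemma bump_W1p0 : W1p0 D p phi Dphi.
Proof.
apply: (@lipschitz_W1p0 R n phi Dphi C x1 (eps / eta) rho p C0) => //.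
- exact: bump_sqr_lipschitz.
- by move=> x; rewrite sqrf_eq0 => /bump_support[_ /ltW].
- exact: measurable_bump_gradient.
- by move=> i x; exact: bump_gradient_le.
- by apply: filterS bump_gradient_at_ae => x hx _.
Qed.

(** Integration by parts for the product [phi * ell]; the linear growth of [ell] is harmless because
    [phi] has bounded support. *)
Lemma bump_parts i (ell : E -> R) (c B : R) : measurable_fun setT ell -> 0 <= B ->
  (forall x t, ell (x + t *: e_ i) = ell x + t * c) ->
  (forall x, `|ell x| <= B * (1 + enorm (x - x1))) ->
  \int[mu]_x (Dphi x ord0 i * ell x + phi x * c) = 0.
Proof.
move=> mell B0 hell ellB.
have [r0 r00 psi0] : exists2 r, 0 < r & forall x, r <= enorm (x - x1) -> psi x = 0.
  by exists (eps / eta); [exact: divr_gt0 | exact: bump_eq0].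
have phi_ge0 x : 0 <= phi x by exact: sqr_ge0.
have phi_le x : phi x <= eps ^+ 2.
  by rewrite lerXn2r ?nnegrE ?bump_le ?bump_ge0// ltW.
have phi0 x : r0 <= enorm (x - x1) -> phi x = 0.
  by move=> hx; rewrite (psi0 _ hx) expr0n.
apply: (@integration_by_parts_ae R n (fun x => phi x * ell x) _ i 1
  (C * (B * (2 + r0)) + eps ^+ 2 * `|c|)); rewrite ?normr1//.
- exact: measurable_funM.
- apply: measurable_funD; apply: measurable_funM => //.
  exact: measurable_bump_gradient.
- have A0 : 0 <= B * (1 + r0) by apply: mulr_ge0 => //; lra.
  exists (eps ^+ 2 * (B * (1 + r0)) + (`|x1| + r0)) => x.
  have [hx|hx] := leP r0 (enorm (x - x1)).
    rewrite (phi0 _ hx) mul0r normr0; split => //.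
    by apply: addr_ge0; [apply: mulr_ge0 => //; exact: sqr_ge0 | apply: addr_ge0 => //; exact: ltW].
  split.
    rewrite -[leLHS]addr0; apply: lerD; last by apply: addr_ge0 => //; exact: ltW.
    rewrite normrM (ger0_norm (phi_ge0 x)); apply: ler_pM => //.
    by apply: le_trans (ellB x) _; apply: ler_wpM2l => //; rewrite lerD2l ltW.
  move=> /ltW h1; exfalso; move: h1; apply/negP; rewrite -ltNge.
  apply: le_lt_trans (_ : `|x1| + enorm (x - x1) < _).
    exact: norm_le_enormB.
  apply: (lt_le_trans (y := `|x1| + r0)); first by rewrite ltrD2l.
  by rewrite lerDr; apply: mulr_ge0 => //; exact: sqr_ge0.
- move=> x t t1; set y := x + _; have yx : enorm (y - x) = `|t| := enorm_step x i t.
  have [[h1 h2]|hx] : (phi y = 0 /\ phi x = 0) \/ enorm (x - x1) <= r0 + 1.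
  + have [h1|h1] := leP (enorm (x - x1)) (r0 + 1); [by right|left].
    split; apply: phi0; last by lra.
    have := enorm_triangle x y x1; rewrite (enorm_distC x y) yx => ?; lra.
  + rewrite h1 h2 !mul0r subrr normr0; apply: mulr_ge0 => //; apply: addr_ge0.
      by apply: mulr_ge0 => //; apply: mulr_ge0 => //; lra.
    by apply: mulr_ge0 => //; exact: sqr_ge0.
  have -> : phi y * ell y - phi x * ell x = (phi y - phi x) * ell x + phi y * (t * c).
    by rewrite /y hell; ring.
  apply: le_trans (ler_normD _ _) _; rewrite [leRHS]mulrDl; apply: lerD.
    rewrite normrM [leRHS]mulrAC; apply: ler_pM => //.
      by apply: le_trans (bump_sqr_lipschitz _ _) _; rewrite yx.
    by apply: le_trans (ellB x) _; apply: ler_wpM2l => //; lra.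
  rewrite normrM (ger0_norm (phi_ge0 y)) normrM [`|t| * _]mulrC mulrA.
  by apply: ler_wpM2r => //; apply: ler_wpM2r.
- apply: filterS bump_gradient_at_ae => x gx; rewrite mul1r.
  have cv := @gradient_at_directional _ _ _ x _ i 1 (normr1 R) gx; rewrite mul1r in cv.
  have cvphi : phi (x + (1 / k.+1%:R) *: e_ i) @[k --> \oo] --> phi x.
    apply/cvgrPdist_le => e e0; have C1 : 0 < e / (C + 1) by rewrite divr_gt0// ltr_wpDl.
    apply: filterS (near_infty_natSinv_lt (PosNum C1)) => k /= hk.
    rewrite distrC; apply: le_trans (bump_sqr_lipschitz _ _) _.
    rewrite enorm_step div1r ger0_norm ?invr_ge0//.
    move: hk; rewrite ltr_pdivlMr ?ltr_wpDl// => /ltW; apply: le_trans.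
    by rewrite mulrC; apply: ler_wpM2l; rewrite ?invr_ge0// lerDl.
  rewrite (_ : (fun k => _) = (fun k => (k.+1%:R * (phi (x + (1 / k.+1%:R) *: e_ i) - phi x))
     * ell x + phi (x + (1 / k.+1%:R) *: e_ i) * c)).
    by apply: cvgD; apply: cvgM => //; exact: cvg_cst.
  apply/funext => k; rewrite hell; field.
  by rewrite nat1r pnatr_eq0.
Qed.

Lemma bump_mul_integrable (k : E -> R) (B : R) : measurable_fun D k ->
  {ae mu, forall x, D x -> `|k x| <= B} -> mu.-integrable D (EFin \o (fun x => psi x * k x)).
Proof.
move=> mk kB; apply: (@ae_bounded_integrable _ _ _ _ _ mD _ (eps * B)) => //.
  by apply: measurable_funM => //; apply: measurable_funTS; exact: measurable_bump.
apply: filterS kB => x hx Dx; rewrite normrM; apply: ler_pM => //; last exact: hx.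
by rewrite ger0_norm ?bump_ge0 ?bump_le.
Qed.

Lemma bump_integrable : mu.-integrable D (EFin \o psi).
Proof.
rewrite (_ : psi = fun x => psi x * 1); last by apply/funext => x; rewrite mulr1.
by apply: (@bump_mul_integrable _ 1); [exact: measurable_cst | apply: (aeW mu) => x _; rewrite normr1].
Qed.

Lemma bump_sqr_integrable : mu.-integrable D (EFin \o phi).
Proof.
rewrite (_ : phi = fun x => psi x * psi x); last by apply/funext => x; rewrite expr2.
apply: (@bump_mul_integrable _ eps); first by apply: measurable_funTS; exact: measurable_bump.
by apply: (aeW mu) => x _; rewrite ger0_norm ?bump_ge0 ?bump_le.
Qed.

Let psiD0 x : ~ D x -> psi x = 0.
Proof.
by move=> /negP; rewrite -leNgt => hx; apply: bump_eq0; apply: le_trans hx; exact: ltW.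
Qed.

Lemma bump_parts_ball i (ell : E -> R) (c B : R) : measurable_fun setT ell -> 0 <= B ->
  (forall x t, ell (x + t *: e_ i) = ell x + t * c) ->
  (forall x, `|ell x| <= B * (1 + enorm (x - x1))) ->
  c * \int[mu]_(x in D) phi x = \int[mu]_(x in D) (psi x * (2 * (h x ord0 i * ell x))) /\
  mu.-integrable D (EFin \o (fun x => psi x * (2 * (h x ord0 i * ell x)))).
Proof.
move=> mell B0 hell ellB.
have int : mu.-integrable D (EFin \o (fun x => psi x * (2 * (h x ord0 i * ell x)))).
  apply: (@bump_mul_integrable _ (2 * (M * (B * (1 + rho))))).
    apply: measurable_funTS; apply: measurable_funM; first exact: measurable_cst.
    exact: measurable_funM.
  apply: (aeW mu) => x Dx; rewrite normrM ger0_norm//; apply: ler_wpM2l => //.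
  rewrite normrM; apply: ler_pM => //; first exact: le_trans (coord_le_enorm _ _) (hM x).
  by apply: le_trans (ellB x) _; apply: ler_wpM2l => //; rewrite lerD2l ltW.
split => //; have := bump_parts mell B0 hell ellB.
rewrite -(Rintegral_support mu (D := D)) => [h0|x /psiD0 hx]; last first.
  by rewrite mxE hx expr0n/= !(mul0r, mulr0, oppr0) addr0.
rewrite -RintegralZl//; last exact: bump_sqr_integrable.
apply/eqP; rewrite -subr_eq0 -RintegralB//; last first.
  exact: (integrableZl mD c bump_sqr_integrable).
by apply/eqP; rewrite -[RHS]h0; apply: eq_Rintegral => x _; rewrite mxE; ring.
Qed.

(** The divergence theorem for the field [ell], whose divergence is the sum of the [c i]: it is [n]
    for [x - x1] and [|d|^2] for [<d, x - x1> d]. *)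
Lemma bump_parts_sum (ell : 'I_n -> E -> R) (c B : 'I_n -> R) :
  (forall i, measurable_fun setT (ell i)) -> (forall i, 0 <= B i) ->
  (forall i x t, ell i (x + t *: e_ i) = ell i x + t * c i) ->
  (forall i x, `|ell i x| <= B i * (1 + enorm (x - x1))) ->
  (\sum_i c i) * \int[mu]_(x in D) phi x =
    \int[mu]_(x in D) (psi x * (2 * \sum_i h x ord0 i * ell i x)) /\
  mu.-integrable D (EFin \o (fun x => psi x * (2 * \sum_i h x ord0 i * ell i x))).
Proof.
move=> mell B0 hell ellB.
have H i := bump_parts_ball (mell i) (B0 i) (hell i) (ellB i).
have -> : (fun x => psi x * (2 * \sum_i h x ord0 i * ell i x)) =
    fun x => \sum_i (psi x * (2 * (h x ord0 i * ell i x))).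
  by apply/funext => x; rewrite !mulr_sumr.
split; last by apply: integrable_sum_EFin => // i; have [] := H i.
rewrite Rintegral_sum// => [|i]; last by have [] := H i.
by rewrite mulr_suml; apply: eq_bigr => i _; have [] := H i.
Qed.

(** Case [ell = 1] of [bump_parts]. It makes the constant flux at [xi] invisible to the test
    function. *)
Lemma bump_gradient_mean0 i : \int[mu]_(x in D) Dphi x ord0 i = 0.
Proof.
rewrite Rintegral_support => [|x /psiD0 hx]; last by rewrite mxE hx mulr0 oppr0 mul0r.
have := @bump_parts i (fun=> 1) 0 1 (measurable_cst _) ler01.
move=> <-; first by apply: eq_Rintegral => x _; rewrite mulr1 mulr0 addr0.
  by move=> x t; rewrite mulr0 addr0.
by move=> x; rewrite normr1 mul1r lerDl enorm_ge0.
Qed.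

Lemma bump_gradient_mass : d != 0 ->
  enorm d * \int[mu]_(x in D) psi x <= n.+2%:R * \int[mu]_(x in D) (psi x * enorm (h x)).
Proof.
move=> d0; have ed0 := enorm_gt0 d0.
have mB i : measurable_fun setT (fun x : E => x ord0 i - x1 ord0 i).
  by apply: measurable_funB; [exact: measurable_rV_coord | exact: measurable_cst].
have md : measurable_fun setT (fun x : E => inner d (x - x1)).
  apply: measurable_inner => i; first exact: measurable_cst.
  by under eq_fun do rewrite !mxE; exact: mB.
have inth : mu.-integrable D (EFin \o (fun x => psi x * enorm (h x))).
  apply: (@bump_mul_integrable _ M); first by apply: measurable_funTS; exact: measurable_enorm.
  by apply: (aeW mu) => x _; rewrite ger0_norm ?enorm_ge0.
(* Here [2 psi <h, x - x1> >= 2 psi w = 2 eps psi - 2 psi^2], because [w = eps - psi] where [psi] is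
   nonzero; the last term turns the divergence [n] into [n + 2]. *)
have I1 : 2 * eps * \int[mu]_(x in D) psi x <= n.+2%:R * \int[mu]_(x in D) phi x.
  have [|||E1 iE1] := @bump_parts_sum (fun i x => x ord0 i - x1 ord0 i) (fun=> 1) (fun=> 1) mB.
  - by move=> i.
  - by move=> i x t; rewrite !mxE !eqxx /=; ring.
  - move=> i x; rewrite mul1r; have := coord_le_enorm (x - x1) i; rewrite !mxE; lra.
  rewrite sumr_const card_ord in E1.
  have sumE x : \sum_i h x ord0 i * (x ord0 i - x1 ord0 i) = inner (h x) (x - x1).
    by apply: eq_bigr => i _; rewrite !mxE.
  have E2 : 2 * eps * \int[mu]_(x in D) psi x - 2 * \int[mu]_(x in D) phi x =
      \int[mu]_(x in D) (2 * eps * psi x - 2 * phi x).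
    rewrite RintegralB//; [|exact: (integrableZl mD _ bump_integrable)
      |exact: (integrableZl mD _ bump_sqr_integrable)].
    by rewrite !RintegralZl//; [exact: bump_sqr_integrable | exact: bump_integrable].
  have : \int[mu]_(x in D) (2 * eps * psi x - 2 * phi x) <=
      \int[mu]_(x in D) (psi x * (2 * \sum_i h x ord0 i * (x ord0 i - x1 ord0 i))).
    apply: Rintegral_ae_le => //.
    - apply: (integrableB mD (integrableZl mD _ bump_integrable)
        (integrableZl mD _ bump_sqr_integrable)).
    - apply: filterS cw => x hx Dx; rewrite sumE.
      have -> : 2 * eps * psi x - 2 * phi x = psi x * (2 * w x).
        have [->|/bump_support[-> _]] := eqVneq (psi x) 0; last by ring.
        by rewrite expr0n/= !(mul0r, mulr0) subrr.
      by apply: ler_wpM2l; [exact: bump_ge0 | apply: ler_wpM2l => //; exact: hx].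
  rewrite -E1 -E2 -[n.+2]addn2 natrD mulrDl; lra.
(* On the support of [psi], [|<d, x - x1>| <= w <= eps]; one factor [|d|] cancels against the
   divergence [|d|^2]. *)
have I2 : enorm d * \int[mu]_(x in D) phi x <= 2 * eps * \int[mu]_(x in D) (psi x * enorm (h x)).
  pose ell i (x : E) := d ord0 i * inner d (x - x1).
  have mell i : measurable_fun setT (ell i) by apply: measurable_funM => //; exact: measurable_cst.
  have B0 i : 0 <= `|d ord0 i| * enorm d by apply: mulr_ge0 => //; exact: enorm_ge0.
  have [||E1 iE1] := @bump_parts_sum ell (fun i => d ord0 i * d ord0 i) _ mell B0.
  - move=> i x t; rewrite /ell (_ : x + _ - x1 = (x - x1) + t *: e_ i); last by rewrite addrAC.
    by rewrite (innerDr d (x - x1)) innerZr inner_delta; ring.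
  - move=> i x; rewrite normrM -mulrA; apply: ler_wpM2l => //.
    apply: le_trans (cauchy_schwarz_abs _ _) _; apply: ler_wpM2l; first exact: enorm_ge0.
    by rewrite lerDr.
  rewrite -/(inner d d) -enormE in E1.
  have sumE x : \sum_i h x ord0 i * ell i x = inner (h x) d * inner d (x - x1).
    by rewrite /inner mulr_suml; apply: eq_bigr => i _; rewrite /ell mulrA.
  rewrite -(ler_pM2l ed0) mulrA E1 mulrA -RintegralZl//.
  apply: Rintegral_ae_le => //.
  - exact: (integrableZl mD _ inth).
  - apply: (aeW mu) => x Dx; rewrite sumE.
    have [->|/bump_support[wE _]] := eqVneq (psi x) 0; first by rewrite !(mul0r, mulr0).
    rewrite [leRHS]mulrCA; apply: ler_wpM2l; first exact: bump_ge0.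
    have h1 : inner (h x) d * inner d (x - x1) <= enorm (h x) * enorm d * eps.
      apply: le_trans (ler_norm _) _; rewrite normrM; apply: ler_pM => //.
        exact: cauchy_schwarz_abs.
      have := wlow x; have := bump_ge0 x; have := enorm_ge0 (x - x1) => a1 a2 a3.
      have : 0 <= eta * enorm (x - x1) by apply: mulr_ge0 => //; exact: ltW.
      by rewrite wE in a3 => ?; lra.
    by have := ler_wpM2l (ler0n R 2) h1; lra.
have e2 : 0 < 2 * eps by apply: mulr_gt0.
rewrite -(ler_pM2l e2) mulrCA; apply: le_trans (ler_wpM2l (ltW ed0) I1) _.
rewrite mulrCA [leRHS]mulrCA; exact: ler_wpM2l I2.
Qed.

(** On a cube around [x1] with half-side proportional to [eps], the Lipschitz bound gives
    [w <= eps / 2], so [psi >= eps / 2] there: a height of order [eps] times a volume of order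
    [eps^n]. *)
Lemma bump_mass : 2^-1 * ((M + 1) * n.+1%:R)^-1 ^+ n * eps ^+ n.+1 <= \int[mu]_(x in D) psi x.
Proof.
have M1 : 0 < M + 1 by exact: ltr_wpDl.
have c0 : 0 < (M + 1) * n.+1%:R by apply: mulr_gt0.
pose s := eps / 2 / ((M + 1) * n.+1%:R); have s0 : 0 < s by rewrite !divr_gt0.
pose Q := obox (x1 - const_mx s) (x1 + const_mx s).
have mQ : measurable Q by exact: measurable_obox.
have Qpsi x : Q x -> eps / 2 <= psi x.
  move=> Qx; have h1 : enorm (x - x1) <= n%:R * s.
    apply: enorm_le_coord => i.
    by have := Qx i; rewrite !mxE => Qi; rewrite ler_norml; lra.
  have h2 : w x <= eps / 2.
    have := lw x1 x; rewrite w0 subr0 => h3; apply: le_trans (ler_norm _) _; apply: le_trans h3 _.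
    apply: (le_trans (y := (M + 1) * (n.+1%:R * s))); last by rewrite mulrA mulrC divfK// gt_eqF.
    apply: ler_pM => //; [exact: enorm_ge0 | by rewrite lerDl|].
    apply: le_trans h1 _; apply: ler_wpM2r; first exact: ltW.
    by rewrite ler_nat.
  by rewrite /level_bump le_max; apply/orP; right; lra.
have QD : Q `<=` D.
  move=> x /Qpsi h1; have psin0 : psi x != 0 by rewrite gt_eqF//; apply: lt_le_trans h1; rewrite divr_gt0.
  have [_ h2] := bump_support psin0; exact: lt_trans epsrho.
have volQ : mu Q = ((2 * s) ^+ n)%:E.
  rewrite obox_volume => [|i]; last by rewrite !mxE; lra.
  congr EFin; rewrite -[X in _ ^+ X](card_ord n) -prodr_const; apply: eq_bigr => i _.
  by rewrite !mxE; ring.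
have -> : 2^-1 * ((M + 1) * n.+1%:R)^-1 ^+ n * eps ^+ n.+1 = \int[mu]_(x in Q) (eps / 2).
  rewrite Rintegral_cst//= volQ /= /s mulrA mulrCA divff ?pnatr_eq0// mulr1 exprMn exprS; ring.
apply: (@le_trans _ _ (\int[mu]_(x in Q) psi x)).
  apply: le_Rintegral => //; first by apply: (bounded_integrable mQ (B := eps / 2)) => //;
    [exact: obox_volume_lty | move=> x _; rewrite ger0_norm// divr_ge0// ltW].
  exact: (integrableS mD mQ QD bump_integrable).
apply: fine_le.
- by apply: integrable_fin_num => //; exact: (integrableS mD mQ QD bump_integrable).
- by apply: integrable_fin_num => //; exact: bump_integrable.
- apply: ge0_subset_integral => //.
    by apply/measurable_EFinP; apply: measurable_funTS; exact: measurable_bump.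
  by move=> x _; rewrite lee_fin bump_ge0.
Qed.

(** Integrate the pointwise bound on [|h|] against [psi], compare with [bump_gradient_mass], and
    divide by the positive mass of [psi]. The 2 under [sigma] comes from the gradient [-2 psi h] of
    [psi^2]. *)
Lemma bump_flux (A : E -> E) (MA Ck delta sigma : R) : d != 0 -> 0 <= Ck ->
  (forall i, measurable_fun D (fun x => A x ord0 i)) ->
  {ae mu, forall x, D x -> enorm (A x) <= MA} ->
  {ae mu, forall x, D x -> enorm (h x) <= delta + Ck * inner (A x) (h x)} ->
  - (\int[mu]_(x in D) inner (A x) (Dphi x)) <= sigma * \int[mu]_(x in D) psi x ->
  enorm d <= n.+2%:R * (delta + Ck * (sigma / 2)).
Proof.
move=> d0 Ck0 mA AM hA hsigma; have mass := bump_gradient_mass d0.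
have mass0 : 0 < \int[mu]_(x in D) psi x.
  apply: lt_le_trans bump_mass; apply: mulr_gt0; last exact: exprn_gt0.
  by apply: mulr_gt0 => //; rewrite exprn_gt0// invr_gt0 mulr_gt0// ltr_wpDl.
rewrite -(ler_pM2r mass0); apply: le_trans mass _; rewrite -mulrA; apply: ler_wpM2l => //.
have mAh : measurable_fun D (fun x => inner (A x) (h x)).
  by apply: measurable_inner => // i; exact: measurable_funTS.
have iAh : mu.-integrable D (EFin \o (fun x => psi x * inner (A x) (h x))).
  apply: (@bump_mul_integrable _ (MA * M)) => //.
  apply: filterS AM => x hx Dx; apply: le_trans (cauchy_schwarz_abs _ _) _.
  by apply: ler_pM => //; rewrite ?enorm_ge0//; exact: hx.
have ih : mu.-integrable D (EFin \o (fun x => psi x * enorm (h x))).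
  apply: (@bump_mul_integrable _ M).
    by apply: measurable_funTS; exact: measurable_enorm.
  by apply: (aeW mu) => x _; rewrite ger0_norm ?enorm_ge0.
apply: (@le_trans _ _ (\int[mu]_(x in D) (delta * psi x + Ck * (psi x * inner (A x) (h x))))).
  apply: Rintegral_ae_le => //.
    exact: (integrableD mD (integrableZl mD _ bump_integrable) (integrableZl mD _ iAh)).
  apply: filterS hA => x hx Dx; have := ler_wpM2l (bump_ge0 x) (hx Dx); lra.
rewrite RintegralD//; [|exact: (integrableZl mD _ bump_integrable)|exact: (integrableZl mD _ iAh)].
rewrite !RintegralZl//; last exact: bump_integrable.
rewrite mulrDl lerD2l -mulrA; apply: ler_wpM2l => //.
have -> : \int[mu]_(x in D) (psi x * inner (A x) (h x)) =
    - 2^-1 * \int[mu]_(x in D) inner (A x) (Dphi x).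
  rewrite -RintegralZl//; first by apply: eq_Rintegral => x _; rewrite innerZr; field.
  rewrite (_ : _ \o _ = EFin \o (fun x => - 2 * (psi x * inner (A x) (h x)))).
    exact: (integrableZl mD _ iAh).
  by apply/funext => x /=; rewrite innerZr; congr EFin; ring.
move: hsigma; lra.
Qed.

End level_bump.

(** * Uniqueness of the subgradient *)

Section uniqueness.
Context {R : realType} {n : nat}.
Local Notation E := 'rV[R]_n.
Local Notation mu := (@lebesgue_rV R n).
Local Notation e_ i := (delta_mx ord0 i : E).

Lemma gradient_atD (f g : E -> R) x a b : gradient_at f x a -> gradient_at g x b ->
  gradient_at (fun y => f y + g y) x (a + b).
Proof.
move=> fa gb e e0; have e2 : 0 < e / 2 by rewrite divr_gt0.
have [d1 d10 h1] := fa _ e2; have [d2 d20 h2] := gb _ e2.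
exists (Num.min d1 d2); first by rewrite lt_min d10.
move=> y; rewrite lt_min => /andP[/h1 {}h1 /h2 {}h2].
rewrite innerDl (_ : _ - _ = (f y - f x - inner a (y - x)) + (g y - g x - inner b (y - x))); last by ring.
by apply: le_trans (ler_normD _ _) _; lra.
Qed.

Lemma gradient_at_affine (c : R) (xi x1 x : E) :
  gradient_at (fun y => c + inner xi (y - x1)) x xi.
Proof.
move=> e e0; exists 1 => // y _.
rewrite (_ : _ - _ = 0); first by rewrite normr0 mulr_ge0 ?enorm_ge0// ltW.
by rewrite !innerBr; ring.
Qed.

(** With [z = x - x1] and [v = y - x], Cauchy-Schwarz gives the sign of the remainder and
    [(|z + v| - |z|)^2 >= 0] bounds it by [eta |v|^2 / (2 |z|)]. *)
Lemma gradient_at_enorm (eta : R) (x1 x : E) : 0 < eta -> x != x1 ->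
  gradient_at (fun y => eta * enorm (y - x1)) x ((eta / enorm (x - x1)) *: (x - x1)).
Proof.
move=> eta0 xx1 e e0; set z := x - x1.
have z0 : 0 < enorm z by apply: enorm_gt0; rewrite subr_eq0.
exists (2 * enorm z * (e / eta)); first by rewrite !mulr_gt0 ?invr_gt0.
move=> y; set v := y - x => hv.
have -> : y - x1 = z + v by rewrite /z /v (addrC (x - x1)) addrA subrK.
clearbody v z; set I := inner z v; have := cauchy_schwarz z (z + v); rewrite innerDr -enormE -/I => h1.
have h2 : enorm (z + v) ^+ 2 = enorm z ^+ 2 + 2 * I + enorm v ^+ 2.
  by rewrite !enorm_sqr innerDl !innerDr (innerC v z) -/I; ring.
have v0 := enorm_ge0 v; rewrite innerZl -/I.
move: z0 hv h1 h2 v0; move: (enorm z) (enorm v) (enorm (z + v)) => a s t a0 hv h1 h2 s0.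
have h3 := sqr_ge0 (t - a).
have -> : eta * t - eta * a - eta / a * I = eta / a * (a * t - a * a - I) by field; rewrite gt_eqF.
have h4 : 0 <= a * t - a * a - I by lra.
rewrite ger0_norm; last by apply: mulr_ge0 => //; rewrite divr_ge0// ltW.
have h5 : a * t - a * a - I <= s * s / 2.
  rewrite !expr2 in h2 h3; lra.
apply: le_trans (ler_wpM2l (_ : 0 <= eta / a) h5) _; first by rewrite divr_ge0// ltW.
have -> : eta / a * (s * s / 2) = (s / (2 * a * (e / eta))) * e * s by field; rewrite !gt_eqF.
apply: ler_wpM2r => //; rewrite ger_pMl// ler_pdivrMr ?mul1r ?ltW//.
by rewrite !mulr_gt0 ?invr_gt0.
Qed.

(** At [x1] the cone [eta |x - x1|] has no gradient. In dimension 0 the measure is a Dirac mass,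
    whence the hypothesis. *)
Lemma negligible_point (x1 : E) : (0 < n)%N -> {ae mu, forall x, x != x1}.
Proof.
move=> n0; exists [set v | forall i, [set x1 ord0 i] (rV_coord i v)]; split.
- rewrite (_ : [set v | _] = \bigcap_(i in [set: 'I_n]) (rV_coord i @^-1` [set x1 ord0 i])).
    apply: fin_bigcap_measurable => // i _.
    by rewrite -[X in measurable X]setTI; exact: measurable_rV_coord.
  by apply/seteqP; split => v /= Av i; [move=> _|]; exact: Av.
- rewrite (@lebesgue_rV_box R n (fun i => [set x1 ord0 i]))//.
  rewrite (bigD1 (Ordinal n0))//= lebesgue_measure_set1 mul0e//.
- by move=> x /= /negP; rewrite negbK => /eqP -> i.
Qed.

Lemma pflux_monotone p (z xi : E) : 1 < p -> 0 <= inner (pflux p z - pflux p xi) (z - xi).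
Proof.
move=> p1; have [->|zx] := eqVneq z xi; first by rewrite !subrr inner0l.
have d0 : 0 < enorm (z - xi) by apply: enorm_gt0; rewrite subr_eq0.
have [kappa k0 h] := pflux_strongly_monotone xi p1 d0.
by apply: le_trans (h z _) => //; exact: ltW.
Qed.

(** If [|z - xi| < delta], the term [delta] suffices, since monotonicity makes the other one
    nonnegative. Otherwise the inner product is at least [kappa], and [Ck] is chosen so that
    [Ck * kappa] bounds [|z - xi|]. The multivalued part enters only through its monotonicity. *)
Lemma flux_coercive b p (xi Zxi : E) (delta Lg : R) : 0 < b -> 1 < p -> 0 < delta -> 0 <= Lg ->
  subdifferential enorm xi Zxi -> exists2 Ck : R, 0 <= Ck &
    forall z Z, enorm z <= Lg -> subdifferential enorm z Z ->
    enorm (z - xi) <= delta + Ck * inner (b *: (Z - Zxi) + (pflux p z - pflux p xi)) (z - xi).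
Proof.
move=> b0 p1 d0 L0 hxi; have [kappa k0 hk] := pflux_strongly_monotone xi p1 d0.
have c0 : 0 <= (Lg + enorm xi) / kappa by rewrite divr_ge0 ?addr_ge0 ?enorm_ge0// ltW.
exists ((Lg + enorm xi) / kappa) => // z Z zL hz.
have h1 := subdifferential_monotone hz hxi; have h2 := pflux_monotone z xi p1.
rewrite innerDl innerZl; have h3 : 0 <= b * inner (Z - Zxi) (z - xi).
  by apply: mulr_ge0 => //; exact: ltW.
have [h4|h4] := leP delta (enorm (z - xi)); last first.
  by apply: le_trans (ltW h4) _; rewrite lerDl mulr_ge0// addr_ge0.
apply: (@le_trans _ _ ((Lg + enorm xi) / kappa * kappa)).
  rewrite divfK ?gt_eqF//; apply: le_trans (enormB _ _) _; by rewrite lerD2r.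
apply: (@le_trans _ _ ((Lg + enorm xi) / kappa *
   (b * inner (Z - Zxi) (z - xi) + inner (pflux p z - pflux p xi) (z - xi)))).
  by apply: ler_wpM2l => //; have := hk z h4; lra.
by rewrite lerDr ltW.
Qed.

Lemma inner_is_linear (xi : E) : linear (inner xi : E -> R).
Proof. by move=> a x y; rewrite innerDr innerZr. Qed.

Lemma gradient_at_differentiable (f : E -> R) (x xi : E) : gradient_at f x xi ->
  differentiable f x /\ forall i, partial i f x = xi ord0 i.
Proof.
move=> gf.
pose l : {linear E -> R} := HB.pack (inner xi : E -> R)
  (GRing.isLinear.Build R E R *:%R (inner xi : E -> R) (@inner_is_linear xi)).
have cl : continuous (l : E -> R).
  apply: (lipschitz_continuous_enorm (enorm_ge0 xi)) => y z.
  by rewrite -innerBr; exact: cauchy_schwarz_abs.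
have dl : f \o shift x = cst (f x) + (l : E -> R) +o_ (0 : E) id.
  (* [enorm v] is at most [n] times the library norm of [v], hence the division. *)
  apply/eqaddoP => e e0; have n1 : 0 < e / n.+1%:R by rewrite divr_gt0.
  have [d d0 hd] := gf _ n1.
  apply: filterS (enorm_near (0 : E) d0) => v; rewrite subr0 => vd.
  have := hd (v + x); rewrite addrK => /(_ vd) h.
  have -> : (f \o shift x - (cst (f x) + (l : E -> R))) v = f (v + x) - f x - inner xi v.
    by rewrite !fctE /= /shift /=; ring.
  apply: le_trans h _; rewrite mulrAC ler_pdivrMr//; rewrite -mulrA; apply: ler_wpM2l; first exact: ltW.
  rewrite mulrC; apply: le_trans (enorm_le_norm v) _; apply: ler_wpM2r => //.
  by rewrite ler_nat.
have dE : 'd f x = l :> (E -> R) by exact: diff_unique.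
have df : differentiable f x by apply/diff_locallyP; rewrite dE.
split => // i; rewrite /partial deriveE// dE.
exact: inner_delta.
Qed.

Lemma gradient_at_local (f g : E -> R) (x xi : E) (r : R) : 0 < r ->
  (forall y, enorm (y - x) < r -> f y = g y) -> gradient_at f x xi -> gradient_at g x xi.
Proof.
move=> r0 fg gf e e0; have [d d0 hd] := gf e e0.
exists (Num.min d r); first by rewrite lt_min d0.
move=> y; rewrite lt_min => /andP[yd yr]; rewrite -fg// -fg; first exact: hd.
by rewrite subrr enorm0.
Qed.

End uniqueness.

(** The arithmetic of adding the cone: [t], [s], [c], [m] stand for [delta], [eta], [Ck], [MA], and
    [a1], [a2] for the inner products of the flux difference with [G x - xi] and with the cone
    gradient, whose norm is at most [eta]. *)
Lemma perturbed_flux_bound (R : realType) (t s c m a1 a2 : R) :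
  s * (1 + c * m) <= t -> c * - a2 <= c * (m * s) -> t + c * a1 + s <= 2 * t + c * (a1 + a2).
Proof. lra. Qed.

(** * The contradiction at a point with two subgradients *)

Section uniqueness_main.
Context {R : realType} {n : nat}.
Local Notation E := 'rV[R]_n.
Local Notation mu := (@lebesgue_rV R n).
Local Notation e_ i := (delta_mx ord0 i : E).

Lemma measurable_pflux p D (G : E -> E) i :
  (forall i, measurable_fun D (fun x => G x ord0 i)) ->
  measurable_fun D (fun x => pflux p (G x) ord0 i).
Proof.
move=> mG; under eq_fun do rewrite mxE; apply: measurable_funM => //.
exact: (measurableT_comp (measurable_powR _) (measurable_enorm mG)).
Qed.

Lemma measurable_cone_gradient (eta : R) (x1 : E) i :
  measurable_fun setT (fun x : E => ((eta / enorm (x - x1)) *: (x - x1)) ord0 i).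
Proof.
have mB j : measurable_fun setT (fun x : E => (x - x1) ord0 j).
  under eq_fun do rewrite !mxE.
  by apply: measurable_funB; [exact: measurable_rV_coord | exact: measurable_cst].
under eq_fun do rewrite mxE -powR_inv1 ?enorm_ge0//.
apply: measurable_funM => //; apply: measurable_funM; first exact: measurable_cst.
exact: (measurableT_comp (measurable_powR _) (measurable_enorm mB)).
Qed.

(** At [z = 0] the vector is 0, so the cone gradient stays bounded at its vertex. *)
Lemma enorm_unit_le1 (z : E) : enorm ((enorm z)^-1 *: z) <= 1.
Proof.
rewrite enormZ ger0_norm ?invr_ge0 ?enorm_ge0//.
have [->|z0] := eqVneq (enorm z) 0; first by rewrite mulr0.
by rewrite mulVf.
Qed.

Variables (U : E -> R) (L : R).
Hypotheses (cU : convex_within setT U) (L0 : 0 <= L) (lU : lipschitz_within setT L U).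

(** A bounded Borel field, defined everywhere, that equals the gradient of [U] where that exists.
    The gradient of the test function is built from it because [G] is controlled only almost
    everywhere. *)
Let g x : E := \row_i one_sided_partial U i 1 x.

Lemma gradient_at_one_sided x xi : gradient_at U x xi -> g x = xi.
Proof.
move=> gx; apply/rowP => i; rewrite mxE.
have h1 := gradient_at_directional (i := i) (normr1 R) gx; rewrite mul1r in h1.
have h2 := @one_sided_partial_cvg _ _ U L cU lU i 1 x (normr1 R); rewrite mul1r in h2.
by rewrite -(cvg_lim _ h2)// -(cvg_lim _ h1).
Qed.

Lemma enorm_one_sided_le x : enorm (g x) <= n%:R * L.
Proof.
apply: enorm_le_coord => i; rewrite mxE.
by apply: (one_sided_partial_le cU lU); exact: normr1.
Qed.

Variables (b p : R) (q : \bar R) (O : set E) (f u : E -> R) (x1 : E) (r : R).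
Hypotheses (b0 : 0 < b) (p1 : 1 < p) (nq : (n%:R%:E < q)%E) (fO : Lp_loc O q f)
  (uO : weak_solution b p O f u) (r0 : 0 < r) (rO : [set y | enorm (y - x1) < r] `<=` O)
  (Uu : forall y, enorm (y - x1) < r -> U y = u y).

Lemma weak_solution_unique_subgradient xi1 xi2 :
  subdifferential U x1 xi1 -> subdifferential U x1 xi2 -> xi1 = xi2.
Proof.
move=> s1 s2; apply/eqP; rewrite -subr_eq0; apply/negP => /negP d12.
(* In dimension 0 there is only one vector, so two distinct subgradients force [n > 0]. *)
have n0 : (0 < n)%N.
  rewrite lt0n; apply: contra d12 => /eqP n0; apply/eqP/rowP => i.
  by have := ltn_ord i; rewrite [X in (_ < X)%N]n0.
have n1 : 1 <= n%:R :> R by rewrite ler1n.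
pose xi : E := 2^-1 *: (xi1 + xi2); pose d : E := 2^-1 *: (xi1 - xi2).
have d0 : d != 0 by rewrite scaler_eq0 negb_or d12 andbT invr_eq0.
have xi1E : xi1 = xi + d by apply/rowP => i; rewrite !mxE; field.
have xi2E : xi2 = xi - d by apply/rowP => i; rewrite !mxE; field.
have ed0 := enorm_gt0 d0.
have xiL : enorm xi <= L.
  have h1 := subdifferential_bounded L0 lU s1; have h2 := subdifferential_bounded L0 lU s2.
  rewrite enormZ gtr0_norm// ler_pdivrMl//; have := enormD xi1 xi2; lra.
have Ulow y : U x1 + inner xi (y - x1) + `|inner d (y - x1)| <= U y.
  have := s1 y; have := s2 y; rewrite xi1E xi2E !innerDl innerNl => h1 h2.
  suff : `|inner d (y - x1)| <= U y - U x1 - inner xi (y - x1) by lra.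
  by rewrite ler_norml; apply/andP; split; lra.
(* [bump_flux] will give [|d| <= n.+2 * (3 * delta)]: [2 * delta] from the flux inequality with the
   cone, [delta] from the source. The factor 4 makes this [3 / 4 |d|]. *)
pose delta : R := enorm d / (4 * n.+2%:R).
have delta0 : 0 < delta by rewrite divr_gt0// mulr_gt0.
have [Zxi hZxi] := subdifferential_enorm_nonempty xi.
have Lg0 : 0 <= n%:R * L by apply: mulr_ge0.
have [Ck Ck0 hCk] := flux_coercive b0 p1 delta0 Lg0 hZxi.
pose MA : R := b * 2 + ((n%:R * L) `^ (p - 1) + enorm xi `^ (p - 1)).
have MA0 : 0 <= MA.
  by apply: addr_ge0; [apply: mulr_ge0 => //; exact: ltW | apply: addr_ge0; exact: powR_ge0].
have CM0 : 0 < 1 + Ck * MA by apply: ltr_pwDl => //; exact: mulr_ge0.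
(* The bound by [delta / (1 + Ck * MA)] makes the cone cost at most one more [delta]; the bound by 1
   keeps [M] independent of [eta]. *)
pose eta : R := Num.min 1 (delta / (1 + Ck * MA)).
have eta0 : 0 < eta by rewrite lt_min ltr01 divr_gt0.
have eta1 : eta <= 1 by rewrite ge_min lexx.
have etad : eta * (1 + Ck * MA) <= delta by rewrite -ler_pdivlMr// ge_min lexx orbT.
pose w y := U y + (- U x1 + inner (- xi) (y - x1)) + eta * enorm (y - x1).
pose h x : E := g x + - xi + (eta / enorm (x - x1)) *: (x - x1).
(* One constant for the Lipschitz bound of [w], at most [2 L + 1], and for the bound [n * L + L + 1]
   of its gradient [h]. *)
pose M : R := n%:R * L + L + L + 1.
have M0 : 0 <= M by rewrite /M !addr_ge0.
(* The box of half-side [rho] about [x1] must fit in the ball of radius [r], because almost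
   everywhere uniqueness was proved on boxes. *)
pose rho : R := r / n.+1%:R.
have rho0 : 0 < rho by rewrite divr_gt0.
have nrho : n%:R * rho < r.
  by rewrite mulrC -mulrA -ltr_pdivlMl// mulVf ?gt_eqF// mulrC ltr_pdivrMr// mul1r ltr_nat.
pose D : set E := [set x | enorm (x - x1) < rho].
pose K : set E := [set x | enorm (x - x1) <= rho].
have rhor : rho < r by apply: le_lt_trans nrho; rewrite ler_peMl// ltW.
have cK : compact K by exact: enorm_ball_compact.
have KO : K `<=` O by move=> x xK; apply: rO => /=; exact: le_lt_trans rhor.
have DK : D `<=` K by move=> x /ltW.
have mK : measurable K by exact: compact_measurable_rV.
have mD : measurable D by exact: measurable_enorm_ball.
have Doo : (mu D < +oo)%E by exact: enorm_ball_measure_lty.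
have [G [uK GK wG] solG] := uO.
have DO : compactly_contained D O.
  have cD : closure D `<=` K by exact: closure_enorm_ball.
  split; last exact: subset_trans KO.
  by apply: (subclosed_compact _ cK cD); exact: closed_closure.
have [Z [Zoo subZ weq]] := solG D (ball_bounded_lipschitz_domain x1 rho0) DO.
have mZ i : measurable_fun D (fun x => Z x ord0 i) by exact: Lp_measurable (Zoo i).
have mG i : measurable_fun D (fun x => G x ord0 i).
  by apply: measurable_funS DK _ => //; apply: (Lp_measurable (q := p%:E)) => //; exact: GK.
(* Where the subgradient is unique it is the gradient of [U], so the weak gradient [G] and the
   everywhere defined [g] agree almost everywhere on [D]. *)
have aeU : {ae mu, forall x, D x ->
    subdifferential U x (G x) /\ gradient_at U x (G x) /\ g x = G x}.
  have box (x : E) : (forall i, `|x ord0 i - x1 ord0 i| <= rho) -> enorm (x - x1) < r.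
    by move=> hx; apply: le_lt_trans nrho; apply: enorm_le_coord => i; rewrite !mxE.
  have := @unique_subgradient_ae R n U L cU lU O u G (x1 - const_mx rho) (x1 + const_mx rho) wG.
  case=> [||N [mN N0 hN]].
  - by move=> x hx; apply/rO/box => i; have := hx i; rewrite !mxE -ler_distl.
  - by move=> x hx; apply/Uu/box => i; have := hx i; rewrite !mxE -ltr_distl => /ltW.
  exists N; split => // x /= hx; apply: hN => /= hb; apply: hx => Dx.
  have [|sG uG] := hb.
    move=> i; have := le_lt_trans (coord_le_enorm (x - x1) i) Dx.
    by rewrite !mxE ltr_distl.
  have gG := unique_subgradient_gradient cU L0 lU sG uG.
  by split => //; split => //; exact: gradient_at_one_sided.
have gL x : enorm (g x) <= n%:R * L := enorm_one_sided_le x.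
have lw x y : `|w y - w x| <= M * enorm (y - x).
  have -> : w y - w x = (U y - U x) - inner xi (y - x) +
      eta * (enorm (y - x1) - enorm (x - x1)) by rewrite /w !innerNl !innerBr; ring.
  have h1 := lipschitz_abs y x lU; have h2 := cauchy_schwarz_abs xi (y - x).
  have h3 : enorm xi * enorm (y - x) <= L * enorm (y - x) by apply: ler_wpM2r => //; exact: enorm_ge0.
  have h4 : `|eta * (enorm (y - x1) - enorm (x - x1))| <= 1 * enorm (y - x).
    rewrite normrM gtr0_norm//; apply: ler_pM => //; first exact: ltW.
    apply: le_trans (enorm_lipschitz _ _) _; rewrite (_ : y - x1 - _ = y - x)//.
    by rewrite opprB addrA subrK.
  have h5 : 0 <= n%:R * L * enorm (y - x) by apply: mulr_ge0 => //; exact: enorm_ge0.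
  apply: le_trans (ler_normD _ _) _; apply: le_trans (lerD (ler_normB _ _) h4) _.
  rewrite /M; lra.
have w0 : w x1 = 0 by rewrite /w subrr inner0r enorm0; ring.
have wlow x : `|inner d (x - x1)| + eta * enorm (x - x1) <= w x.
  by have := Ulow x; rewrite /w innerNl; lra.
have mh i : measurable_fun setT (fun x => h x ord0 i).
  rewrite (_ : (fun x => _) = (fun x => one_sided_partial U i 1 x + - xi ord0 i +
    ((eta / enorm (x - x1)) *: (x - x1)) ord0 i)); last by apply/funext => x; rewrite !mxE.
  apply: measurable_funD; last exact: measurable_cone_gradient.
  apply: measurable_funD; last exact: measurable_cst.
  by apply: (measurable_one_sided_partial cU lU); exact: normr1.
have cone_le x : enorm ((eta / enorm (x - x1)) *: (x - x1)) <= eta.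
  rewrite -scalerA enormZ gtr0_norm// -[leRHS]mulr1; apply: ler_wpM2l; first exact: ltW.
  exact: enorm_unit_le1.
have hM x : enorm (h x) <= M.
  apply: le_trans (enormD _ _) _; apply: lerD; last exact: le_trans (cone_le x) eta1.
  apply: le_trans (enormB _ _) _; apply: le_trans (lerD (gL x) xiL) _.
  by rewrite lerDl.
have gw : {ae mu, forall x, D x -> gradient_at w x (h x)}.
  apply: filterS2 aeU (negligible_point x1 n0) => x hx xx1 /hx[_ [gx gE]].
  rewrite /h gE; apply: gradient_atD; last exact: gradient_at_enorm.
  by apply: gradient_atD => //; exact: gradient_at_affine.
have cw : {ae mu, forall x, D x -> w x <= inner (h x) (x - x1)}.
  apply: filterS aeU => x hx /hx[sG [_ gE]].
  have := sG x1; rewrite /h gE /w !innerDl innerNl innerZl -[x1 - x]opprB innerNr -[inner (x - x1) _]enormE => h1.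
  have -> : eta / enorm (x - x1) * (enorm (x - x1) * enorm (x - x1)) = eta * enorm (x - x1).
    have [->|?] := eqVneq (enorm (x - x1)) 0; first by rewrite !mulr0.
    by field.
  lra.
pose c : R := 2^-1 * ((M + 1) * n.+1%:R)^-1 ^+ n.
have c0 : 0 < c by apply: mulr_gt0 => //; rewrite exprn_gt0// invr_gt0 mulr_gt0// ltr_wpDl.
(* The source term may contribute [sigma = 2 delta / (Ck + 1)], so that [Ck * (sigma / 2) <= delta];
   adding 1 guards against [Ck = 0]. *)
have dk0 : 0 < delta / (Ck + 1) * 2 by rewrite mulr_gt0// divr_gt0// ltr_wpDl.
have [e0 e00 hf] := source_term_small n0 cK nq (fO cK KO) c0 dk0.
have half_lt (t : R) : 0 < t -> t / 2 < t by move=> t0; rewrite ltr_pdivrMr// ltr_pMr// ltr1n.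
(* The first bound makes the source term small, the second puts the support of [psi] in [D]. *)
pose eps : R := Num.min (e0 / 2) (eta * rho / 2).
have eps0 : 0 < eps by rewrite lt_min !divr_gt0// mulr_gt0.
have eps1 : eps < e0.
  by apply: (@le_lt_trans _ _ (e0 / 2)); [rewrite ge_min lexx | exact: half_lt].
have er : 0 < eta * rho by exact: mulr_gt0.
have epsrho : eps / eta < rho.
  rewrite ltr_pdivrMr// mulrC; apply: (@le_lt_trans _ _ (eta * rho / 2)); last exact: half_lt.
  by rewrite ge_min lexx orbT.
pose psi := level_bump w eps.
pose Dphi x : E := (- (2 * psi x)) *: h x.
(* The constant [A0] is the flux at [xi] with the selection [Zxi]; [A] is the flux of the solution
   minus [A0]. *)
pose A0 : E := b *: Zxi + pflux p xi.
pose A x : E := b *: (Z x - Zxi) + (pflux p (G x) - pflux p xi).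
have mpsi : measurable_fun setT psi := measurable_bump eps M0 lw.
have psi_ge x : 0 <= psi x := bump_ge0 w eps x.
have psi_le x : psi x <= eps := bump_le eta0 eps0 wlow x.
have ipsi : mu.-integrable D (EFin \o psi) := bump_integrable rho M0 eta0 eps0 lw wlow.
have psiD x : ~ D x -> psi x = 0.
  move=> Dx; apply/eqP/contraT => /(bump_support eta0 wlow)[_ hx]; exfalso; apply: Dx.
  exact: lt_trans epsrho.
have mDphi i : measurable_fun D (fun x => Dphi x ord0 i).
  by apply: measurable_funTS; exact: measurable_bump_gradient M0 lw mh i.
have Dphi_le x : enorm (Dphi x) <= 2 * eps * M.
  rewrite enormZ normrN ger0_norm; last by apply: mulr_ge0.
  apply: ler_pM => //; [by apply: mulr_ge0 | exact: enorm_ge0 | by apply: ler_wpM2l].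
have intB (B : E -> E) (beta : R) : (forall i, measurable_fun D (fun x => B x ord0 i)) ->
    {ae mu, forall x, D x -> enorm (B x) <= beta} ->
    mu.-integrable D (EFin \o (fun x => inner (B x) (Dphi x))).
  move=> mB hB; apply: (@ae_bounded_integrable _ _ _ _ _ mD _ (beta * (2 * eps * M))) => //.
    exact: measurable_inner.
  apply: filterS hB => x hx Dx; apply: le_trans (cauchy_schwarz_abs _ _) _.
  by apply: ler_pM; rewrite ?enorm_ge0//; exact: hx.
have ZL : {ae mu, forall x, D x -> enorm (Z x) <= 1}.
  by apply: filterS subZ => x hx /hx; exact: subdifferential_enorm_le.
have GL : {ae mu, forall x, D x -> enorm (pflux p (G x)) <= (n%:R * L) `^ (p - 1)}.
  apply: filterS aeU => x hx /hx[_ [_ gE]]; rewrite enorm_pflux// -gE.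
  by apply: ge0_ler_powR; rewrite ?nnegrE ?subr_ge0 ?enorm_ge0// ltW.
have mPG i : measurable_fun D (fun x => pflux p (G x) ord0 i) by exact: measurable_pflux.
have mA i : measurable_fun D (fun x => A x ord0 i).
  rewrite (_ : (fun x => _) = (fun x => b * (Z x ord0 i - Zxi ord0 i) +
    (pflux p (G x) ord0 i - pflux p xi ord0 i))); last by apply/funext => x; rewrite !mxE.
  apply: measurable_funD.
    apply: measurable_funM; first exact: measurable_cst.
    by apply: measurable_funB => //; exact: measurable_cst.
  by apply: measurable_funB => //; exact: measurable_cst.
have AM : {ae mu, forall x, D x -> enorm (A x) <= MA}.
  apply: filterS2 ZL GL => x hx1 hx2 Dx; have {}hx1 := hx1 Dx; have {}hx2 := hx2 Dx.
  apply: le_trans (enormD _ _) _; apply: lerD.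
    rewrite enormZ gtr0_norm//; apply: ler_wpM2l; first exact: ltW.
    by apply: le_trans (enormB _ _) _; exact: lerD hx1 (subdifferential_enorm_le hZxi).
  by apply: le_trans (enormB _ _) _; apply: lerD => //; rewrite enorm_pflux.
have hA : {ae mu, forall x, D x -> enorm (h x) <= 2 * delta + Ck * inner (A x) (h x)}.
  apply: filterS (filterI aeU (filterI subZ AM)) => x [hx1 [hx2 hx3]] Dx.
  have [_ [_ gE]] := hx1 Dx.
  have := hCk (G x) (Z x); rewrite -{1}gE => /(_ (gL x) (hx2 Dx)) h1.
  set e := (eta / enorm (x - x1)) *: (x - x1); have e1 : enorm e <= eta := cone_le x.
  have hE : h x = (G x - xi) + e by rewrite /h gE.
  rewrite -/(A x) in h1; rewrite hE (innerDr (A x) (G x - xi)).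
  have h2 : - inner (A x) e <= MA * eta.
    rewrite -innerNl; apply: le_trans (cauchy_schwarz _ _) _; rewrite enormN.
    by apply: ler_pM => //; rewrite ?enorm_ge0//; exact: hx3.
  apply: le_trans (enormD _ _) _; apply: le_trans (lerD h1 e1) _.
  exact: (perturbed_flux_bound _ etad (ler_wpM2l Ck0 h2)).
have iA0 : mu.-integrable D (EFin \o (fun x => inner A0 (Dphi x))).
  by apply: (@intB (fun=> A0) (enorm A0)) => //; exact: (aeW mu).
have A0int : \int[mu]_(x in D) inner A0 (Dphi x) = 0.
  have iDphi i : mu.-integrable D (EFin \o (fun x => Dphi x ord0 i)).
    apply: (@ae_bounded_integrable _ _ _ _ _ mD _ (2 * eps * M)) => //.
    by apply: (aeW mu) => x _; exact: le_trans (coord_le_enorm _ _) (Dphi_le x).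
  rewrite /inner Rintegral_sum// => [|i]; last exact: (integrableZl mD _ (iDphi i)).
  apply: big1 => i _; rewrite RintegralZl//.
  by rewrite (bump_gradient_mean0 M0 eta0 eps0 epsrho lw wlow mh gw) mulr0.
have phiW : W1p0 D p (fun x => psi x ^+ 2) Dphi :=
  bump_W1p0 M0 eta0 eps0 epsrho p1 lw wlow mh hM gw.
(* The equation tested with [psi^2], after subtracting the vanishing integral of [A0]. *)
have AE : \int[mu]_(x in D) inner (A x) (Dphi x) = \int[mu]_(x in D) (f x * psi x ^+ 2).
  have iZ := intB Z 1 mZ ZL; have iP := intB (fun x => pflux p (G x)) _ mPG GL.
  rewrite -(weq _ _ phiW) -[RHS]subr0 -A0int -RintegralZl//.
  rewrite -RintegralD//; last exact: (integrableZl mD _ iZ).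
  rewrite -RintegralB//; last first.
    exact: (integrableD mD (integrableZl mD _ iZ) iP).
  apply: eq_Rintegral => x _; rewrite /A /A0 !(innerDl, innerNl, innerZl); ring.
(* The equation is taken on the open ball, the bound on the source on a compact set; [psi] vanishes
   outside [D], so the integrals agree. *)
have intK (k : E -> R) : (forall x, ~ D x -> k x = 0) ->
    \int[mu]_(x in D) k x = \int[mu]_(x in K) k x.
  move=> k0; rewrite Rintegral_support// [RHS]Rintegral_support// => x Kx.
  by apply: k0 => /DK.
have iKf : mu.-integrable K (EFin \o f) := Lp_integrable n0 cK nq (fO cK KO).
have iDf : mu.-integrable D (EFin \o f) := integrableS mK mD DK iKf.
have psi2_le x : psi x ^+ 2 <= eps * psi x by rewrite expr2; apply: ler_wpM2r.
have ifphi : mu.-integrable D (EFin \o (fun x => f x * psi x ^+ 2)).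
  apply: (integrable_mul_bounded mD (M := eps * eps) iDf).
    by apply: measurable_funTS; exact: measurable_funX.
  move=> x _; rewrite ger0_norm ?sqr_ge0//; apply: le_trans (psi2_le x) _.
  by apply: ler_wpM2l => //; exact: ltW.
have ifpsi : mu.-integrable D (EFin \o (fun x => `|f x| * psi x)).
  apply: (integrable_mul_bounded mD (M := eps)) => //.
  - exact: (integrable_norm iDf).
  - exact: measurable_funTS.
  - by move=> x _; rewrite ger0_norm.
(* The bound [psi^2 <= eps psi] supplies the factor [eps] that [source_term_small] expects. *)
have small : - (\int[mu]_(x in D) inner (A x) (Dphi x)) <=
    (delta / (Ck + 1) * 2) * \int[mu]_(x in D) psi x.
  rewrite AE; apply: le_trans (ler_norm _) _; rewrite normrN.
  apply: le_trans (le_normr_Rintegral mD ifphi) _.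
  apply: (@le_trans _ _ (\int[mu]_(x in D) (eps * (`|f x| * psi x)))).
    apply: le_Rintegral => //; [exact: (integrable_norm ifphi) | exact: (integrableZl mD _ ifpsi) |].
    move=> x _; rewrite normrM (ger0_norm (sqr_ge0 _)) [leRHS]mulrCA; exact: ler_wpM2l.
  rewrite RintegralZl// !intK//; first apply: hf => //.
  - by move=> x; rewrite psi_ge psi_le.
  - rewrite -intK//; exact: (bump_mass M0 eta0 eps0 epsrho lw w0 wlow).
  - by move=> x /psiD ->; rewrite mulr0.
have := bump_flux M0 eta0 eps0 epsrho lw w0 wlow mh hM gw cw d0 Ck0 mA AM hA small.
have Ckd : Ck * (delta / (Ck + 1)) <= delta.
  rewrite mulrCA ler_piMr ?(ltW delta0)// ler_pdivrMr ?ltr_wpDl// mul1r.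
  by rewrite lerDl.
apply/negP; rewrite -ltNge mulfK//.
apply: (@le_lt_trans _ _ (n.+2%:R * (3 * delta))).
  apply: ler_wpM2l => //; have -> : 3 * delta = 2 * delta + delta by ring.
  by rewrite lerD2l.
rewrite (_ : n.+2%:R * (3 * delta) = 3 / 4 * enorm d).
  by rewrite gtr_pMl// ltr_pdivrMr// mul1r ltr_nat.
by rewrite /delta; field; rewrite -natrD addSn pnatr_eq0.
Qed.

End uniqueness_main.

Theorem theorem1 (R : realType) (n : nat) (b p : R) (q : \bar R)
    (O : set 'rV[R]_n) (f u : 'rV[R]_n -> R) :
  0 < b -> 1 < p ->
  domain O ->
  (n%:R%:E < q)%E -> Lp_loc O q f ->
  convex_on O u -> weak_solution b p O f u ->
  C1_on O u.
Proof.
move=> b0 p1 [oO _ _] nq fO cu uO x Ox.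
have [r r0 [rO [U [L L0 [cU lU Uu]]]]] := convex_on_local_extension oO Ox cu.
(* Uniqueness is applied at every point [y] of the ball, with the radius that remains around [y]. *)
have uniq y xi zeta : enorm (y - x) < r -> subdifferential U y xi ->
    subdifferential U y zeta -> zeta = xi.
  move=> yr; have r1 : 0 < r - enorm (y - x) by rewrite subr_gt0.
  have ball z : enorm (z - y) < r - enorm (y - x) -> enorm (z - x) < r.
    by rewrite ltrBrDr; apply: le_lt_trans; exact: enorm_triangle.
  move=> h1 h2; apply: (weak_solution_unique_subgradient cU L0 lU b0 p1 nq fO uO r1) h2 h1.
    by move=> z /ball; exact: rO.
  by move=> z /ball; exact: Uu.
have grad y xi : enorm (y - x) < r -> subdifferential U y xi -> gradient_at u y xi.
  move=> yr sxi; have r1 : 0 < r - enorm (y - x) by rewrite subr_gt0.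
  apply: (@gradient_at_local _ _ U u y xi _ r1) => [z zy|].
    by apply: Uu; move: zy; rewrite ltrBrDr; apply: le_lt_trans; exact: enorm_triangle.
  apply: (unique_subgradient_gradient cU L0 lU sxi) => zeta; exact: uniq.
have xr : enorm (x - x) < r by rewrite subrr enorm0.
have [xi sxi] := subdifferential_nonempty cU x.
have [df pf] := gradient_at_differentiable (grad x xi xr sxi).
split => // i; apply/(@cvgrPdist_lt _ _ _ (nbhs x)) => e e0; rewrite pf.
(* The partial derivatives at [y] are the coordinates of a subgradient at [y], and for [y] near [x]
   those subgradients are close to [xi]. *)
have [d d0 hd] := unique_subgradient_near L0 lU (fun zeta => uniq x xi zeta xr sxi) e0.
apply: filterS2 (enorm_near x d0) (enorm_near x r0) => y yd yr.
have [zeta szeta] := subdifferential_nonempty cU y.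
have [_ ->] := gradient_at_differentiable (grad y zeta yr szeta).
rewrite distrC; apply: le_lt_trans (hd y zeta yd szeta).
by have := coord_le_enorm (zeta - xi) i; rewrite !mxE.
Qed.
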